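(* Let $d\ge 1$, let $\psi$ be a nonzero entire function on $\mathbb C^d$ and let $\varphi$ be a holomorphic self-mapping of $\mathbb C^d$. (a) The maximal weighted composition operator $C_{\psi,\varphi,\max}$ on $\mathcal F^2(\mathbb C^d)$ is real symmetric (i.e. $C_{\psi,\varphi,\max}=C_{\psi,\varphi,\max}^*$) if and only if there exist a $d\times d$ matrix $Q$ with $Q=Q^*$, a vector $q\in\mathbb C^d$ and $\theta\in\mathbb R$ such that $$\psi(z)=\theta e^{\langle z,q\rangle},\qquad \varphi(z)=Qz+q\qquad(z\in\mathbb C^d).$$ Likewise, $C_{\psi,\varphi,\max}$ is skew-real symmetric (i.e. $C_{\psi,\varphi,\max}=-C_{\psi,\varphi,\max}^*$) if and only if $\psi,\varphi$ have the same forms with $Q=Q^*$, $q\in\mathbb C^d$ and $\theta\in i\mathbb R$. (b) Let $C_{\psi,\varphi}$ be a weighted composition operator on $\mathcal F^2(\mathbb C^d)$ (i.e. $C_{\psi,\varphi}\preceq C_{\psi,\varphi,\max}$). Then $C_{\psi,\varphi}$ is real symmetric (respectively skew-real symmetric) if and only if $C_{\psi,\varphi}=C_{\psi,\varphi,\max}$ and $\psi(z)=\theta e^{\langle z,q\rangle}$, $\varphi(z)=Qz+q$ with $Q=Q^*$, $q\in\mathbb C^d$ and $\theta\in\mathbb R$ (respectively $\theta\in i\mathbb R$).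
   Context: For $u,z\in\mathbb C^d$, $\langle u,z\rangle=\sum_{j=1}^d u_j\overline{z_j}$ and $|z|^2=\langle z,z\rangle$. The Fock space $\mathcal F^2(\mathbb C^d)$ is the Hilbert space of entire functions $f$ on $\mathbb C^d$ with $\|f\|^2=\pi^{-d}\int_{\mathbb C^d}|f(z)|^2e^{-|z|^2}\,dV(z)<\infty$ ($dV$ Lebesgue measure), with the corresponding inner product; its reproducing kernels are $K_z(u)=e^{\langle u,z\rangle}$. For a matrix $M$, $M^{\mathbf t}$ is the transpose, $\overline M$ the entrywise conjugate, and $M^*=\overline M^{\mathbf t}$. For (possibly unbounded) operators, $T\preceq S$ means $\mathrm{dom}(T)\subseteq\mathrm{dom}(S)$ and $Tf=Sf$ on $\mathrm{dom}(T)$; $T^*$ is the Hilbert space adjoint. Given $\psi,\varphi$, set $E_{\psi,\varphi}(f)=\psi\cdot (f\circ\varphi)$. The maximal weighted composition operator $C_{\psi,\varphi,\max}$ has domain $\{f\in\mathcal F^2(\mathbb C^d):E_{\psi,\varphi}(f)\in\mathcal F^2(\mathbb C^d)\}$ and acts by $C_{\psi,\varphi,\max}f=E_{\psi,\varphi}(f)$. A weighted composition operator is any operator $C_{\psi,\varphi}$ with $C_{\psi,\varphi}\preceq C_{\psi,\varphi,\max}$. *)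

(* Defs.v *)
From HB Require Import structures.
From mathcomp Require Import all_boot all_order all_algebra.
From mathcomp Require Import all_classical all_reals all_analysis.
From mathcomp Require Import complex.
Set Implicit Arguments. Unset Strict Implicit. Unset Printing Implicit Defensive.
Import Order.TTheory GRing.Theory Num.Theory.
Local Open Scope ring_scope.
Local Open Scope classical_set_scope.

Section Fock.
Variable R : realType.
Local Notation C := (complex R).

Definition cvec (d : nat) := 'cV[C]_d.
Definition cfun (d : nat) := cvec d -> C.

Definition cdot d (u z : cvec d) : C := \sum_(j < d) u j 0 * conjc (z j 0).

Definition cre (w : C) : R := let: Complex a _ := w in a.
Definition cim (w : C) : R := let: Complex _ b := w in b.

Definition cabs (w : C) : R := Num.sqrt (cre w ^+ 2 + cim w ^+ 2).
Definition cnorm2 d (z : cvec d) : R :=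
  \sum_(j < d) (cre (z j 0) ^+ 2 + cim (z j 0) ^+ 2).
Definition cnorm d (z : cvec d) : R := Num.sqrt (cnorm2 z).

Definition cexp (w : C) : C :=
  Complex (expR (cre w) * cos (cim w)) (expR (cre w) * sin (cim w)).

Definition entire d (f : cfun d) : Prop :=
  forall z : cvec d, exists a : cvec d, forall eps : R, 0 < eps ->
    exists delta : R, 0 < delta /\ forall h : cvec d, cnorm h < delta ->
      cabs (f (z + h) - f z - \sum_(j < d) a j 0 * h j 0) <= eps * cnorm h.

Definition holo_map d (phi : cvec d -> cvec d) : Prop :=
  forall j : 'I_d, entire (fun z => phi z j 0).

(* Lebesgue measure dV on C^d = R^(2d), integrals computed as iterated
   integrals over the 2d real coordinates x_0, ..., x_(2d-1), where
   z_j = x_(2j) + i x_(2j+1). *)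
Definition vec_of_coords d (v : nat -> R) : cvec d :=
  \col_(j < d) Complex (v (j.*2)%N) (v (j.*2.+1)%N).

Fixpoint iter_int (n : nat) (F : (nat -> R) -> \bar R) : \bar R :=
  match n with
  | 0%N => F (fun _ => 0)
  | n'.+1 => \int[@lebesgue_measure R]_(x in setT)
               iter_int n' (fun v => F (fun k => if k == n' then x else v k))
  end.

Fixpoint iter_Rint (n : nat) (F : (nat -> R) -> R) : R :=
  match n with
  | 0%N => F (fun _ => 0)
  | n'.+1 => Rintegral (@lebesgue_measure R) setT (fun x =>
               iter_Rint n' (fun v => F (fun k => if k == n' then x else v k)))
  end.

Definition intCd_nneg d (F : cvec d -> R) : \bar R :=
  iter_int (d.*2) (fun v => (F (vec_of_coords d v))%:E).

Definition intCd d (F : cfun d) : C :=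
  Complex (iter_Rint (d.*2) (fun v => cre (F (vec_of_coords d v))))
          (iter_Rint (d.*2) (fun v => cim (F (vec_of_coords d v)))).

Definition fock_weight d (f : cfun d) (z : cvec d) : R :=
  cabs (f z) ^+ 2 * expR (- cnorm2 z).

Definition fock d : set (cfun d) :=
  [set f | entire f /\
    (intCd_nneg (fock_weight f) < +oo)%E].

Definition fock_ip d (f g : cfun d) : C :=
  Complex ((pi ^+ d)^-1) 0 *
  intCd (fun z => f z * conjc (g z) * Complex (expR (- cnorm2 z)) 0).

(* A (possibly unbounded) operator on F^2 is given by its domain D
   (a subset of F^2) and its action A on D. *)
Definition is_subspace d (D : set (cfun d)) : Prop :=
  D `<=` @fock d /\ D (fun _ => 0) /\
  (forall f g, D f -> D g -> D (f \+ g)) /\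
  (forall (c : C) f, D f -> D (fun z => c * f z)).

Definition adjoint_graph d (D : set (cfun d)) (A : cfun d -> cfun d)
  (g h : cfun d) : Prop :=
  @fock d g /\ @fock d h /\ forall f, D f -> fock_ip (A f) g = fock_ip f h.

Definition op_eq_adj d (D : set (cfun d)) (A : cfun d -> cfun d) : Prop :=
  forall g h : cfun d, (D g /\ h = A g) <-> adjoint_graph D A g h.

Definition op_eq_neg_adj d (D : set (cfun d)) (A : cfun d -> cfun d) : Prop :=
  forall g h : cfun d,
    (D g /\ h = A g) <-> adjoint_graph D A g (fun z => - h z).

Definition wcomp d (psi : cfun d) (phi : cvec d -> cvec d) (f : cfun d)
  : cfun d := fun z => psi z * f (phi z).

Definition cmax_dom d (psi : cfun d) (phi : cvec d -> cvec d) : set (cfun d) :=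
  [set f | @fock d f /\ @fock d (wcomp psi phi f)].

Definition adjmx d (Q : 'M[C]_d) : 'M[C]_d := (map_mx (@conjc R) Q)^T.

Definition affine_form d (psi : cfun d) (phi : cvec d -> cvec d)
  (theta : C) (Q : 'M[C]_d) (q : cvec d) : Prop :=
  Q = adjmx Q /\ (forall z, psi z = theta * cexp (cdot z q)) /\
  (forall z, phi z = Q *m z + q).

End Fock.

(* Main.v *)
(* Testing the adjoint relation on reproducing kernels gives
     psi(u) exp<phi u, z> = +- conj(psi z) exp<u, phi z>.
   At z = 0 this determines psi, and then exp(<chi u, z> - <u, chi z>) = 1 with
   chi = phi - phi 0; along a real line the exponent is continuous, takes values
   in 2 i pi Z and vanishes at 0, so chi is symmetric, i.e. given by a Hermitian
   matrix.

   Conversely, kernels lie in the maximal domain, so the adjoint is contained in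
   C_max, and what remains is <Cf, g> = <f, Cg> for all f, g in that domain with
   Cf(z) = exp<z, q> f(Qz + q).  A unitary change of variables makes Q diagonal
   with real entries lam and makes q >= 0 where lam = 1.  In each coordinate the
   map is z |-> lam z + q.  If lam <> 1, cut off to discs around its fixed point;
   on each circle a contour shift moves lam from one factor to the other.  If
   lam = 1, cut off to vertical strips with a Gaussian damping in Im z, and shift
   the contour in Im z.  The truncated forms agree by Fubini, one coordinate at a
   time, and the cutoffs are removed by dominated convergence; the truncated
   integrals converge because a Fock function is O(exp(|z|^2 / 2)). *)
Require Import Defs.
From HB Require Import structures.
From mathcomp Require Import all_boot all_order all_algebra.
From mathcomp Require Import all_classical all_reals all_analysis.
From mathcomp Require Import complex.
From mathcomp Require Import measurable_realfun ring lra.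
Set Implicit Arguments. Unset Strict Implicit. Unset Printing Implicit Defensive.
Import Order.TTheory GRing.Theory Num.Theory numFieldNormedType.Exports.
Local Open Scope ring_scope.
Local Open Scope classical_set_scope.

(** * Complex numbers and entire functions of one variable *)

(** The maximal domain offers no evident core: an [f] for which [f] and [Cf] lie in the Fock space
    is not visibly a graph limit of kernels, so <Cf, g> = <f, Cg> is proved on the integrals
    themselves. The only data are the pointwise bound exp(|z|^2 / 2) and the integrability of the
    two densities. The eigenvalues of [Q] are arbitrary reals, so a density in which the map has
    moved from [f] to [g] in some coordinates only has no reason to be integrable. Hence all
    coordinates are cut off before any is treated, and the cutoffs are removed together, for the two
    pure densities alone. Away from lam = 1 there is a fixed point, and discs about it suit
    rotations. A translation has none in general, which accounts for the strips; these are
    unbounded, so a damping is needed, and it must be holomorphic in the contour variable. The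
    cutoffs of the two sides then differ, harmlessly, since both tend to 1. Identities are proved
    for real parts; imaginary parts follow on multiplying [f] by -i. Both symmetries are treated at
    once through a sign s = 1 or -1. *)

Section ComplexBasics.
Variable R : realType.
Local Notation C := (complex R).
Implicit Types (w z a b h : C) (x y : R).

Lemma creD z w : cre (z + w) = cre z + cre w. Proof. by case: z w => [a b] [c d]. Qed.
Lemma cimD z w : cim (z + w) = cim z + cim w. Proof. by case: z w => [a b] [c d]. Qed.
Lemma creN z : cre (- z) = - cre z. Proof. by case: z. Qed.
Lemma cimN z : cim (- z) = - cim z. Proof. by case: z. Qed.
Lemma creB z w : cre (z - w) = cre z - cre w. Proof. by rewrite creD creN. Qed.
Lemma cimB z w : cim (z - w) = cim z - cim w. Proof. by rewrite cimD cimN. Qed.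
Lemma creM z w : cre (z * w) = cre z * cre w - cim z * cim w.
Proof. by case: z w => [a b] [c d]. Qed.
Lemma cimM z w : cim (z * w) = cre z * cim w + cim z * cre w.
Proof. by case: z w => [a b] [c d]. Qed.
Lemma creJ z : cre (conjc z) = cre z. Proof. by case: z. Qed.
Lemma cimJ z : cim (conjc z) = - cim z. Proof. by case: z. Qed.
Lemma cre0 : cre (0 : C) = 0. Proof. by []. Qed.
Lemma cim0 : cim (0 : C) = 0. Proof. by []. Qed.
Lemma cre1 : cre (1 : C) = 1. Proof. by []. Qed.
Lemma cim1 : cim (1 : C) = 0. Proof. by []. Qed.
Lemma creC x y : cre (Complex x y) = x. Proof. by []. Qed.
Lemma cimC x y : cim (Complex x y) = y. Proof. by []. Qed.
Definition cE := (creD, cimD, creN, cimN, creM, cimM, creJ, cimJ, cre0, cim0, cre1, cim1, creC, cimC).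

Lemma cre_cim_inj z w : cre z = cre w -> cim z = cim w -> z = w.
Proof. by case: z w => [a b] [c d] /= -> ->. Qed.
Lemma cK z : Complex (cre z) (cim z) = z. Proof. by case: z. Qed.

Lemma cre_sum I (r : seq I) (P : pred I) (F : I -> C) :
  cre (\sum_(i <- r | P i) F i) = \sum_(i <- r | P i) cre (F i).
Proof. by apply: (big_morph _ creD). Qed.
Lemma cim_sum I (r : seq I) (P : pred I) (F : I -> C) :
  cim (\sum_(i <- r | P i) F i) = \sum_(i <- r | P i) cim (F i).
Proof. by apply: (big_morph _ cimD). Qed.

Lemma cabsE z : cabs z = ComplexField.Normc.normc z. Proof. by case: z. Qed.
Lemma cabs_ge0 z : 0 <= cabs z. Proof. exact: sqrtr_ge0. Qed.
Lemma sqr_cabs z : cabs z ^+ 2 = cre z ^+ 2 + cim z ^+ 2.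
Proof. by rewrite sqr_sqrtr// addr_ge0// sqr_ge0. Qed.
Lemma cabsM z w : cabs (z * w) = cabs z * cabs w.
Proof. by rewrite !cabsE ComplexField.Normc.normcM. Qed.
Lemma cabs0 : cabs (0 : C) = 0. Proof. by rewrite cabsE ComplexField.Normc.normc0. Qed.
Lemma cabs1 : cabs (1 : C) = 1. Proof. by rewrite cabsE ComplexField.Normc.normc1. Qed.
Lemma cabs_eq0 z : cabs z = 0 -> z = 0.
Proof. by rewrite cabsE; exact: ComplexField.Normc.eq0_normc. Qed.
Lemma ler_cabsD z w : cabs (z + w) <= cabs z + cabs w.
Proof. by rewrite !cabsE; exact: le_normcD. Qed.
Lemma cabsN z : cabs (- z) = cabs z. Proof. by rewrite !cabsE normcN. Qed.
Lemma cabsJ z : cabs (conjc z) = cabs z.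
Proof. by case: z => x y; rewrite /cabs /= sqrrN. Qed.
Lemma ler_cre z : `|cre z| <= cabs z.
Proof. by rewrite -sqrtr_sqr ler_sqrt ?addr_ge0 ?sqr_ge0// lerDl sqr_ge0. Qed.
Lemma ler_cim z : `|cim z| <= cabs z.
Proof. by rewrite -sqrtr_sqr ler_sqrt ?addr_ge0 ?sqr_ge0// lerDr sqr_ge0. Qed.
Lemma cabs_ler z : cabs z <= `|cre z| + `|cim z|.
Proof.
rewrite -(@ler_pXn2r _ 2) ?nnegrE ?addr_ge0 ?cabs_ge0//.
rewrite sqr_cabs sqrrD !real_normK ?num_real//.
by rewrite lerD2r lerDl mulrn_wge0// mulr_ge0.
Qed.
Lemma cabs_real x : cabs (Complex x 0) = `|x|.
Proof. by rewrite /cabs /= expr0n addr0 sqrtr_sqr. Qed.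
Lemma cabs_imag y : cabs (Complex 0 y) = `|y|.
Proof. by rewrite /cabs /= expr0n add0r sqrtr_sqr. Qed.
Lemma mulcJ z : z * conjc z = Complex (cabs z ^+ 2) 0.
Proof. by rewrite sqr_cabs; case: z => x y; apply: cre_cim_inj; rewrite !cE/=; ring. Qed.
Lemma conjcD z w : conjc (z + w) = conjc z + conjc w.
Proof. exact: rmorphD. Qed.
Lemma conjcM z w : conjc (z * w) = conjc z * conjc w.
Proof. exact: rmorphM. Qed.
Lemma conjcN z : conjc (- z) = - conjc z.
Proof. exact: rmorphN. Qed.

Lemma cexpD z w : cexp (z + w) = cexp z * cexp w.
Proof.
by case: z w => [a b] [c d]; apply: cre_cim_inj; rewrite !cE /= expRD ?cosD ?sinD; ring.
Qed.
Lemma cexp0 : cexp (0 : C) = 1.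
Proof. by apply: cre_cim_inj; rewrite /= expR0 ?cos0 ?sin0 ?mulr1 ?mulr0. Qed.
Lemma cabs_cexp z : cabs (cexp z) = expR (cre z).
Proof.
by rewrite /cabs /= !exprMn -mulrDr cos2Dsin2 mulr1 sqrtr_sqr ger0_norm// expR_ge0.
Qed.
Lemma cexpJ z : cexp (conjc z) = conjc (cexp z).
Proof. by apply: cre_cim_inj; rewrite /= ?cE /= ?cosN ?sinN ?mulrN//. Qed.
Lemma cexp_neq0 z : cexp z != 0.
Proof.
apply/eqP => /(congr1 (@cabs R)); rewrite cabs_cexp cabs0 => /eqP.
by rewrite gt_eqF// expR_gt0.
Qed.
Lemma cexp_real x : cexp (Complex x 0) = Complex (expR x) 0.
Proof. by rewrite /cexp /= cos0 sin0 mulr1 mulr0. Qed.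

(** The estimate in [entire] for one variable, with the derivative exposed so that product and chain
    rules can be stated. *)
Definition cderiv (F : C -> C) z a := forall eps : R, 0 < eps ->
  exists delta : R, 0 < delta /\ forall h, cabs h < delta ->
    cabs (F (z + h) - F z - a * h) <= eps * cabs h.

Definition entire1 (F : C -> C) := forall z, exists a, cderiv F z a.

Lemma cderiv_lip F z a : cderiv F z a ->
  exists delta : R, 0 < delta /\ forall h, cabs h < delta ->
    cabs (F (z + h) - F z) <= (cabs a + 1) * cabs h.
Proof.
move=> /(_ 1 ltr01) [d [d0 H]]; exists d; split=> // h /H; rewrite mul1r => {}H.
have -> : F (z + h) - F z = (F (z + h) - F z - a * h) + a * h by ring.
by apply: (le_trans (ler_cabsD _ _)); rewrite cabsM; lra.
Qed.

Lemma entire1_cst c : entire1 (fun=> c).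
Proof.
move=> z; exists 0 => e e0; exists 1; split=> // h _.
by rewrite mul0r !subr0 subrr cabs0 mulr_ge0 ?cabs_ge0// ltW.
Qed.

Lemma entire1_id : entire1 id.
Proof.
move=> z; exists 1 => e e0; exists 1; split=> // h _.
have -> : z + h - z - 1 * h = 0 by ring.
by rewrite cabs0 mulr_ge0 ?cabs_ge0// ltW.
Qed.

(** Schwarz reflection; it turns the antiholomorphic factor conj(G) of an inner product into an
    entire function of a contour parameter. *)
Lemma entire1_conj F : entire1 F -> entire1 (fun z => conjc (F (conjc z))).
Proof.
move=> H z; have [a Ha] := H (conjc z); exists (conjc a) => e /Ha [d [d0 Hd]].
exists d; split=> // h hd; have := Hd (conjc h); rewrite cabsJ => /(_ hd).
by rewrite -[X in X <= _ -> _]cabsJ !(conjcD, conjcN, conjcM) conjcK.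
Qed.

Lemma cderivM F G z a b : cderiv F z a -> cderiv G z b ->
  cderiv (fun w => F w * G w) z (a * G z + F z * b).
Proof.
move=> HF HG e e0.
have [d1 [d10 H1]] := cderiv_lip HG.
pose K := cabs (G z) + cabs b + 1 + cabs (F z) + cabs a * (cabs b + 1).
have K0 : 0 < K.
  have ? := cabs_ge0 (G z); have ? := cabs_ge0 b; have ? := cabs_ge0 (F z).
  have : 0 <= cabs a * (cabs b + 1) by rewrite mulr_ge0 ?addr_ge0 ?cabs_ge0.
  rewrite /K; lra.
have e10 : 0 < e / K by rewrite divr_gt0.
have [d2 [d20 H2]] := HF _ e10; have [d3 [d30 H3]] := HG _ e10.
exists (Num.min (Num.min d1 1) (Num.min (Num.min d2 d3) (e / K))).
split; first by rewrite !lt_min ltr01 d10 d20 d30 e10.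
move=> h; rewrite !lt_min => /andP[/andP[h1 h11] /andP[/andP[h2 h3] h4]].
move: (H1 _ h1) (H2 _ h2) (H3 _ h3) => {}H1 {}H2 {}H3.
set e1 := e / K in H2 H3 h4 e10 *.
have -> : e = e1 * K by rewrite /e1 divfK// gt_eqF.
have -> : F (z + h) * G (z + h) - F z * G z - (a * G z + F z * b) * h =
  (F (z + h) - F z - a * h) * G (z + h) + (F z * (G (z + h) - G z - b * h)
   + a * h * (G (z + h) - G z)) by ring.
apply: (le_trans (ler_cabsD _ _)); rewrite !cabsM.
apply: (le_trans (lerD (lexx _) (ler_cabsD _ _))); rewrite !cabsM.
have HG' : cabs (G (z + h)) <= cabs (G z) + cabs b + 1.
  have -> : G (z + h) = G z + (G (z + h) - G z) by ring.
  apply: (le_trans (ler_cabsD _ _)); rewrite -addrA lerD2l.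
  by apply: (le_trans H1); apply: ler_piMr; [rewrite addr_ge0 ?cabs_ge0|exact: ltW].
have -> : e1 * K * cabs h = e1 * cabs h * (cabs (G z) + cabs b + 1) +
   (cabs (F z) * (e1 * cabs h) + cabs a * cabs h * ((cabs b + 1) * e1)).
  by rewrite /K; ring.
apply: lerD; first by rewrite ler_pM ?cabs_ge0.
apply: lerD; first by rewrite ler_wpM2l ?cabs_ge0.
rewrite ler_wpM2l ?mulr_ge0 ?cabs_ge0//; apply: (le_trans H1).
by rewrite ler_wpM2l ?addr_ge0 ?cabs_ge0// ltW.
Qed.

Lemma cderiv_comp F G z a b : cderiv F z a -> cderiv G (F z) b ->
  cderiv (fun w => G (F w)) z (b * a).
Proof.
move=> HF HG e e0.
have [d1 [d10 H1]] := cderiv_lip HF.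
pose K := cabs a + 1 + cabs b.
have K0 : 0 < K.
  by have ? := cabs_ge0 a; have ? := cabs_ge0 b; rewrite /K; lra.
have e10 : 0 < e / K by rewrite divr_gt0.
have [d2 [d20 H2]] := HF _ e10; have [d3 [d30 H3]] := HG _ e10.
have a1 : 0 < cabs a + 1 by rewrite ltr_pwDr ?cabs_ge0.
exists (Num.min d1 (Num.min d2 (d3 / (cabs a + 1)))).
split; first by rewrite !lt_min d10 d20 divr_gt0.
move=> h; rewrite !lt_min => /andP[h1 /andP[h2 h3]].
move: (H1 _ h1) (H2 _ h2) => {}H1 {}H2.
have := H3 (F (z + h) - F z); set k := F (z + h) - F z in H1 H2 *.
have kd : cabs k < d3.
  by apply: (le_lt_trans H1); rewrite mulrC -ltr_pdivlMr.
move=> /(_ kd); have -> : F z + k = F (z + h) by rewrite /k; ring.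
move=> {}H3; set e1 := e / K in H2 H3 *.
have -> : e = e1 * K by rewrite /e1 divfK// gt_eqF.
have -> : G (F (z + h)) - G (F z) - b * a * h =
   (G (F (z + h)) - G (F z) - b * k) + b * (k - a * h) by ring.
apply: (le_trans (ler_cabsD _ _)); rewrite cabsM.
have -> : e1 * K * cabs h = e1 * ((cabs a + 1) * cabs h) + cabs b * (e1 * cabs h).
  by rewrite /K; ring.
apply: lerD; last by rewrite ler_wpM2l ?cabs_ge0.
by apply: (le_trans H3); rewrite ler_wpM2l// ltW.
Qed.

Lemma entire1M F G : entire1 F -> entire1 G -> entire1 (fun z => F z * G z).
Proof.
move=> HF HG z; have [a Ha] := HF z; have [b Hb] := HG z.
by eexists; exact: cderivM Ha Hb.
Qed.
Lemma entire1_comp F G : entire1 F -> entire1 G -> entire1 (fun z => G (F z)).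
Proof.
move=> HF HG z; have [a Ha] := HF z; have [b Hb] := HG (F z).
by eexists; exact: cderiv_comp Ha Hb.
Qed.
Lemma entire1_affine a b : entire1 (fun z => a * z + b).
Proof.
move=> z; exists a => e e0; exists 1; split=> // h _.
have -> : a * (z + h) + b - (a * z + b) - a * h = 0 by ring.
by rewrite cabs0 mulr_ge0 ?cabs_ge0// ltW.
Qed.
Lemma entire1D F G : entire1 F -> entire1 G -> entire1 (fun z => F z + G z).
Proof.
move=> HF HG z; have [a Ha] := HF z; have [b Hb] := HG z.
exists (a + b) => e e0.
have e20 : 0 < e / 2 by rewrite divr_gt0.
have [d1 [d10 H1]] := Ha _ e20; have [d2 [d20 H2]] := Hb _ e20.
exists (Num.min d1 d2); split; first by rewrite lt_min d10.
move=> h; rewrite lt_min => /andP[/H1 {}H1 /H2 {}H2].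
have -> : F (z + h) + G (z + h) - (F z + G z) - (a + b) * h =
 (F (z + h) - F z - a * h) + (G (z + h) - G z - b * h) by ring.
by apply: (le_trans (ler_cabsD _ _)); lra.
Qed.

Lemma is_derive_eps (f : R -> R) (x df : R) : is_derive x 1 f df ->
  forall e : R, 0 < e -> exists d : R, 0 < d /\ forall h : R, `|h| < d ->
   `|f (x + h) - f x - df * h| <= e * `|h|.
Proof.
move=> [Hd Hv] e e0.
have := Hd; rewrite /derivable => Hc.
have : h^-1 *: (f (h *: 1 + x) - f x) @[h --> 0^'] --> df by rewrite -Hv.
move=> /cvgrPdist_le /(_ e e0); rewrite near_withinE => /nbhs_ballP [d /= d0 Hb].
exists d; split=> // h hd.
have [->|h0] := eqVneq h 0; first by rewrite addr0 subrr mulr0 subrr normr0 mulr0.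
have := Hb h; rewrite /ball /= sub0r normrN => /(_ hd h0).
rewrite /GRing.scale /= mulr1 (addrC h x) => H.
have -> : f (x + h) - f x - df * h = - (df - h^-1 * (f (x + h) - f x)) * h.
  by field.
by rewrite normrM normrN ler_wpM2r.
Qed.

Lemma cderiv_cexp0 : cderiv (@cexp R) 0 1.
Proof.
move=> e e0.
(* The real and imaginary parts below cost at most 4 e1 |h| and 6 e1 |h|, whence the 10; e1 <= 1
   absorbs products of errors. *)
have [e1 [e10 e11 e1e]] : exists e1 : R, [/\ 0 < e1, e1 <= 1 & 10 * e1 <= e].
  exists (Num.min 1 (e / 10)); rewrite lt_min ltr01 divr_gt0// ge_min lexx.
  by split=> //; rewrite -ler_pdivlMl// mulrC ge_min lexx orbT.
have [d1 [d10 H1]] := is_derive_eps (is_derive_expR (0 : R)) e10.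
have [d2 [d20 H2]] := is_derive_eps (is_derive_cos (0 : R)) e10.
have [d3 [d30 H3]] := is_derive_eps (is_derive_sin (0 : R)) e10.
exists (Num.min e1 (Num.min d1 (Num.min d2 d3))); split.
  by rewrite !lt_min e10 d10 d20.
move=> h; rewrite !lt_min => /and4P[h0 h1 h2 h3].
have hx := ler_cre h; have hy := ler_cim h.
have := H1 _ (le_lt_trans hx h1); have := H2 _ (le_lt_trans hy h2).
have := H3 _ (le_lt_trans hy h3).
rewrite !add0r expR0 cos0 sin0 oppr0 mul0r !mul1r !subr0 !addr0.
move: (cabs_ge0 h) => h'; rewrite cexp0.
set x := cre h in hx *; set y := cim h in hy *; set r := cabs h in h0 hx hy h' *.
move=> {}H3 {}H2 {}H1.
apply: (le_trans (cabs_ler _)); rewrite !cE -/x -/y oppr0 addr0.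
have E : `|expR x - 1| <= 2 * r.
  have -> : expR x - 1 = (expR x - 1 - x) + x by ring.
  apply: (le_trans (ler_normD _ _)).
  have := ler_wpM2r (normr_ge0 x) e11; lra.
have r1 : r <= 1 by lra.
have A1 : `|expR x * cos y + -1 - x| <= 4 * e1 * r.
  have -> : expR x * cos y + -1 - x = (expR x - 1 - x) + expR x * (cos y - 1) by ring.
  apply: (le_trans (ler_normD _ _)); rewrite normrM.
  have : `|expR x| <= 3.
    have -> : expR x = (expR x - 1) + 1 by ring.
    by apply: (le_trans (ler_normD _ _)); rewrite normr1; lra.
  move=> /ler_pM /(_ H2) => /(_ (normr_ge0 _) (normr_ge0 _)).
  have := ler_wpM2l (ltW e10) hx; have := ler_wpM2l (ltW e10) hy; lra.
have A2 : `|expR x * sin y - y| <= 6 * e1 * r.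
  have -> : expR x * sin y - y = (sin y - y) + (expR x - 1) * (sin y - y) + (expR x - 1) * y by ring.
  apply: (le_trans (ler_normD _ _)); apply: (le_trans (lerD (ler_normD _ _) (lexx _))).
  rewrite !normrM.
  have := ler_pM (normr_ge0 _) (normr_ge0 _) E H3.
  have := ler_pM (normr_ge0 _) (normr_ge0 _) E hy.
  have := ler_wpM2l (ltW e10) hy.
  have : r * r <= e1 * r by rewrite ler_wpM2r// ltW.
  have : r * (e1 * `|y|) <= 1 * (e1 * r).
    by apply: ler_pM; rewrite ?mulr_ge0//; [exact: ltW|rewrite ler_wpM2l// ltW].
  have := mulr_ge0 (ltW e10) h'; lra.
have := ler_wpM2r h' e1e; lra.
Qed.

Lemma entire1_cexp : entire1 (@cexp R).
Proof.
move=> z; exists (cexp z) => e e0.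
have k0 : 0 < cabs (cexp z) by rewrite cabs_cexp expR_gt0.
have [d [d0 H]] := cderiv_cexp0 (divr_gt0 e0 k0).
exists d; split=> // h /H; rewrite add0r cexp0 mul1r => {}H.
have -> : cexp (z + h) - cexp z - cexp z * h = cexp z * (cexp h - 1 - h).
  by rewrite cexpD; ring.
by rewrite cabsM mulrC -ler_pdivlMr// mulrAC.
Qed.

End ComplexBasics.

(** * Goursat's theorem for rectangles *)

Section Goursat.
Variable R : realType.
Local Notation C := (complex R).
Local Notation mu := (@lebesgue_measure R).
Local Notation I f a b := (Rintegral mu `[a, b] f).

Lemma itv_integrable (f : R -> R) a b : continuous f ->
  mu.-integrable `[a, b] (EFin \o f).
Proof.
move=> cf; apply: continuous_compact_integrable; first exact: segment_compact.
exact: continuous_subspaceT.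
Qed.

Lemma Rint_add (f : R -> R) a b c : continuous f -> a <= c -> c <= b ->
  I f a b = I f a c + I f c b.
Proof.
move=> cf ac cb.
have := @Rintegral_itvB R f (BLeft a) (BRight b) c (itv_integrable a b cf).
rewrite !bnd_simp => /(_ ac cb) /eqP; rewrite subr_eq => /eqP ->; rewrite addrC.
by rewrite Rintegral_itv_obnd_cbnd//; apply: integrableS (itv_integrable c b cf) => //;
  apply: subset_itvr; rewrite bnd_simp.
Qed.

Lemma Rint_cst (k : R) a b : a <= b -> I (fun=> k) a b = k * (b - a).
Proof.
move=> ab; rewrite Rintegral_cst//= lebesgue_measure_itv/= lte_fin.
case: ltP => //= ba; have -> : a = b by apply/eqP; rewrite eq_le ab ba.
by rewrite subrr.
Qed.

Lemma cont_cst (k : R) : continuous (fun _ : R => k).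
Proof. by move=> x; exact: cvg_cst. Qed.

Lemma contB (f g : R -> R) : continuous f -> continuous g -> continuous (fun x => f x - g x).
Proof. by move=> cf cg x; exact: (cvgB (cf x) (cg x)). Qed.

Lemma Rint_est (f : R -> R) a b k e : continuous f -> a <= b ->
  (forall x, a <= x <= b -> `|f x - k| <= e) -> `|I f a b - k * (b - a)| <= e * (b - a).
Proof.
move=> cf ab H.
have ck := @cont_cst k; have ce := @cont_cst e.
rewrite -(Rint_cst k ab) -RintegralB//; last 2 first.
- exact: itv_integrable.
- exact: itv_integrable.
apply: (le_trans (le_normr_Rintegral _ _)) => //.
  by apply: itv_integrable; exact: contB.
rewrite -(Rint_cst e ab); apply: le_Rintegral => //.
- have := itv_integrable a b (contB cf ck) => /integrable_norm; exact.
- exact: itv_integrable.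
Qed.

Lemma entire1_cont (F : C -> C) z : entire1 F -> forall e : R, 0 < e ->
  exists d : R, 0 < d /\ forall h, cabs h < d -> cabs (F (z + h) - F z) <= e.
Proof.
move=> /(_ z) [a /cderiv_lip [d [d0 H]]] e e0.
have a1 : 0 < cabs a + 1 by rewrite ltr_pwDr ?cabs_ge0.
exists (Num.min d (e / (cabs a + 1))); split; first by rewrite lt_min d0 divr_gt0.
move=> h; rewrite lt_min => /andP[/H h1]; rewrite ltr_pdivlMr// mulrC => h2.
exact: le_trans h1 (ltW h2).
Qed.

Lemma entire1_continuous_re (F : C -> C) (g : R -> C) : entire1 F ->
  (forall x h, cabs (g (x + h) - g x) <= `|h|) ->
  continuous (fun x => cre (F (g x))).
Proof.
move=> EF Hg x; apply/cvgrPdist_le => e e0.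
have [d [d0 H]] := entire1_cont (g x) EF e0.
near=> t; rewrite distrC -creB.
apply: (le_trans (ler_cre _)).
have -> : F (g t) = F (g x + (g t - g x)) by congr F; ring.
apply: H; have := Hg x (t - x); have -> : x + (t - x) = t by ring.
move=> h; apply: (le_lt_trans h); rewrite distrC; near: t.
by apply: cvgr_dist_lt => //; exact: cvg_id.
Unshelve. all: by end_near. Qed.

Lemma entire1_continuous_im (F : C -> C) (g : R -> C) : entire1 F ->
  (forall x h, cabs (g (x + h) - g x) <= `|h|) ->
  continuous (fun x => cim (F (g x))).
Proof.
move=> EF Hg.
have -> : (fun x => cim (F (g x))) = (fun x => cre (Complex 0 (-1) * F (g x) )).
  by apply/funext => x; rewrite !cE; ring.
apply: (@entire1_continuous_re (fun z => Complex 0 (-1) * F z)) => //.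
by apply: entire1M => //; exact: entire1_cst.
Qed.

Lemma line_lip_re (c : R) x h : cabs (Complex (x + h) c - Complex x c) <= `|h|.
Proof.
have -> : Complex (x + h) c - Complex x c = Complex h 0.
  by apply: cre_cim_inj; rewrite !cE; ring.
by rewrite cabs_real.
Qed.
Lemma line_lip_im (c : R) x h : cabs (Complex c (x + h) - Complex c x) <= `|h|.
Proof.
have -> : Complex c (x + h) - Complex c x = Complex 0 h.
  by apply: cre_cim_inj; rewrite !cE; ring.
by rewrite cabs_imag.
Qed.

Section Rect.
Variable E : C -> C.
Hypothesis hE : entire1 E.
Let u x y := cre (E (Complex x y)).
Let v x y := cim (E (Complex x y)).

Let cu c : continuous (fun x => u x c).
Proof. by move=> x; apply: (@entire1_continuous_re E (fun x => Complex x c) hE (line_lip_re c)). Qed.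
Let cv c : continuous (v c).
Proof. by move=> x; apply: (@entire1_continuous_im E (Complex c) hE (line_lip_im c)). Qed.

Let cuu c1 c2 : continuous (fun x => cre (E (Complex x c1)) - cre (E (Complex x c2))).
Proof. exact: (contB (@cu c1) (@cu c2)). Qed.
Let cvv c1 c2 : continuous (fun y => cim (E (Complex c1 y)) - cim (E (Complex c2 y))).
Proof. exact: (contB (@cv c1) (@cv c2)). Qed.

(** Real part of the contour integral of E dz around the rectangle with lower left corner a + i c
    and sides [l], [m]: real parts on bottom minus top and, since dz = i dy there, imaginary parts
    on left minus right. *)
Definition rect_form (E : C -> C) (a c l m : R) : R :=
  I (fun x => cre (E (Complex x c)) - cre (E (Complex x (c + m)))) a (a + l) +
  I (fun y => cim (E (Complex a y)) - cim (E (Complex (a + l) y))) c (c + m).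

Let G := rect_form E.

(** Replace [E] by its first-order expansion at (p, q): the affine part contributes Im(al) m l from
    the horizontal sides and the opposite from the vertical ones, so only the remainder, at most e
    (l + m) at each point, is left. *)
Let local_bound (p q : R) (e : R) : 0 < e -> exists d : R, 0 < d /\
  forall a c l m, 0 <= l -> 0 <= m -> l + m < d ->
   a <= p <= a + l -> c <= q <= c + m -> `|G a c l m| <= 2 * e * (l + m) ^+ 2.
Proof.
move=> e0; have [al Hal] := hE (Complex p q); have [d [d0 H]] := Hal _ e0.
exists d; split=> // a c l m l0 m0 lmd /andP[ap pal] /andP[cq qcm].
pose err z := E z - E (Complex p q) - al * (z - Complex p q).
have Herr z : cabs (z - Complex p q) <= l + m -> cabs (err z) <= e * (l + m).
  move=> zlm; have := H (z - Complex p q) (le_lt_trans zlm lmd).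
  have -> : Complex p q + (z - Complex p q) = z by ring.
  by move=> h; apply: (le_trans h); rewrite ler_wpM2l// ltW.
have dist x y : a <= x <= a + l -> c <= y <= c + m ->
    cabs (Complex x y - Complex p q) <= l + m.
  move=> /andP[? ?] /andP[? ?]; apply: (le_trans (cabs_ler _)); rewrite !cE.
  by apply: lerD; rewrite ler_norml; apply/andP; split; lra.
have Ez z : E z = err z + E (Complex p q) + al * (z - Complex p q).
  by rewrite /err; ring.
have B1 : `|I (fun x => u x c - u x (c + m)) a (a + l) - (cim al * m) * (a + l - a)|
    <= 2 * e * (l + m) * (a + l - a).
  apply: Rint_est => [||x xa].
  - exact: contB.
  - by rewrite lerDl.
  have h1 := Herr _ (dist x c xa _); have h2 := Herr _ (dist x (c + m) xa _).
  have -> : u x c - u x (c + m) - cim al * m = cre (err (Complex x c)) - cre (err (Complex x (c + m))).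
    by rewrite /u (Ez (Complex x c)) (Ez (Complex x (c + m))) !cE; ring.
  apply: (le_trans (ler_normB _ _)).
  have := le_trans (ler_cre _) (h1 _); have := le_trans (ler_cre _) (h2 _).
  rewrite !lexx !lerDl m0 => /(_ isT) ? /(_ isT) ?; lra.
have B2 : `|I (fun y => v a y - v (a + l) y) c (c + m) - (- cim al * l) * (c + m - c)|
    <= 2 * e * (l + m) * (c + m - c).
  apply: Rint_est => [||y yc].
  - exact: contB.
  - by rewrite lerDl.
  have h1 := Herr _ (dist a y _ yc); have h2 := Herr _ (dist (a + l) y _ yc).
  have -> : v a y - v (a + l) y - - cim al * l = cim (err (Complex a y)) - cim (err (Complex (a + l) y)).
    by rewrite /v (Ez (Complex a y)) (Ez (Complex (a + l) y)) !cE; ring.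
  apply: (le_trans (ler_normB _ _)).
  have := le_trans (ler_cim _) (h1 _); have := le_trans (ler_cim _) (h2 _).
  rewrite !lexx !lerDl l0 => /(_ isT) ? /(_ isT) ?; lra.
rewrite /G /rect_form; move: B1 B2.
set A := Rintegral _ _ _; set B := Rintegral _ _ _ => B1 B2.
have -> : A + B = (A - (cim al * m) * (a + l - a)) + (B - (- cim al * l) * (c + m - c)).
  by ring.
apply: (le_trans (ler_normD _ _)); apply: (le_trans (lerD B1 B2)).
by rewrite le_eqVlt; apply/orP; left; apply/eqP; ring.
Qed.

Let split_h a c l m : 0 <= l -> 0 <= m ->
  G a c (l + l) m = G a c l m + G (a + l) c l m.
Proof.
move=> l0 m0; rewrite /G /rect_form (@Rint_add _ a _ (a + l)); last 3 first.
- exact: cuu.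
- by rewrite lerDl.
- by rewrite lerD2l lerDl.
have -> : I (fun y => cim (E (Complex a y)) - cim (E (Complex (a + (l + l)) y))) c (c + m) =
  I (fun y => cim (E (Complex a y)) - cim (E (Complex (a + l) y))) c (c + m) +
  I (fun y => cim (E (Complex (a + l) y)) - cim (E (Complex (a + (l + l)) y))) c (c + m).
  rewrite -RintegralD//; last 2 first.
  - exact: (itv_integrable _ _ (@cvv _ _)).
  - exact: (itv_integrable _ _ (@cvv _ _)).
  by apply: eq_Rintegral => y _; ring.
rewrite !addrA; ring.
Qed.

Let split_v a c l m : 0 <= l -> 0 <= m ->
  G a c l (m + m) = G a c l m + G a (c + m) l m.
Proof.
move=> l0 m0; rewrite /G /rect_form (@Rint_add _ c _ (c + m)); last 3 first.
- exact: cvv.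
- by rewrite lerDl.
- by rewrite lerD2l lerDl.
have -> : I (fun x => cre (E (Complex x c)) - cre (E (Complex x (c + (m + m))))) a (a + l) =
  I (fun x => cre (E (Complex x c)) - cre (E (Complex x (c + m)))) a (a + l) +
  I (fun x => cre (E (Complex x (c + m))) - cre (E (Complex x (c + (m + m))))) a (a + l).
  rewrite -RintegralD//; last 2 first.
  - exact: (itv_integrable _ _ (@cuu _ _)).
  - exact: (itv_integrable _ _ (@cuu _ _)).
  by apply: eq_Rintegral => y _; ring.
rewrite !addrA; ring.
Qed.

Let quarter a c l m K : 0 <= l -> 0 <= m -> 4 * K <= `|G a c (l + l) (m + m)| ->
  exists a' c', [/\ a <= a' <= a + l, c <= c' <= c + m & K <= `|G a' c' l m|].
Proof.
move=> l0 m0; rewrite split_h ?addr_ge0// !split_v// => H.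
have [|h1] := leP K `|G a c l m|; first by exists a, c; rewrite !lexx !lerDl l0 m0.
have [|h2] := leP K `|G a (c + m) l m|; first by exists a, (c + m); rewrite !lexx !lerDl l0 m0.
have [|h3] := leP K `|G (a + l) c l m|; first by exists (a + l), c; rewrite !lexx !lerDl l0 m0.
exists (a + l), (c + m); rewrite !lexx !lerDl l0 m0; split => //.
have := le_trans H (ler_normD _ _).
have := ler_normD (G a c l m) (G a (c + m) l m).
have := ler_normD (G (a + l) c l m) (G (a + l) (c + m) l m).
lra.
Qed.

(** Goursat's bisection. A modulus K > 0 leaves at least K / 4^n on nested rectangles of sides l /
    2^n and m / 2^n; near their common point the local bound is quadratic in the size with an
    arbitrarily small factor, a contradiction. *)
Lemma goursat_rectangle a c l m : 0 <= l -> 0 <= m -> rect_form E a c l m = 0.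
Proof.
move=> l0 m0; apply/eqP; rewrite -normr_le0 -/G leNgt; apply/negP => K0.
set K := `|G a c l m| in K0.
pose h n : R := (2^-1) ^+ n.
have hS n : h n = h n.+1 + h n.+1 by rewrite /h exprS; field.
have h0 n : 0 <= h n by rewrite exprn_ge0.
pose ok n (p : R * R) := K * (h n) ^+ 2 <= `|G p.1 p.2 (l * h n) (m * h n)|.
(* Totalised over all states so that [choice] applies; where [ok] fails, the corner is returned
   unchanged. *)
have step (s : nat * (R * R)) : exists p' : R * R, ok s.1 s.2 ->
   [/\ ok s.1.+1 p', s.2.1 <= p'.1 <= s.2.1 + l * h s.1.+1 & s.2.2 <= p'.2 <= s.2.2 + m * h s.1.+1].
  case: s => n [x y] /=.
  have [okn|] := pselect (ok n (x, y)); last by exists (x, y).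
  have := @quarter x y (l * h n.+1) (m * h n.+1) (K * h n.+1 ^+ 2).
  rewrite -!mulrDr -hS => Q.
  have [//|//||x' [y' [A1 A2 A3]]] := Q.
  - by rewrite mulr_ge0.
  - by rewrite mulr_ge0.
  - by apply: le_trans okn; rewrite le_eqVlt; apply/orP; left; rewrite (hS n); apply/eqP; ring.
  by exists (x', y').
have [nxt Hnxt] := choice step.
pose st := fix st n := if n is n'.+1 then nxt (n', st n') else (a, c).
have okst n : ok n (st n).
  elim: n => [|n IH]; last by have [] := Hnxt (n, st n) IH.
  by rewrite /ok /h /= expr0 !mulr1 expr1n mulr1.
have s1 n : (st n).1 <= (st n.+1).1 <= (st n).1 + l * h n.+1 by have [] := Hnxt (n, st n) (okst n).
have s2 n : (st n).2 <= (st n.+1).2 <= (st n).2 + m * h n.+1 by have [] := Hnxt (n, st n) (okst n).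
(* Lower ends increase and upper ends decrease, so the supremum of the lower ends lies in every
   interval. *)
have lim (t : nat -> R) (L : R) : 0 <= L -> (forall n, t n <= t n.+1 <= t n + L * h n.+1) ->
    exists p, forall n, t n <= p <= t n + L * h n.
  move=> L0 Ht.
  have up n k : t n <= t (n + k)%N.
    elim: k => [|k IH]; first by rewrite addn0.
    by rewrite addnS; have /andP[+ _] := Ht (n + k)%N; exact: le_trans.
  have dn n k : t (n + k)%N + L * h (n + k)%N <= t n + L * h n.
    elim: k => [|k IH]; first by rewrite addn0.
    apply: le_trans IH; rewrite addnS; have /andP[_ +] := Ht (n + k)%N.
    by rewrite (hS (n + k)%N); lra.
  have all n k : t k <= t n + L * h n.
    have Lh j : 0 <= L * h j by rewrite mulr_ge0.
    have [nk|kn] := leqP n k.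
      have := dn n (k - n)%N; rewrite subnKC// => ?; have := Lh k; lra.
    have := up k (n - k)%N; rewrite subnKC ?(ltnW kn)// => ?; have := Lh n; lra.
  have hs : has_sup (range t).
    split; first by exists (t 0%N), 0%N.
    by exists (t 0%N + L * h 0%N) => _ [k _ <-].
  exists (sup (range t)) => n; apply/andP; split.
    by apply: sup_upper_bound => //; exists n.
  by apply: sup_le_ub; [exists (t 0%N), 0%N|move=> _ [k _ <-]].
have [p Hp] := lim (fun n => (st n).1) l l0 s1.
have [q Hq] := lim (fun n => (st n).2) m m0 s2.
(* Then 2 e (l + m)^2 < K; the added 1 avoids a zero denominator for a degenerate rectangle. *)
pose e := K / (4 * ((l + m) ^+ 2 + 1)).
have lm1 : 0 < (l + m) ^+ 2 + 1 by rewrite ltr_wpDl// sqr_ge0.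
have e0 : 0 < e by rewrite divr_gt0// mulr_gt0.
have [d [d0 H]] := local_bound p q e0.
have [n Hn] : exists n, (l + m) * h n < d.
  have : h n @[n --> \oo] --> (0 : R).
    by apply: cvg_expr; rewrite ger0_norm ?invr_ge0// invf_lt1// ltr1n.
  move=> /cvgrPdist_lt /(_ (d / (l + m + 1))).
  have lmp : 0 < l + m + 1 by rewrite ltr_wpDl// addr_ge0.
  rewrite divr_gt0// => /(_ isT) [n _ /(_ n (leqnn n))] /=.
  rewrite sub0r normrN ger0_norm// ltr_pdivlMr// => hh; exists n.
  apply: le_lt_trans hh; rewrite mulrC ler_wpM2l// lerDl//.
have := H (st n).1 (st n).2 (l * h n) (m * h n).
rewrite -mulrDl !mulr_ge0// => /(_ isT isT Hn (Hp n) (Hq n)).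
move=> /(le_trans (okst n)); rewrite exprMn [2 * e * _]mulrA ler_pM2r; last by rewrite exprn_gt0// exprn_gt0.
rewrite leNgt => /negP; apply.
have -> : 2 * e * (l + m) ^+ 2 = (K / 2) * ((l + m) ^+ 2 / ((l + m) ^+ 2 + 1)).
  by rewrite /e; field; rewrite gt_eqF.
apply: (@le_lt_trans _ _ (K / 2 * 1)); last by rewrite mulr1 ltr_pdivrMr// ltr_pMr// ltr1n.
by rewrite ler_wpM2l// ?divr_ge0// ?(ltW K0)// ler_pdivrMr// mul1r lerDl.
Qed.

End Rect.
End Goursat.

(** * Measure theory and contour shifts *)

Section Measurability.
Variable R : realType.
Local Notation C := (complex R).

Lemma measurable_floor_fiber d (T : measurableType d) (f : T -> R) (k : int) :
  measurable_fun setT f -> measurable [set t | Num.floor (f t) = k].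
Proof.
move=> mf; rewrite (_ : [set t | _] = setT `&` f @^-1` `[k%:~R, (k + 1)%:~R[%classic).
  exact: mf.
apply/seteqP; split=> t /=; rewrite in_itv /=.
  by move=> /eqP; rewrite floor_eq.
by case=> _ /= /floor_def.
Qed.

(* Rounding the coordinates gives maps with countably many values. *)
Lemma measurable_fun_continuous_coords (I : finType) d (T : measurableType d)
    (c : I -> T -> R) (G : (I -> R) -> R) :
  (forall i, measurable_fun setT (c i)) ->
  (forall v (e : R), 0 < e -> exists dl : R, 0 < dl /\ forall w,
     (forall i, `|w i - v i| < dl) -> `|G w - G v| <= e) ->
  measurable_fun setT (fun t => G (c^~ t)).
Proof.
move=> mc cG.
pose key n t : {ffun I -> int} := [ffun i => Num.floor (c i t * n.+1%:R)].
pose g n (k : {ffun I -> int}) : R := G (fun i => (k i)%:~R / n.+1%:R).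
apply: (@measurable_fun_cvg _ _ _ _ (fun n t => g n (key n t))).
- move=> n _ B mB; rewrite setTI.
  rewrite (_ : _ @^-1` _ = \bigcup_m [set t | exists k, [/\ pickle k = m, B (g n k) & key n t = k]]).
    apply: bigcup_measurable => m _.
    have [[k Hk]|Hk] := pselect (exists k, pickle k = m /\ B (g n k)); last first.
      rewrite (_ : [set t | _] = set0) => [|//]; first exact: measurable0.
      by apply/seteqP; split=> t //= [k [k1 k2 _]]; apply: Hk; exists k.
    rewrite (_ : [set t | _] = \bigcap_(i in [set: I]) [set t | Num.floor (c i t * n.+1%:R) = k i]).
      apply: fin_bigcap_measurable => [|i _]; first exact: finite_finset.
      apply: (@measurable_floor_fiber _ _ (fun t => c i t * n.+1%:R)).
      by apply: measurable_funM => //; exact: mc.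
    have [Hk1 Hk2] := Hk; apply/seteqP; split=> t /=.
      move=> [k' [k'm _ kt]] i _ /=.
      have kk : k' = k by apply: (pcan_inj pickleK); rewrite k'm -Hk1.
      by move: kt; rewrite kk => <-; rewrite ffunE.
    move=> Ht; exists k; split=> //; apply/ffunP => i; rewrite ffunE; exact: Ht.
  apply/seteqP; split=> t /=.
    by move=> Bt; exists (pickle (key n t)) => //=; exists (key n t).
  by case=> m _ /= [k [_ Bk kt]]; rewrite kt.
- move=> t _; apply/cvgrPdist_le => e e0.
  have [dl [dl0 H]] := cG (c^~ t) e e0.
  near=> n; rewrite distrC; apply: H => i.
  rewrite ffunE.
  have n0 : (0 : R) < n.+1%:R by [].
  have /andP[F1 F2] := floor_itv (c i t * n.+1%:R).
  set f := (Num.floor _)%:~R in F1 *; have {}F2 : c i t * n.+1%:R < f + 1 by rewrite intrD in F2.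
  rewrite distrC ger0_norm; last by rewrite subr_ge0 ler_pdivrMr.
  apply: (@le_lt_trans _ _ (n.+1%:R^-1)).
    by rewrite -(ler_pM2r n0) mulrBl divfK ?gt_eqF// mulVf ?gt_eqF//; lra.
  near: n; exact: near_infty_natSinv_lt (PosNum dl0).
Unshelve. all: by end_near. Qed.

Definition cmeas d (T : measurableType d) (f : T -> C) :=
  measurable_fun setT (fun t => cre (f t)) /\ measurable_fun setT (fun t => cim (f t)).

Section cmeas.
Context d (T : measurableType d).
Implicit Types f g : T -> C.

Lemma cmeas_cst c : cmeas (fun _ : T => c).
Proof. by split; exact: measurable_cst. Qed.
Lemma cmeas_real (f : T -> R) : measurable_fun setT f -> cmeas (fun t => Complex (f t) 0).
Proof. by move=> mf; split=> //; exact: measurable_cst. Qed.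
Lemma cmeasD f g : cmeas f -> cmeas g -> cmeas (fun t => f t + g t).
Proof.
move=> [f1 f2] [g1 g2]; split.
  by under eq_fun do rewrite creD; exact: measurable_funD.
by under eq_fun do rewrite cimD; exact: measurable_funD.
Qed.
Lemma cmeasN f : cmeas f -> cmeas (fun t => - f t).
Proof.
move=> [f1 f2]; split.
  by under eq_fun do rewrite creN; exact: measurableT_comp.
by under eq_fun do rewrite cimN; exact: measurableT_comp.
Qed.
Lemma cmeasM f g : cmeas f -> cmeas g -> cmeas (fun t => f t * g t).
Proof.
move=> [f1 f2] [g1 g2]; split.
  by under eq_fun do rewrite creM; apply: measurable_funB; exact: measurable_funM.
by under eq_fun do rewrite cimM; apply: measurable_funD; exact: measurable_funM.
Qed.
Lemma cmeasJ f : cmeas f -> cmeas (fun t => conjc (f t)).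
Proof.
move=> [f1 f2]; split.
  by under eq_fun do rewrite creJ.
by under eq_fun do rewrite cimJ; exact: measurableT_comp.
Qed.
Lemma cmeas_sum n (f : 'I_n -> T -> C) : (forall i, cmeas (f i)) ->
  cmeas (fun t => \sum_(i < n) f i t).
Proof.
move=> mf; elim: n f mf => [|n IH] f mf.
  by under eq_fun do rewrite big_ord0; exact: cmeas_cst.
under eq_fun do rewrite big_ord_recr /=; apply: cmeasD => //.
exact: (IH (fun i => f (widen_ord (leqnSn n) i))).
Qed.
Lemma measurable_cabs f : cmeas f -> measurable_fun setT (fun t => cabs (f t)).
Proof.
move=> [f1 f2]; rewrite /cabs; apply: measurableT_comp => //.
  by apply: continuous_measurable_fun; exact: sqrt_continuous.
by apply: measurable_funD; exact: measurable_funX.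
Qed.
Lemma cmeas_exp f : cmeas f -> cmeas (fun t => cexp (f t)).
Proof.
move=> [f1 f2].
have me : measurable_fun setT (fun t => expR (cre (f t))) by exact: measurableT_comp.
split; apply: measurable_funM => //; apply: measurableT_comp => //;
  apply: continuous_measurable_fun; [exact: continuous_cos|exact: continuous_sin].
Qed.

End cmeas.

Lemma cmeas_entire1 d (T : measurableType d) (F : C -> C) (f : T -> C) :
  entire1 F -> cmeas f -> cmeas (fun t => F (f t)).
Proof.
move=> EF [f1 f2].
have H (G : C -> R) : (forall z w, `|G z - G w| <= cabs (z - w)) ->
    measurable_fun setT (fun t => G (F (f t))).
  move=> GL; pose c (b : bool) t := if b then cre (f t) else cim (f t).
  have := @measurable_fun_continuous_coords bool _ T c
     (fun v => G (F (Complex (v true) (v false)))).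
  rewrite /c /=; under eq_fun do rewrite cK; apply; first by case.
  move=> v e e0; have [dl [dl0 Hd]] := entire1_cont (Complex (v true) (v false)) EF e0.
  exists (dl / 2); split; first by rewrite divr_gt0.
  move=> w wv; apply: (le_trans (GL _ _)).
  have := Hd (Complex (w true) (w false) - Complex (v true) (v false)).
  rewrite addrCA subrr addr0; apply; apply: (le_lt_trans (cabs_ler _)); rewrite !cE.
  by have := wv true; have := wv false; lra.
split; apply: H => z w; first by rewrite -creB ler_cre.
by rewrite -cimB ler_cim.
Qed.

End Measurability.

(** * Gaussian integrability and contour shifts *)

Section RealIntegrals.
Variable R : realType.
Local Notation C := (complex R).
Local Notation mu := (@lebesgue_measure R).

(** Lebesgue measure is determined by its values on half-open intervals, whose lengths a translation
    preserves. *)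
Lemma lebesgue_shift (a : R) (A : set R) : measurable A ->
  pushforward mu ((fun x => x + a) : _ -> measurableTypeR R) A = mu A.
Proof.
move=> mA; apply/esym/lebesgue_measure_unique => //=; first exact: measurable_funD.
move=> _ _ [[x y]] _ <-.
rewrite /pushforward /= (_ : _ @^-1` _ = `]x - a, y - a]%classic); last first.
  by apply/seteqP; split => t /=; rewrite !in_itv /= ltrBlDr lerBrDr.
rewrite !lebesgue_measure_itv /= !lte_fin ltrD2r.
by case: ifP => // _; rewrite -!EFinB; congr EFin; ring.
Qed.

Lemma integral_shift (a : R) (f : R -> \bar R) : measurable_fun setT f ->
  (forall x, 0 <= f x)%E -> (\int[mu]_x f (x + a)%R = \int[mu]_x f x)%E.
Proof.
move=> mf f0.
have mh : measurable_fun setT ((fun x => x + a) : measurableTypeR R -> measurableTypeR R) by exact: measurable_funD.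
transitivity (\int[pushforward mu ((fun x => (x + a)%R) : measurableTypeR R -> measurableTypeR R)]_x f x)%E.
  have := @ge0_integral_pushforward _ _ _ _ _ _ mh mu setT f measurableT mf (fun y _ => f0 y).
  by rewrite preimage_setT => ->.
by apply: eq_measure_integral => //= A mA _; exact: lebesgue_shift.
Qed.

Lemma gauss_integrable (k : R) : 0 < k ->
  mu.-integrable setT (fun x => (expR (- (k * x ^+ 2)))%:E).
Proof.
(* The normal law with 1 / (2 s^2) = k; its density is a constant multiple of the Gaussian. *)
move=> k0; pose s := (Num.sqrt (k *+ 2))^-1.
have k2 : 0 < k *+ 2 by rewrite pmulrn_lgt0.
have s0 : s != 0 by rewrite invr_neq0// gt_eqF// sqrtr_gt0.
have := @integrable_normal_pdf R 0 s.
rewrite normal_pdfE// => H.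
have p0 := normal_peak_gt0 s0.
have E : (fun x : R => (expR (- (k * x ^+ 2)))%:E) =
   (fun x => (((normal_peak s)^-1)%:E * (normal_peak s * normal_fun 0 s x)%:E)%E).
  apply/funext => x; rewrite -EFinM mulKf ?gt_eqF// /normal_fun subr0.
  congr (expR _)%:E; rewrite mulNr; congr (- _); rewrite /s exprVn sqr_sqrtr ?ltW//.
  by field; rewrite gt_eqF.
by rewrite E; exact: integrableZl.
Qed.

Lemma cvg_Rint_setT (f : R -> R) : mu.-integrable setT (EFin \o f) ->
  Rintegral mu `[- n%:R, n%:R] f @[n --> \oo] --> Rintegral mu setT f.
Proof.
move=> intf; have mf := measurable_int _ intf.
pose fn (n : nat) : R -> \bar R := (EFin \o f) \_ `[- n%:R, n%:R].
have [] := @dominated_convergence _ _ _ mu setT measurableT fn (EFin \o f) (abse \o (EFin \o f)).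
- by move=> n; apply: (iffLR (measurable_restrictT _ _)) => //; exact: measurable_funTS.
- exact: mf.
- apply: aeW => x _; apply: cvg_near_cst.
  have [N HN] : exists N : nat, `|x| <= N%:R.
    exists (Num.truncn `|x|).+1; exact/ltW/truncnS_gt.
  exists N => // n /= Nn; rewrite /fn patchE ifT// inE /= in_itv /= -ler_norml.
  by rewrite (le_trans HN)// ler_nat.
- exact: integrable_abse.
- apply: aeW => x n _; rewrite /fn patchE; case: ifP => //= _.
  by rewrite normr0 lee_fin.
move=> _ _ H.
apply: fine_cvg; rewrite fineK; last exact: integrable_fin_num.
apply: cvg_trans H; apply: near_eq_cvg; near=> n.
by rewrite /= [RHS]integral_mkcond.
Unshelve. all: by end_near. Qed.

Section Shifts.
Variable E : C -> C.
Hypothesis hE : entire1 E.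

(** By periodicity the two vertical sides of the rectangle over [0, T] cancel. *)
Lemma periodic_shift (T : R) c m : 0 <= T -> 0 <= m ->
  (forall z, E (z + Complex T 0) = E z) ->
  Rintegral mu `[0, T] (fun x => cre (E (Complex x c))) =
  Rintegral mu `[0, T] (fun x => cre (E (Complex x (c + m)))).
Proof.
move=> T0 m0 per; have := goursat_rectangle hE 0 c T0 m0; rewrite /rect_form add0r.
have -> : (fun y => cim (E (Complex 0 y)) - cim (E (Complex T y))) = (fun=> 0).
  apply/funext => y; have := per (Complex 0 y).
  have -> : Complex 0 y + Complex T 0 = Complex T y by apply: cre_cim_inj; rewrite !cE; ring.
  by move=> ->; rewrite subrr.
have lr c' : continuous (fun x => cre (E (Complex x c'))).
  by move=> x; apply: (@entire1_continuous_re _ E (fun x => Complex x c') hE (line_lip_re c')).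
rewrite RintegralB//; [|exact: (itv_integrable 0 T (@lr _))..].
by rewrite Rint_cst ?lerDl// mul0r addr0 => /eqP; rewrite subr_eq0 => /eqP.
Qed.

(** The vertical sides at -n and n carry at most 2 K m exp(-k n^2), which vanishes in the limit,
    while the horizontal sides tend to integrals over the whole line. *)
Lemma line_shift (m k K : R) : 0 <= m -> 0 < k ->
  (forall x y, 0 <= y <= m -> cabs (E (Complex x y)) <= K * expR (- (k * x ^+ 2))) ->
  Rintegral mu setT (fun x => cre (E (Complex x 0))) =
  Rintegral mu setT (fun x => cre (E (Complex x m))).
Proof.
move=> m0 k0 H.
have lr c' : continuous (fun x => cre (E (Complex x c'))).
  by move=> x; apply: (@entire1_continuous_re _ E (fun x => Complex x c') hE (line_lip_re c')).
have li c' : continuous (fun x => cim (E (Complex c' x))).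
  by move=> x; apply: (@entire1_continuous_im _ E (Complex c') hE (line_lip_im c')).
have int y : 0 <= y <= m -> mu.-integrable setT (EFin \o (fun x => cre (E (Complex x y)))).
  move=> hy; apply: (le_integrable _ _ _ (integrableZl _ K (gauss_integrable k0))) => //.
  - by apply/measurable_EFinP; exact: continuous_measurable_fun.
  - move=> x _ /=; rewrite lee_fin; apply: (le_trans (ler_cre _)).
    by apply: (le_trans (H _ _ hy)); exact: ler_norm.
pose u y n := Rintegral mu `[- n%:R, n%:R] (fun x => cre (E (Complex x y))).
have c0 : u 0 n @[n --> \oo] --> Rintegral mu setT (fun x => cre (E (Complex x 0))).
  by apply: cvg_Rint_setT; apply: int; rewrite lexx m0.
have cm : u m n @[n --> \oo] --> Rintegral mu setT (fun x => cre (E (Complex x m))).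
  by apply: cvg_Rint_setT; apply: int; rewrite lexx m0.
have K0 : 0 <= K.
  have := H 0 0; rewrite lexx m0 => /(_ isT); rewrite expr0n mulr0 oppr0 expR0 mulr1.
  exact/le_trans/cabs_ge0.
(* Since n^2 >= n, the Gaussian is traded for a geometric sequence. *)
have diff n : `|u 0 n - u m n| <= (2 * K * m) * (expR (- k)) ^+ n.
  have nn : - n%:R <= n%:R :> R by rewrite (@le_trans _ _ 0)// oppr_le0.
  have := @goursat_rectangle _ E hE (- n%:R) 0 (n%:R + n%:R) m _ m0.
  rewrite addr_ge0// => /(_ isT); rewrite /rect_form !add0r addKr.
  rewrite RintegralB//; [|exact: (itv_integrable _ _ (@lr _))..].
  rewrite -/(u 0 n) -/(u m n) => /eqP; rewrite addr_eq0 => /eqP ->; rewrite normrN.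
  have := @Rint_est _ (fun y => cim (E (Complex (- n%:R) y)) - cim (E (Complex n%:R y))) 0 m 0
    (2 * K * (expR (- k)) ^+ n) _ m0.
  rewrite !subr0 mul0r subr0.
  have -> : 2 * K * expR (- k) ^+ n * m = 2 * K * m * expR (- k) ^+ n by ring.
  apply; first exact: (contB (@li _) (@li _)).
  move=> y hy; rewrite subr0; apply: (le_trans (ler_normB _ _)).
  have Kn : K * expR (- (k * n%:R ^+ 2)) <= K * expR (- k) ^+ n.
    rewrite ler_wpM2l// -expRM_natl ler_expR mulrN lerN2 mulrC (ler_wpM2l (ltW k0))//.
    by rewrite -natrX ler_nat expnS expn1; case: (n) => // j; rewrite leq_pmulr.
  have h1 := le_trans (ler_cim _) (H (- n%:R) y hy).
  have h2 := le_trans (ler_cim _) (H n%:R y hy).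
  rewrite sqrrN in h1; lra.
have d0 : (u 0 n - u m n) @[n --> \oo] --> 0.
  apply/cvgr0Pnorm_le => e e0.
  have : expR (- k) ^+ n @[n --> \oo] --> (0 : R).
    by apply: cvg_expr; rewrite ger0_norm ?expR_ge0// expR_lt1 oppr_lt0.
  have M0 : 0 < 2 * K * m + 1 by rewrite ltr_wpDl// !mulr_ge0.
  move=> /cvgr0Pnorm_le /(_ (e / (2 * K * m + 1))); rewrite divr_gt0// => /(_ isT) cpoint.
  near=> n; apply: (le_trans (diff n)).
  have : `|expR (- k) ^+ n| <= e / (2 * K * m + 1) by near: n.
  rewrite ger0_norm ?exprn_ge0 ?expR_ge0// ler_pdivlMr// => h; apply: le_trans h.
  by rewrite mulrC ler_wpM2l ?exprn_ge0 ?expR_ge0// lerDl.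
have := cvg_unique (@Rhausdorff R) (cvgB c0 cm) d0.
by move=> /(_ _ _) /eqP; rewrite subr_eq0 => /eqP.
Unshelve. all: by end_near. Qed.
End Shifts.

End RealIntegrals.

(** * Sigma-finite products and Fubini's theorem *)

Section ProductMeasure.
Local Open Scope ereal_scope.
Context d1 d2 (T1 : measurableType d1) (T2 : measurableType d2) (R : realType).
Variables (m1 : {sigma_finite_measure set T1 -> \bar R}) (m2 : {sigma_finite_measure set T2 -> \bar R}).

(* An alias of [m1 \x m2]: on the latter the inferred sigma-finite structure
   is the one for finite [m1] and [m2]. *)
Definition prodm : set (T1 * T2) -> \bar R := m1 \x m2.

HB.instance Definition _ := Measure.copy prodm (m1 \x m2).

Let prodm_sigma_finite : sigma_finite setT prodm.
Proof.
have /sigma_finiteP[F [TF ndF Foo]] := sigma_finiteT m1.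
have /sigma_finiteP[G [TG ndG Goo]] := sigma_finiteT m2.
exists (fun n => F n `*` G n).
  apply/seteqP; split=> // -[x y] _.
  have [i _ Fx] : (\bigcup_i F i) x by rewrite -TF.
  have [j _ Gy] : (\bigcup_i G i) y by rewrite -TG.
  exists (maxn i j) => //; split => /=.
    by move: x Fx; apply/subsetPset/ndF/leq_maxl.
  by move: y Gy; apply/subsetPset/ndG/leq_maxr.
move=> n; have [mF Fn] := Foo n; have [mG Gn] := Goo n.
split; first exact: measurableX.
by rewrite /prodm product_measure1E// lte_mul_pinfty// ge0_fin_numE.
Qed.

HB.instance Definition _ := Measure_isSigmaFinite.Build _ _ _ prodm prodm_sigma_finite.

End ProductMeasure.

Section Fubini.
Variable R : realType.
Context d1 d2 (T1 : measurableType d1) (T2 : measurableType d2).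
Variable m1 : {sigma_finite_measure set T1 -> \bar R}.
Variable m2 : {sigma_finite_measure set T2 -> \bar R}.

(** Tonelli gives measurability of the integrals of the positive and negative parts; [Rintegral] is
    [fine] of their difference, also on slices where this is a default value. *)
Lemma measurable_Rint (f : T1 * T2 -> R) : measurable_fun setT f ->
  measurable_fun setT (fun x => Rintegral m2 setT (fun y => f (x, y))).
Proof.
move=> mf; apply: measurableT_comp => //.
have mf' : measurable_fun setT (EFin \o f) by exact/measurable_EFinP.
rewrite (_ : (fun _ => _) = (fubini_F m2 (EFin \o f)^\+) \- (fubini_F m2 (EFin \o f)^\-))%E.
  by apply: emeasurable_funB; apply: measurable_fun_fubini_tonelli_F => //;
     [exact: measurable_funepos|exact: measurable_funeneg].
apply/funext => x; rewrite integralE /fubini_F.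
congr (_ - _)%E; apply: eq_integral => y _.
  by rewrite !funeposE.
by rewrite !funenegE.
Qed.

Lemma integrable_Rint (f : T1 * T2 -> R) : (prodm m1 m2).-integrable setT (EFin \o f) ->
  m1.-integrable setT (EFin \o (fun x => Rintegral m2 setT (fun y => f (x, y)))).
Proof.
move=> fi; have iF := integrable_fubini_F fi.
have mf : measurable_fun setT f by apply/measurable_EFinP; exact: measurable_int fi.
apply: (le_integrable _ _ _ iF) => //.
  by apply/measurable_EFinP; exact: measurable_Rint.
move=> x _ /=; rewrite /fubini_F /Rintegral /=.
by case: (integral _ _ _) => [r| |] //=; rewrite normr0 ?leey.
Qed.

(** [Rintegral] and the extended-real inner integral differ only where the latter is infinite, a
    null set by integrability. *)
Lemma Rint_fubini (f : T1 * T2 -> R) : (prodm m1 m2).-integrable setT (EFin \o f) ->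
  Rintegral (prodm m1 m2) setT f = Rintegral m1 setT (fun x => Rintegral m2 setT (fun y => f (x, y))).
Proof.
move=> fi; have iF := integrable_fubini_F fi.
have mf : measurable_fun setT f by apply/measurable_EFinP; exact: measurable_int fi.
rewrite /Rintegral -integral12_prod_meas1//; congr fine.
apply: ae_eq_integral => //.
- exact: measurable_int iF.
- by apply/measurable_EFinP; exact: measurable_Rint.
have := integrable_ae measurableT iF; apply: filterS => x /= /(_ I) Fx _.
by rewrite fineK.
Qed.

Lemma measurable_Rint2 (f : T1 * T2 -> R) : measurable_fun setT f ->
  measurable_fun setT (fun y => Rintegral m1 setT (fun x => f (x, y))).
Proof.
move=> mf; apply: measurableT_comp => //.
have mf' : measurable_fun setT (EFin \o f) by exact/measurable_EFinP.
rewrite (_ : (fun _ => _) = (fubini_G m1 (EFin \o f)^\+) \- (fubini_G m1 (EFin \o f)^\-))%E.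
  by apply: emeasurable_funB; apply: measurable_fun_fubini_tonelli_G => //;
     [exact: measurable_funepos|exact: measurable_funeneg].
apply/funext => x; rewrite integralE /fubini_G.
congr (_ - _)%E; apply: eq_integral => y _.
  by rewrite !funeposE.
by rewrite !funenegE.
Qed.

Lemma Rint_fubini2 (f : T1 * T2 -> R) : (prodm m1 m2).-integrable setT (EFin \o f) ->
  Rintegral (prodm m1 m2) setT f = Rintegral m2 setT (fun y => Rintegral m1 setT (fun x => f (x, y))).
Proof.
move=> fi.
have mf : measurable_fun setT f by apply/measurable_EFinP; exact: measurable_int fi.
rewrite /Rintegral -integral21_prod_meas1//; congr fine.
apply: ae_eq_integral => //.
- exact: (measurable_fubini_G fi).
- by apply/measurable_EFinP; exact: measurable_Rint2.
have := ae_integrable2 fi; apply: filterS => y /= iy _.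
by rewrite fineK//; exact: integrable_fin_num iy.
Qed.

Lemma ae_eq_Rint (f g : T1 -> R) : m1.-integrable setT (EFin \o f) ->
  measurable_fun setT g -> {ae m1, forall x, f x = g x} ->
  m1.-integrable setT (EFin \o g) /\ Rintegral m1 setT f = Rintegral m1 setT g.
Proof.
move=> fi mg fg; have mf := measurable_int _ fi.
have mg' : measurable_fun setT (EFin \o g) by exact/measurable_EFinP.
split.
  apply/integrableP; split=> //; have /integrableP[_] := fi.
  rewrite (@ae_eq_integral _ _ _ m1 setT (abse \o (EFin \o f)) (abse \o (EFin \o g)))//.
  - exact: measurableT_comp.
  - exact: measurableT_comp.
  - by apply: filterS fg => x /= -> _.
rewrite /Rintegral; congr fine; apply: ae_eq_integral => //.
by apply: filterS fg => x /= -> _.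
Qed.

Lemma tonelli1 (f : T1 * T2 -> \bar R) : measurable_fun setT f -> (forall z, 0 <= f z)%E ->
  (\int[prodm m1 m2]_z f z = \int[m1]_x \int[m2]_y f (x, y))%E.
Proof. by move=> mf f0; exact: fubini_tonelli1. Qed.

Lemma tonelli2 (f : T1 * T2 -> \bar R) : measurable_fun setT f -> (forall z, 0 <= f z)%E ->
  (\int[prodm m1 m2]_z f z = \int[m2]_y \int[m1]_x f (x, y))%E.
Proof. by move=> mf f0; exact: fubini_tonelli2. Qed.

End Fubini.

(** * The iterated integral as an integral on a product space *)

Section Spaces.
Variable R : realType.
Local Notation C := (complex R).
Local Notation mu := (@lebesgue_measure R).

Definition plane := prodm mu mu.
HB.instance Definition _ := SigmaFiniteMeasure.copy plane (prodm mu mu).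

(** Bundling a type with its measure lets one recursion on the dimension produce both. *)
Record mspace := MSpace {
  ms_d : measure_display;
  ms_T : measurableType ms_d;
  ms_mu : {sigma_finite_measure set ms_T -> \bar R} }.

Definition leb : {sigma_finite_measure set (measurableTypeR R) -> \bar R} := mu.

(* [cspace n] models C^n with Lebesgue measure; [ccoord] reads off coordinates
   (extended by 0). In a factor of type [R * R] the imaginary part comes first,
   as in [iter_int]. *)
Fixpoint cspace n : mspace :=
  if n is n'.+1 then MSpace (prodm plane (ms_mu (cspace n'))) else MSpace (@dirac _ unit tt R).
Local Notation T_ n := (ms_T (cspace n)).
Local Notation mu_ n := (ms_mu (cspace n)).

Definition cpair (p : R * R) : C := Complex p.2 p.1.

Definition cset (z : nat -> C) n (w : C) : nat -> C := fun k => if k == n then w else z k.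

Fixpoint ccoord n : T_ n -> nat -> C :=
  match n return T_ n -> nat -> C with
  | 0%N => fun _ _ => 0
  | n'.+1 => fun t => cset (ccoord t.2) n' (cpair t.1)
  end.

Lemma cmeas_cpair : cmeas (cpair : measurableTypeR R * measurableTypeR R -> C).
Proof. by split; [exact: measurable_snd|exact: measurable_fst]. Qed.

Lemma cmeas_comp d1 d2 (T1 : measurableType d1) (T2 : measurableType d2) (f : T2 -> C) (h : T1 -> T2) :
  cmeas f -> measurable_fun setT h -> cmeas (fun t => f (h t)).
Proof. by move=> [f1 f2] mh; split; [exact: (measurableT_comp f1 mh)|exact: (measurableT_comp f2 mh)]. Qed.

Lemma cmeas_ccoord n k : cmeas (fun t : T_ n => ccoord t k).
Proof.
elim: n k => [|n IH] k; first exact: cmeas_cst.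
rewrite /= /cset; case: eqP => _.
  exact: (cmeas_comp cmeas_cpair measurable_fst).
exact: (cmeas_comp (IH k) measurable_snd).
Qed.

(** Sequences carry no sigma-algebra here: a functional is tested along every family of sequences
    with measurable coordinates. *)
Definition rseqmeas (F : (nat -> R) -> R) := forall d (T : measurableType d) (c : T -> nat -> R),
  (forall k, measurable_fun setT (c^~ k)) -> measurable_fun setT (fun t => F (c t)).

Definition rset (v : nat -> R) n (x : R) : nat -> R := fun k => if k == n then x else v k.

Lemma measurable_rset d (T : measurableType d) (c : T -> nat -> R) n (h : T -> R) :
  (forall k, measurable_fun setT (c^~ k)) -> measurable_fun setT h ->
  forall k, measurable_fun setT (fun t => rset (c t) n (h t) k).
Proof. by move=> mc mh k; rewrite /rset; case: eqP. Qed.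

Lemma rseqmeas_rset F n x : rseqmeas F -> rseqmeas (fun v => F (rset v n x)).
Proof.
move=> gF d T c mc; apply: gF => k; apply: measurable_rset => //; exact: measurable_cst.
Qed.

Definition rcoord n (t : T_ n) : nat -> R :=
  fun k => if odd k then cim (ccoord t k./2) else cre (ccoord t k./2).

Lemma measurable_rcoord n k : measurable_fun setT (fun t : T_ n => rcoord t k).
Proof. by rewrite /rcoord; case: odd; [exact: (cmeas_ccoord _ _).2|exact: (cmeas_ccoord _ _).1]. Qed.

Lemma rcoord_S n p (t : T_ n) :
  rcoord ((p, t) : T_ n.+1) = rset (rset (rcoord t) n.*2 p.2) n.*2.+1 p.1.
Proof.
apply/funext => k; rewrite /rcoord /rset /= /cset.
have [->|k1] := eqVneq k n.*2.+1.
  by rewrite /= odd_double uphalf_double eqxx.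
have [->|k2] := eqVneq k n.*2; first by rewrite odd_double doubleK eqxx.
have -> : (k./2 == n) = false; last by [].
apply/negbTE/eqP => kn; move: (odd_double_half k); rewrite kn.
by case: odd => /esym E; [move: k1|move: k2]; rewrite E eqxx.
Qed.

(** Each complex coordinate consumes two iterations of [iter_int], of which the outer one integrates
    the imaginary part, as [plane] does. *)
Lemma iter_intE n F : rseqmeas F -> (forall v, 0 <= F v) ->
  iter_int n.*2 (fun v => (F v)%:E) = (\int[mu_ n]_t (F (rcoord t))%:E)%E.
Proof.
elim: n F => [|n IH] F gF F0.
  rewrite /= integral_dirac//= diracE mem_set// mul1e; congr (F _)%:E.
  by apply/funext => k; rewrite /rcoord; case: odd.
have mF : measurable_fun setT (fun t : T_ n.+1 => (F (rcoord t))%:E).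
  by apply/measurable_EFinP; apply: gF => k; exact: measurable_rcoord.
rewrite doubleS /= tonelli1//; last by move=> z; rewrite lee_fin.
under [RHS]eq_integral do under eq_integral do rewrite rcoord_S.
rewrite tonelli1; last 2 first.
- apply: (measurable_fun_fubini_tonelli_F (fun z : _ * T_ n => (F (rset (rset (rcoord z.2) n.*2 z.1.2) n.*2.+1 z.1.1))%:E)).
    by apply: eq_measurable_fun mF => -[p t] _; rewrite rcoord_S.
  by move=> z; rewrite lee_fin.
- by move=> z; apply: integral_ge0 => t _; rewrite lee_fin.
apply: eq_integral => y _; apply: eq_integral => x _.
rewrite -(IH (fun v => F (rset (rset v n.*2 x) n.*2.+1 y)))//.
by apply: (@rseqmeas_rset (fun v => F (rset v _ _))); exact: rseqmeas_rset.
Qed.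

(** The parameter space [S] is arbitrary so that the induction can move the variable of the outer
    integral into it. *)
Lemma measurable_iter_Rint n d (S : measurableType d) (H : S -> (nat -> R) -> R) :
  (forall d' (T : measurableType d') (s : T -> S) (c : T -> nat -> R),
    measurable_fun setT s -> (forall k, measurable_fun setT (c^~ k)) ->
    measurable_fun setT (fun t => H (s t) (c t))) ->
  measurable_fun setT (fun s => iter_Rint n (H s)).
Proof.
elim: n d S H => [|n IH] d S H mH /=.
  by apply: mH => // k; exact: measurable_cst.
apply: (@measurable_Rint _ _ _ S (measurableTypeR R) leb
  (fun p => iter_Rint n (fun v => H p.1 (rset v n p.2)))).
apply: IH => d' T s c ms mc; apply: mH; first exact: measurableT_comp.
by apply: measurable_rset => //; exact: measurableT_comp.
Qed.

(** A slice is integrable only for almost every value of the last complex coordinate, so the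
    induction hypothesis yields an almost everywhere equality; the measurability of the iterated
    integral [J] then allows Fubini to proceed. *)
Lemma iter_RintE n F : rseqmeas F -> (mu_ n).-integrable setT (EFin \o (fun t => F (rcoord t))) ->
  iter_Rint n.*2 F = Rintegral (mu_ n) setT (fun t => F (rcoord t)).
Proof.
elim: n F => [|n IH] F gF iF.
  rewrite /= /Rintegral integral_dirac//= indicE mem_set// mul1r; congr (F _).
  by apply/funext => k; rewrite /rcoord; case: odd.
rewrite doubleS /=.
have mF : measurable_fun setT (fun t : T_ n.+1 => F (rcoord t)).
  by apply: gF => k; exact: measurable_rcoord.
rewrite [RHS](Rint_fubini iF).
pose J (p : R * R) := iter_Rint n.*2 (fun v => F (rset (rset v n.*2 p.2) n.*2.+1 p.1)).
have mJ : measurable_fun setT (J : measurableTypeR R * measurableTypeR R -> R).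
  apply: (@measurable_iter_Rint _ _ _ (fun p v => F (rset (rset v n.*2 p.2) n.*2.+1 p.1))).
  move=> d T s c ms mc; apply: gF; apply: measurable_rset; last exact: measurableT_comp.
  by apply: measurable_rset => //; exact: measurableT_comp.
have ae : {ae plane, forall p, Rintegral (mu_ n) setT (fun t => F (rcoord ((p, t) : T_ n.+1))) = J p}.
  have := @ae_integrable1 _ _ _ _ _ plane (mu_ n) _ iF.
  apply: filterS => p ip; rewrite /J IH.
  - by apply: eq_Rintegral => t _; rewrite rcoord_S.
  - by apply: (@rseqmeas_rset (fun v => F (rset v _ _))); exact: rseqmeas_rset.
  - by move: ip; congr (integrable _ _ _); apply/funext => t /=; rewrite rcoord_S.
have [iJ ->] := ae_eq_Rint (integrable_Rint iF) mJ ae.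
by rewrite Rint_fubini.
Qed.

End Spaces.

(** * Points as vectors and translation invariance *)

Section Invariance.
Variable R : realType.
Local Notation C := (complex R).
Local Notation mu := (@lebesgue_measure R).
Local Notation T_ n := (ms_T (cspace R n)).
Local Notation mu_ n := (ms_mu (cspace R n)).
Local Notation cvec := (cvec R).

(* Column vectors carry no sigma-algebra: measurability is stated through
   composition with maps whose coordinates are measurable. *)
Definition cmeasv d dd (T : measurableType dd) (Z : T -> cvec d) :=
  forall j, cmeas (fun t => Z t j 0).
Definition mvecR d (F : cvec d -> R) := forall dd (T : measurableType dd) (Z : T -> cvec d),
  cmeasv Z -> measurable_fun setT (fun t => F (Z t)).
Definition mvec d (F : cvec d -> C) := forall dd (T : measurableType dd) (Z : T -> cvec d),
  cmeasv Z -> cmeas (fun t => F (Z t)).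
Definition mmap d (W : cvec d -> cvec d) := forall dd (T : measurableType dd) (Z : T -> cvec d),
  cmeasv Z -> cmeasv (fun t => W (Z t)).

Definition cpoint d (t : T_ d) : cvec d := \col_(j < d) ccoord t j.

Lemma cmeasv_cpoint d : cmeasv (@cpoint d).
Proof. by move=> j; rewrite /cpoint; under eq_fun do rewrite mxE; exact: cmeas_ccoord. Qed.

Lemma vec_of_coords_rcoord d (t : T_ d) : vec_of_coords d (rcoord t) = cpoint t.
Proof.
apply/matrixP => i j; rewrite !mxE /rcoord /= !odd_double /= doubleK uphalf_double.
exact: cK.
Qed.

Lemma rseqmeas_vec d (F : cvec d -> R) : mvecR F -> rseqmeas (fun v => F (vec_of_coords d v)).
Proof.
move=> mF dd T c mc; apply: mF => j; rewrite /vec_of_coords.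
by under eq_fun do rewrite mxE; split; exact: mc.
Qed.

Lemma intCd_nnegE d (F : cvec d -> R) : mvecR F -> (forall z, 0 <= F z) ->
  intCd_nneg F = (\int[mu_ d]_t (F (cpoint t))%:E)%E.
Proof.
move=> mF F0; rewrite /intCd_nneg (@iter_intE _ d (fun v => F (vec_of_coords d v)))//.
  by apply: eq_integral => t _; rewrite vec_of_coords_rcoord.
exact: rseqmeas_vec.
Qed.

Lemma iter_Rint_cpoint d (F : cvec d -> R) : mvecR F ->
  (mu_ d).-integrable setT (EFin \o (fun t => F (cpoint t))) ->
  iter_Rint d.*2 (fun v => F (vec_of_coords d v)) = Rintegral (mu_ d) setT (fun t => F (cpoint t)).
Proof.
move=> mF iF; rewrite iter_RintE.
- by apply: eq_Rintegral => t _; rewrite vec_of_coords_rcoord.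
- exact: rseqmeas_vec.
- by under eq_fun do rewrite vec_of_coords_rcoord.
Qed.

Lemma mvecR_abs d (F : cvec d -> R) : mvecR F -> mvecR (fun z => `|F z|).
Proof. by move=> mF dd T Z mZ; apply: measurableT_comp => //; exact: mF. Qed.

Lemma mvecR_cnorm2 d : mvecR (@cnorm2 R d).
Proof.
move=> dd T Z mZ; rewrite /cnorm2; apply: measurable_sum => j.
by have [m1 m2] := mZ j; apply: measurable_funD; exact: measurable_funX.
Qed.

Lemma cnorm2_ge0 d (z : cvec d) : 0 <= cnorm2 z.
Proof. by apply: sumr_ge0 => j _; rewrite addr_ge0 ?sqr_ge0. Qed.

Lemma cnorm2E d (z : cvec d) : cnorm2 z = \sum_(j < d) cabs (z j 0) ^+ 2.
Proof. by apply: eq_bigr => j _; rewrite sqr_cabs. Qed.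

Lemma mvecR_gauss d (k : R) : mvecR (fun z : cvec d => expR (- (k * cnorm2 z))).
Proof.
move=> dd T Z mZ; apply: measurableT_comp => //; apply: measurableT_comp => //.
by apply: measurable_funM => //; exact: mvecR_cnorm2.
Qed.

Lemma plane_shift (a b : R) (f : R * R -> \bar R) :
  measurable_fun (setT : set (measurableTypeR R * measurableTypeR R)) f -> (forall p, 0 <= f p)%E ->
  (\int[@plane R]_p f ((p.1 + a)%R, (p.2 + b)%R) = \int[@plane R]_p f p)%E.
Proof.
move=> mf f0.
rewrite [LHS]tonelli1//; last first.
  apply: (measurableT_comp mf (g := fun p : measurableTypeR R * measurableTypeR R => ((p.1 + a)%R : measurableTypeR R, (p.2 + b)%R : measurableTypeR R))); apply: measurable_fun_pair => /=.
    by apply: measurable_funD => //; exact: measurable_fst.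
  by apply: measurable_funD => //; exact: measurable_snd.
rewrite [RHS](@tonelli1 _ _ _ _ _ mu mu f mf f0).
under eq_integral => x _.
  rewrite (@integral_shift _ b (fun y => f ((x + a)%R, y)))//; last first.
    exact: measurable_fun_pair2.
  over.
rewrite (@integral_shift _ a (fun x => \int[mu]_y f (x, y))%E)//.
  exact: (@measurable_fun_fubini_tonelli_F _ _ (measurableTypeR R) (measurableTypeR R) R (leb R) f mf f0).
by move=> x; apply: integral_ge0.
Qed.

Definition cseqmeasR (F : (nat -> C) -> R) := forall dd (T : measurableType dd) (Z : T -> nat -> C),
  (forall k, cmeas (Z^~ k)) -> measurable_fun setT (fun t => F (Z t)).

Lemma cmeas_cset dd (T : measurableType dd) (Z : T -> nat -> C) n (h : T -> C) :
  (forall k, cmeas (Z^~ k)) -> cmeas h -> forall k, cmeas (fun t => cset (Z t) n (h t) k).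
Proof. by move=> mc mh k; rewrite /cset; case: eqP. Qed.

(** Indices from [n] on keep the default 0 of [ccoord], which makes the base case trivial. In the
    step, the first [n] coordinates are shifted in the inner integral, and the last one after
    Tonelli has exchanged the order. *)
Lemma shift_ccoord n F (a : nat -> C) : cseqmeasR F -> (forall z, 0 <= F z) ->
  (\int[mu_ n]_t (F (fun k => if (k < n)%N then ccoord t k + a k else 0))%:E =
   \int[mu_ n]_t (F (ccoord t))%:E)%E.
Proof.
elim: n F => [|n IH] F gF F0; first by [].
have mF : measurable_fun setT (fun t : T_ n.+1 => (F (ccoord t))%:E).
  by apply/measurable_EFinP; apply: gF => k; exact: cmeas_ccoord.
have eS p (t : T_ n) : ccoord ((p, t) : T_ n.+1) = cset (ccoord t) n (cpair p) by [].
have eS' p (t : T_ n) : (fun k => if (k < n.+1)%N then ccoord ((p, t) : T_ n.+1) k + a k else 0) =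
   (fun w => cset w n (cpair p + a n)) (fun k => if (k < n)%N then ccoord t k + a k else 0).
  apply/funext => k; rewrite eS /cset; case: eqP => [->|/eqP kn]; first by rewrite ltnSn.
  by rewrite ltnS leq_eqVlt (negbTE kn).
rewrite tonelli1; last 2 first.
- apply/measurable_EFinP; apply: (gF _ _ (fun t : T_ n.+1 => fun k => if (k < n.+1)%N then ccoord t k + a k else 0)) => k.
  case: (k < n.+1)%N; last exact: cmeas_cst.
  by apply: cmeasD; [exact: cmeas_ccoord|exact: cmeas_cst].
- by move=> z; rewrite lee_fin.
under eq_integral => p _.
  under eq_integral do rewrite eS'.
  rewrite (IH (fun w => F (cset w n (cpair p + a n))))//; last first.
    move=> dd T Z mZ; apply: gF; apply: cmeas_cset => //; exact: cmeas_cst.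
  over.
rewrite -(@tonelli2 _ _ _ (T_ n) _ (mu_ n) (@plane R) (fun z => (F (cset (ccoord z.1) n (cpair z.2 + a n)))%:E)); last 2 first.
- apply/measurable_EFinP; apply: gF; apply: cmeas_cset.
    by move=> k; exact: (cmeas_comp (@cmeas_ccoord R n k) measurable_fst).
  by apply: cmeasD; [exact: (cmeas_comp (@cmeas_cpair R) measurable_snd)|exact: cmeas_cst].
- by move=> z; rewrite lee_fin.
rewrite tonelli1; last 2 first.
- apply/measurable_EFinP; apply: gF; apply: cmeas_cset.
    by move=> k; exact: (cmeas_comp (@cmeas_ccoord R n k) measurable_fst).
  by apply: cmeasD; [exact: (cmeas_comp (@cmeas_cpair R) measurable_snd)|exact: cmeas_cst].
- by move=> z; rewrite lee_fin.
rewrite [RHS]tonelli2; [|exact: mF|by move=> z; rewrite lee_fin].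
apply: eq_integral => t _.
transitivity (\int[@plane R]_p (F (cset (ccoord t) n (cpair p)))%:E)%E; last by [].
rewrite -(@plane_shift (cim (a n)) (cre (a n)) (fun p => (F (cset (ccoord t) n (cpair p)))%:E)).
- apply: eq_integral => p _; congr (F (cset _ _ _))%:E.
  by rewrite /cpair; apply: cre_cim_inj; rewrite !cE.
- apply/measurable_EFinP; apply: gF; apply: cmeas_cset; last exact: cmeas_cpair.
  by move=> k; exact: cmeas_cst.
- by move=> p; rewrite lee_fin.
Qed.

Lemma shift_cspace d (F : cvec d -> R) a : mvecR F -> (forall z, 0 <= F z) ->
  (\int[mu_ d]_t (F (cpoint t + a))%:E = \int[mu_ d]_t (F (cpoint t))%:E)%E.
Proof.
move=> mF F0; pose a' k := if insub k is Some j then a (j : 'I_d) 0 else 0.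
have := @shift_ccoord d (fun z => F (\col_(j < d) z j)) a'.
move=> <-//; last first.
  by move=> dd T Z mZ; apply: mF => j; under eq_fun do rewrite mxE; exact: mZ.
apply: eq_integral => t _; congr (F _)%:E; apply/matrixP => i j.
by rewrite !mxE ltn_ord /a' ord1 valK.
Qed.

End Invariance.

(** * Gaussian integrals and unitary invariance *)

Section Gauss.
Variable R : realType.
Local Notation mu := (@lebesgue_measure R).
Local Notation T_ n := (ms_T (cspace R n)).
Local Notation mu_ n := (ms_mu (cspace R n)).
Local Notation cvec := (cvec R).

Definition gauss1 (k : R) : R := Rintegral mu setT (fun x => expR (- (k * x ^+ 2))).

Lemma int_gauss1 (k : R) : 0 < k ->
  (\int[mu]_x (expR (- (k * x ^+ 2)))%:E = (gauss1 k)%:E)%E.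
Proof.
move=> k0; rewrite /gauss1 /Rintegral fineK//.
exact: (integrable_fin_num _ (gauss_integrable k0)).
Qed.

Lemma gauss1_ge0 k : 0 <= gauss1 k.
Proof. by apply: Rintegral_ge0 => x _; exact: expR_ge0. Qed.

Lemma gauss1_1 : gauss1 1 = Num.sqrt pi.
Proof.
have := @integralT_gauss R; rewrite /gauss_fun => E.
by rewrite /gauss1 /Rintegral; under eq_integral do rewrite mul1r; rewrite E.
Qed.

Lemma measurable_cabs_cpair : measurable_fun setT (fun p : measurableTypeR R * measurableTypeR R => cabs (cpair p)).
Proof. exact: (measurable_cabs (@cmeas_cpair R)). Qed.

Lemma measurable_gauss_plane (k : R) : measurable_fun setT
  (fun p : measurableTypeR R * measurableTypeR R => expR (- (k * cabs (cpair p) ^+ 2))).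
Proof.
apply: measurableT_comp => //; apply: measurableT_comp => //; apply: measurable_funM => //.
exact: measurable_funX measurable_cabs_cpair.
Qed.

Lemma int_gauss_plane (k : R) : 0 < k ->
  (\int[@plane R]_p (expR (- (k * cabs (cpair p) ^+ 2)))%:E = (gauss1 k ^+ 2)%:E)%E.
Proof.
move=> k0; rewrite [LHS](@tonelli1 _ _ _ _ _ mu mu).
- have E y x : (expR (- (k * cabs (cpair (y, x)) ^+ 2)))%:E =
     ((expR (- (k * y ^+ 2)))%:E * (expR (- (k * x ^+ 2)))%:E)%E.
    rewrite -EFinM -expRD sqr_cabs /cpair /=; congr (expR _)%:E; ring.
  have me : measurable_fun setT (fun x : R => (expR (- (k * x ^+ 2)))%:E).
    exact: measurable_int (gauss_integrable k0).
  under eq_integral => y _.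
    under eq_integral do rewrite E.
    rewrite ge0_integralZl//.
    rewrite int_gauss1//; over.
  rewrite ge0_integralZr//; last by rewrite lee_fin gauss1_ge0.
  by rewrite int_gauss1// -EFinM expr2.
- by apply/measurable_EFinP; exact: measurable_gauss_plane.
- by move=> p; rewrite lee_fin expR_ge0.
Qed.

Lemma cnorm2_cpointS n p (t : T_ n) : cnorm2 (cpoint ((p, t) : T_ n.+1)) = cabs (cpair p) ^+ 2 + cnorm2 (cpoint t).
Proof.
rewrite !cnorm2E big_ord_recr /= !mxE /= /cset eqxx addrC; congr (_ + _).
apply: eq_bigr => j _; rewrite !mxE /= /cset ltn_eqF//.
Qed.

Lemma int_gauss_cspace n (k : R) : 0 < k ->
  (\int[mu_ n]_t (expR (- (k * cnorm2 (cpoint t))))%:E = (gauss1 k ^+ 2 ^+ n)%:E)%E.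
Proof.
move=> k0; elim: n => [|n IH].
  by rewrite integral_dirac//= diracE mem_set// mul1e /cnorm2 big_ord0 mulr0 oppr0 expR0.
have me m : measurable_fun setT (fun t : T_ m => (expR (- (k * cnorm2 (cpoint t))))%:E).
  apply/measurable_EFinP; apply: (@mvecR_gauss R m k); exact: cmeasv_cpoint.
rewrite [LHS](@tonelli1 _ _ _ _ _ (@plane R) (mu_ n)); last 2 first.
- exact: (me n.+1).
- by move=> t; rewrite lee_fin expR_ge0.
under eq_integral => p _.
  under eq_integral do rewrite cnorm2_cpointS mulrDr opprD expRD EFinM.
  rewrite ge0_integralZl//.
  rewrite IH; over.
rewrite ge0_integralZr//.
- by rewrite int_gauss_plane// -EFinM -exprS.
- by apply/measurable_EFinP; exact: measurable_gauss_plane.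
- by rewrite lee_fin exprn_ge0// exprn_ge0// gauss1_ge0.
Qed.

Lemma int_gauss_pi n :
  (\int[mu_ n]_t (expR (- cnorm2 (cpoint t)))%:E = (pi ^+ n)%:E)%E.
Proof.
have := int_gauss_cspace n (@ltr01 R); under eq_integral do rewrite mul1r.
by move=> ->; rewrite gauss1_1 sqr_sqrtr// pi_ge0.
Qed.

Section Preserving.
Context dd (T : measurableType dd) (m : {sigma_finite_measure set T -> \bar R}).
Context d (Z : T -> cvec d).
Hypothesis mZ : cmeasv Z.

(** Invariance under [W] of the image of [m] under [Z], phrased with nonnegative integrands because
    vectors have no sigma-algebra; the variants for signed and for integrable functions follow from
    it. *)
Definition preserves (W : cvec d -> cvec d) := forall F : cvec d -> R, mvecR F ->
  (forall z, 0 <= F z) -> (\int[m]_t (F (W (Z t)))%:E = \int[m]_t (F (Z t))%:E)%E.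

Lemma preserves_int (W : cvec d -> cvec d) (F : cvec d -> R) : preserves W -> mvecR F ->
  (\int[m]_t (F (W (Z t)))%:E = \int[m]_t (F (Z t))%:E)%E.
Proof.
move=> pW mF; rewrite integralE [RHS]integralE; congr (_ - _)%E.
  have Ep (h : T -> cvec d) : (\int[m]_t ((fun t => (F (h t))%:E)^\+ t) = \int[m]_t (Num.max (F (h t)) 0)%:E)%E.
    by apply: eq_integral => t _; rewrite funeposE -EFin_max.
  rewrite !Ep; apply: (pW (fun z => Num.max (F z) 0)); last by move=> z; rewrite le_max lexx orbT.
  by move=> d' T' Z' mZ'; apply: measurable_maxr => //; exact: mF.
have En (h : T -> cvec d) : (\int[m]_t ((fun t => (F (h t))%:E)^\- t) = \int[m]_t (Num.max (- F (h t)) 0)%:E)%E.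
  by apply: eq_integral => t _; rewrite funenegE -EFin_max.
rewrite !En; apply: (pW (fun z => Num.max (- F z) 0)); last by move=> z; rewrite le_max lexx orbT.
by move=> d' T' Z' mZ'; apply: measurable_maxr => //; apply: measurableT_comp => //; exact: mF.
Qed.

Lemma preserves_Rint (W : cvec d -> cvec d) (F : cvec d -> R) : preserves W -> mvecR F ->
  Rintegral m setT (fun t => F (W (Z t))) = Rintegral m setT (fun t => F (Z t)).
Proof. by move=> pW mF; rewrite /Rintegral (preserves_int pW). Qed.

Lemma preserves_integrable (W : cvec d -> cvec d) (F : cvec d -> R) : preserves W -> mmap W ->
  mvecR F -> m.-integrable setT (EFin \o (fun t => F (Z t))) ->
  m.-integrable setT (EFin \o (fun t => F (W (Z t)))).
Proof.
move=> pW mW mF /integrableP[_ iF]; apply/integrableP; split.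
  by apply/measurable_EFinP; apply: mF; exact: mW.
under eq_integral do rewrite /=.
rewrite (pW (fun z => `|F z|))//; exact: mvecR_abs.
Qed.

Hypothesis shiftZ : forall a, preserves (fun z => z + a).
Hypothesis gaussZ : exists2 g : R, 0 < g & (\int[m]_t (expR (- cnorm2 (Z t)))%:E = g%:E)%E.

(* Uniqueness of Haar measure: two translation-invariant integrals are compared
   through the double integral of [exp(-|x|^2) F(U y)]. *)
Lemma haar_refl (U V : cvec d -> cvec d) (F : cvec d -> R) :
  (forall x y, U (x + y) = U x + U y) -> (forall x, U (V x) = x) ->
  (forall x, cnorm2 (U x) = cnorm2 x) -> mmap U ->
  mvecR F -> (forall z, 0 <= F z) ->
  (\int[m]_t (F (U (Z t)))%:E = \int[m]_t (F (- Z t))%:E)%E.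
Proof.
move=> UD UV Un mU mF F0; have [g g0 gE] := gaussZ.
pose e (z : cvec d) := expR (- cnorm2 z).
have e0 z : 0 <= e z by exact: expR_ge0.
have me : mvecR e.
  by move=> d' T' Z' mZ'; apply: measurableT_comp => //; apply: measurableT_comp => //; exact: mvecR_cnorm2.
have mfst : cmeasv (fun p : T * T => Z p.1).
  by move=> j; exact: (cmeas_comp (mZ j) measurable_fst).
have msnd : cmeasv (fun p : T * T => Z p.2).
  by move=> j; exact: (cmeas_comp (mZ j) measurable_snd).
have cD d' (T' : measurableType d') (f1 f2 : T' -> cvec d) : cmeasv f1 -> cmeasv f2 -> cmeasv (fun t => f1 t + f2 t).
  by move=> h1 h2 j; under eq_fun do rewrite mxE; exact: cmeasD.
have cN d' (T' : measurableType d') (f1 : T' -> cvec d) : cmeasv f1 -> cmeasv (fun t => - f1 t).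
  by move=> h1 j; under eq_fun do rewrite mxE; exact: cmeasN.
have cc (a : cvec d) d' (T' : measurableType d') : cmeasv (fun _ : T' => a).
  by move=> j; exact: cmeas_cst.
have mFU : mvecR (fun z => F (U z)) by move=> d' T' Z' mZ'; apply: mF; exact: mU.
have mFN : mvecR (fun z => F (- z)) by move=> d' T' Z' mZ'; apply: mF; exact: cN.
have U0 : U 0 = 0 by have := UD 0 0; rewrite addr0 => /eqP; rewrite -subr_eq subrr eq_sym => /eqP.
have UN x : U (- x) = - U x.
  by apply/eqP; rewrite -addr_eq0 -UD addNr U0.
have EF d' (T' : measurableType d') (f : T' -> R) : measurable_fun setT f -> measurable_fun setT (EFin \o f).
  by move=> h; exact/measurable_EFinP.
have gF (G : cvec d -> R) : mvecR G -> (forall z, 0 <= G z) ->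
   (\int[m]_x \int[m]_y (e (Z x) * G (Z y))%:E = g%:E * \int[m]_y (G (Z y))%:E)%E.
  move=> mG G0; under eq_integral => x _.
    under eq_integral do rewrite EFinM.
    rewrite ge0_integralZl//; [|exact/EF/mG|by move=> y _; rewrite lee_fin|by rewrite lee_fin].
    over.
  rewrite ge0_integralZr//; [by rewrite gE|exact/EF/me|by move=> y _; rewrite lee_fin|].
  by apply: integral_ge0 => y _; rewrite lee_fin.
(* Three substitutions, each a translation in one variable with the other fixed: x + U y for x; then
   y - V x for y, using |U y| = |y|; finally a shift of x by U y, which turns F(U y - x) into F(-
   x). *)
have H : (g%:E * \int[m]_y (F (U (Z y)))%:E = g%:E * \int[m]_y (F (- Z y))%:E)%E.
  rewrite -(gF _ mFU)// -(gF _ mFN)//.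
  transitivity (\int[m]_y \int[m]_x (e (Z x + U (Z y)) * F (U (Z y)))%:E)%E.
    rewrite -(@tonelli1 _ _ _ _ _ m m (fun p => (e (Z p.1) * F (U (Z p.2)))%:E)); last 2 first.
    - by apply: EF; apply: measurable_funM; [exact: me|apply: mFU].
    - by move=> p; rewrite lee_fin mulr_ge0.
    rewrite tonelli2; last 2 first.
    - by apply: EF; apply: measurable_funM; [exact: me|apply: mFU].
    - by move=> p; rewrite lee_fin mulr_ge0.
    apply: eq_integral => y _ /=.
    rewrite -(shiftZ (U (Z y)) (F := fun z => e z * F (U (Z y))))//.
    - move=> d' T' Z' mZ'; apply: measurable_funM; first exact: me.
      exact: measurable_cst.
    - by move=> z; rewrite mulr_ge0.
  transitivity (\int[m]_x \int[m]_y (e (Z y) * F (U (Z y) - Z x))%:E)%E.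
    rewrite -(@tonelli2 _ _ _ _ _ m m (fun p => (e (Z p.1 + U (Z p.2)) * F (U (Z p.2)))%:E)); last 2 first.
    - by apply: EF; apply: measurable_funM; [apply: me; apply: cD => //; exact: mU|exact: mFU].
    - by move=> p; rewrite lee_fin mulr_ge0.
    rewrite tonelli1; last 2 first.
    - by apply: EF; apply: measurable_funM; [apply: me; apply: cD => //; exact: mU|exact: mFU].
    - by move=> p; rewrite lee_fin mulr_ge0.
    apply: eq_integral => x _ /=.
    rewrite -(shiftZ (- V (Z x)) (F := fun z => e (Z x + U z) * F (U z)))//.
    - apply: eq_integral => y _; rewrite UD UN UV addrCA subrr addr0.
      by rewrite /e Un.
    - move=> d' T' Z' mZ'; apply: measurable_funM; last exact: mFU.
      by apply: me; apply: cD; [exact: cc|exact: mU].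
    - by move=> z; rewrite mulr_ge0.
  rewrite -(@tonelli1 _ _ _ _ _ m m (fun p => (e (Z p.2) * F (U (Z p.2) - Z p.1))%:E)); last 2 first.
  - apply: EF; apply: measurable_funM; [exact: me|apply: mF; apply: cD; [exact: mU|exact: cN]].
  - by move=> p; rewrite lee_fin mulr_ge0.
  rewrite tonelli2; last 2 first.
  - apply: EF; apply: measurable_funM; [exact: me|apply: mF; apply: cD; [exact: mU|exact: cN]].
  - by move=> p; rewrite lee_fin mulr_ge0.
  apply: eq_integral => y _ /=.
  rewrite -(shiftZ (- U (Z y)) (F := fun z => e (Z y) * F (- z)))//.
  - by apply: eq_integral => x _; rewrite opprB.
  - by move=> d' T' Z' mZ'; apply: measurable_funM; [exact: measurable_cst|exact: mFN].
  - by move=> z; rewrite mulr_ge0.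
have := congr1 (fun x => (g^-1)%:E * x)%E H.
by rewrite !muleA -!EFinM mulVf ?gt_eqF// !mul1e.
Qed.

(** The right side in [haar_refl] does not involve [U], so [U] may be compared with the identity. *)
Lemma haar_preserves (U V : cvec d -> cvec d) :
  (forall x y, U (x + y) = U x + U y) -> (forall x, U (V x) = x) ->
  (forall x, cnorm2 (U x) = cnorm2 x) -> mmap U -> preserves U.
Proof.
move=> UD UV Un mU F mF F0; rewrite (haar_refl UD UV Un mU mF F0).
by rewrite -(@haar_refl id id).
Qed.

End Preserving.

End Gauss.

(** * Symmetry in one coordinate *)

Section Circle.
Variable R : realType.
Local Notation C := (complex R).
Local Notation mu := (@lebesgue_measure R).
Local Notation cvec := (cvec R).

Definition cis (t : R) : C := cexp (Complex 0 t).

Lemma cisE t : cis t = Complex (cos t) (sin t).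
Proof. by rewrite /cis /cexp /= expR0 !mul1r. Qed.
Lemma cabs_cis t : cabs (cis t) = 1.
Proof. by rewrite /cis cabs_cexp expR0. Qed.
Lemma cnorm2Z d (u : C) (z : cvec d) : cnorm2 (u *: z) = cabs u ^+ 2 * cnorm2 z.
Proof.
by rewrite !cnorm2E mulr_sumr; apply: eq_bigr => j _; rewrite mxE cabsM exprMn.
Qed.

Lemma mmapZ d (u : C) : mmap (fun z : cvec d => u *: z).
Proof.
by move=> dd T Z mZ j; under eq_fun do rewrite mxE; apply: cmeasM; [exact: cmeas_cst|].
Qed.

Section Rotation.
Context dd (T : measurableType dd) (m : {sigma_finite_measure set T -> \bar R}).
Context d (Z : T -> cvec d).
Hypothesis mZ : cmeasv Z.
Hypothesis rotZ : forall u : C, cabs u = 1 -> preserves m Z (fun z => u *: z).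

(** Each rotation leaves the integral unchanged; the angle runs over an interval of length 2 pi, and
    Fubini exchanges it with the point. *)
Lemma rot_average (F : cvec d -> R) : mvecR F ->
  m.-integrable setT (EFin \o (fun w => F (Z w))) ->
  Rintegral m setT (fun w => Rintegral mu `[0, pi *+ 2] (fun t => F (cis t *: Z w))) =
  (pi *+ 2) * Rintegral m setT (fun w => F (Z w)).
Proof.
move=> mF iF.
pose ind : R -> R := \1_`[0, pi *+ 2].
have mind : measurable_fun setT ind by exact: measurable_indic.
pose g (x : R * T) := ind x.1 * F (cis x.1 *: Z x.2).
have mg : measurable_fun setT (g : measurableTypeR R * T -> R).
  apply: measurable_funM; first exact: (measurableT_comp mind measurable_fst).
  apply: mF => j; under eq_fun do rewrite mxE.
  apply: cmeasM; last exact: (cmeas_comp (mZ j) measurable_snd).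
  apply: cmeas_exp; split; first exact: measurable_cst.
  exact: measurable_fst.
have p2 : (0 : R) <= pi *+ 2 by rewrite mulrn_wge0// pi_ge0.
have rI t : Rintegral m setT (fun w => F (cis t *: Z w)) = Rintegral m setT (fun w => F (Z w)).
  by apply: (preserves_Rint (rotZ (cabs_cis t))).
have rint t : m.-integrable setT (EFin \o (fun w => F (cis t *: Z w))).
  by apply: (preserves_integrable mZ (rotZ (cabs_cis t))) => //; exact: mmapZ.
have indint : mu.-integrable setT (EFin \o ind).
  exact: integrable_indic_itv.
have intind : (\int[mu]_t (ind t)%:E = (pi *+ 2)%:E)%E.
  rewrite integral_indic// setIT /= lebesgue_measure_itv /= lte_fin.
  case: ltP => p2'; first by rewrite -EFinB subr0.
  by have -> : pi *+ 2 = 0 :> R by apply/eqP; rewrite eq_le p2 p2'.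
have ig : (prodm (leb R) m).-integrable setT (EFin \o g).
  apply/integrableP; split; first exact/measurable_EFinP.
  rewrite [ltLHS](@tonelli1 _ _ _ _ _ (leb R) m (abse \o (EFin \o g))); last 2 first.
  - by apply: measurableT_comp => //; exact/measurable_EFinP.
  - by move=> x /=; rewrite lee_fin.
  have E t : (\int[m]_w (abse \o (EFin \o g)) (t, w) = (ind t)%:E * \int[m]_w (`|F (Z w)|)%:E)%E.
    rewrite -(rotZ (cabs_cis t) (mvecR_abs mF))//.
    have i0 : 0 <= ind t by rewrite /ind indicE.
    rewrite -ge0_integralZl//.
    - by apply: eq_integral => w _ /=; rewrite /g normrM (ger0_norm i0).
    - by apply/measurable_EFinP; apply: mvecR_abs => //; exact: mmapZ.
  under eq_integral => t _ do rewrite E.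
  have [_ fF] := integrableP _ _ _ iF.
  rewrite ge0_integralZr//.
  - by rewrite intind; apply: lte_mul_pinfty; rewrite ?lee_fin.
  - exact/measurable_EFinP.
  - by move=> t _; rewrite lee_fin /ind indicE.
  - by apply: integral_ge0.
have := Rint_fubini ig; rewrite (Rint_fubini2 ig).
have -> : Rintegral m setT (fun w => Rintegral (leb R) setT (fun t => g (t, w))) =
   Rintegral m setT (fun w => Rintegral mu `[0, pi *+ 2] (fun t => F (cis t *: Z w))).
  apply: eq_Rintegral => w _; rewrite [RHS]Rintegral_mkcond; apply: eq_Rintegral => t _.
  by rewrite patchE /g /ind indicE; case: ifP; rewrite ?mul1r ?mul0r.
move=> ->.
under eq_Rintegral => t _.
  rewrite /g /= RintegralZl// rI; over.
by rewrite /= RintegralZr// [X in X * _]/Rintegral intind.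
Qed.

End Rotation.

Local Notation I0 f := (Rintegral mu `[0, pi *+ 2] f).
Local Notation rc x := (Complex (x : R) 0).
Local Notation ii := (Complex (0 : R) 1).

Lemma pi2_ge0 : (0 : R) <= pi *+ 2. Proof. by rewrite mulrn_wge0// pi_ge0. Qed.

Lemma cexpN z : cexp (- z) = (cexp z)^-1 :> C.
Proof.
apply: (mulfI (cexp_neq0 z)); rewrite -cexpD subrr cexp0 mulfV//.
exact: cexp_neq0.
Qed.

Lemma cis_conjE t : conjc (cis t) = cexp (- Complex 0 t).
Proof. by rewrite /cis -cexpJ; congr cexp; apply: cre_cim_inj; rewrite !cE ?oppr0. Qed.

(* The integrand is the restriction to the real axis of an entire function of
   [t] of period [2 pi]; shift the contour by [- i ln lam]. *)
Lemma circ_shift (F G : C -> C) (lam : R) w c : entire1 F -> entire1 G -> 0 < lam ->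
  I0 (fun t => cre (c * F (rc lam * (cis t * w)) * conjc (G (cis t * w)))) =
  I0 (fun t => cre (c * F (cis t * w) * conjc (G (rc lam * (cis t * w))))).
Proof.
move=> eF eG l0.
(* [G] enters through its reflection: for real [tau], exp(- i tau) conj(w) is the conjugate of exp(i
   tau) w, so [E] is entire and still restricts to the wanted integrand. *)
pose E tau := c * F (cexp (ii * tau) * w) * conjc (G (conjc (rc lam * (cexp (- (ii * tau)) * conjc w)))).
have elin a : entire1 (fun z : C => cexp (a * z)).
  apply: (@entire1_comp _ (fun z => a * z) (@cexp R)); last exact: entire1_cexp.
  exact: (entire1M (entire1_cst a) (@entire1_id R)).
have eE : entire1 E.
  apply: entire1M; first apply: entire1M.
  - exact: entire1_cst.
  - apply: (@entire1_comp _ (fun z => cexp (ii * z) * w) F) => //.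
    by apply: entire1M; [exact: elin|exact: entire1_cst].
  - apply: (@entire1_comp _ (fun z => rc lam * (cexp (- (ii * z)) * conjc w)) (fun z => conjc (G (conjc z)))).
      apply: entire1M; first exact: entire1_cst.
      apply: entire1M; last exact: entire1_cst.
      by under eq_fun do rewrite -mulNr; exact: elin.
    exact: entire1_conj.
have per z : E (z + rc (pi *+ 2)) = E z.
  have P : cexp (ii * (z + rc (pi *+ 2))) = cexp (ii * z).
    rewrite mulrDr cexpD [X in _ * X](_ : _ = 1) ?mulr1//.
    have -> : ii * rc (pi *+ 2) = Complex 0 (pi *+ 2) by apply: cre_cim_inj; rewrite !cE; ring.
    by rewrite -/(cis _) cisE cos2pi sin2pi.
  by rewrite /E cexpN P -cexpN.
pose s := - ln lam.
have Es t : E (Complex t s) = c * F (rc lam * (cis t * w)) * conjc (G (cis t * w)).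
  have X : cexp (ii * Complex t s) = rc lam * cis t.
    have -> : ii * Complex t s = rc (ln lam) + Complex 0 t.
      by apply: cre_cim_inj; rewrite !cE /s; ring.
    by rewrite cexpD cexp_real lnK ?posrE.
  rewrite /E cexpN X; congr (_ * F _ * conjc (G _)); first by rewrite mulrA.
  have lc : rc lam != 0 by rewrite eq_complex /= gt_eqF.
  have cc : cis t != 0 by exact: cexp_neq0.
  have -> : rc lam * ((rc lam * cis t)^-1 * conjc w) = (cis t)^-1 * conjc w.
    by rewrite invfM -mulrA mulVKf.
  rewrite -[in RHS](conjcK w) conjcM conjcK; congr (_ * _).
  by rewrite -[RHS]conjcK cis_conjE cexpN.
have E0 t : E (rc t) = c * F (cis t * w) * conjc (G (rc lam * (cis t * w))).
  have X : ii * rc t = Complex 0 t by apply: cre_cim_inj; rewrite !cE; ring.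
  rewrite /E X -/(cis t); congr (_ * conjc (G _)).
  rewrite !conjcM conjcK; congr (_ * (_ * _)); first by rewrite /= oppr0.
  by rewrite -cis_conjE conjcK.
under eq_Rintegral do rewrite -Es.
under [RHS]eq_Rintegral do rewrite -E0.
(* [periodic_shift] only moves upwards; for lam > 1 the lower line is the one at height [s]. *)
have [s0|s0] := leP 0 s.
  by rewrite (periodic_shift eE 0 pi2_ge0 s0 per) add0r.
have ns : 0 <= - s by rewrite oppr_ge0 ltW.
by rewrite (periodic_shift eE s pi2_ge0 ns per) addrN.
Qed.

(** With [G] constant, the circle shift says that the mean does not depend on the radius; shrinking
    the circle gives the value at the centre by continuity. *)
Lemma circle_mean (g : C -> C) w : entire1 g ->
  I0 (fun t => cre (g (cis t * w))) = (pi *+ 2) * cre (g 0).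
Proof.
move=> eg.
have S lam : 0 < lam -> I0 (fun t => cre (g (rc lam * (cis t * w)))) = I0 (fun t => cre (g (cis t * w))).
  move=> l0; have := @circ_shift g (fun=> 1) lam w 1 eg (entire1_cst 1) l0.
  by under eq_Rintegral do rewrite conjc1 mulr1 mul1r; under [in RHS]eq_Rintegral do rewrite conjc1 mulr1 mul1r.
apply/eqP; rewrite -subr_eq0 -normr_le0; apply/ler_addgt0Pl => e e0; rewrite addr0.
have p0 : (0 : R) < pi *+ 2 by rewrite pmulrn_lgt0// pi_gt0.
have [d [d0 H]] := entire1_cont 0 eg (divr_gt0 e0 p0).
have w1 : 0 < cabs w + 1 by rewrite ltr_pwDr ?cabs_ge0.
(* Keeps lam |w| below d, as lam (|w| + 1) = d / 2. *)
pose lam := d / (cabs w + 1) / 2.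
have l0 : 0 < lam by rewrite !divr_gt0.
rewrite -(S _ l0).
have ct : continuous (fun t => cre (g (rc lam * (cis t * w)))).
  pose E tau := g (rc lam * (cexp (ii * tau) * w)).
  have -> : (fun t => cre (g (rc lam * (cis t * w)))) = (fun t => cre (E (rc t))).
    apply/funext => t; rewrite /E /cis; congr (cre (g (_ * (cexp _ * _)))).
    by apply: cre_cim_inj; rewrite !cE; ring.
  apply: (@entire1_continuous_re _ E (fun t => rc t)); last exact: line_lip_re.
  apply: (@entire1_comp _ (fun z => rc lam * (cexp (ii * z) * w)) g) => //.
  apply: entire1M; first exact: entire1_cst.
  apply: entire1M; last exact: entire1_cst.
  apply: (@entire1_comp _ (fun z => ii * z) (@cexp R)); last exact: entire1_cexp.
  exact: (entire1M (entire1_cst ii) (@entire1_id R)).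
have := @Rint_est _ _ 0 (pi *+ 2) (cre (g 0)) (e / (pi *+ 2)) ct pi2_ge0.
rewrite subr0 divfK ?gt_eqF// [X in `|_ - X|]mulrC; apply.
move=> t _; rewrite -creB; apply: (le_trans (ler_cre _)).
have := H (rc lam * (cis t * w)); rewrite add0r; apply.
rewrite !cabsM cabs_cis mul1r cabs_real gtr0_norm//.
have : lam * (cabs w + 1) = d / 2 by rewrite /lam; field; rewrite gt_eqF.
lra.
Qed.

(** The limiting case lam = 0 of the circle shift, where no logarithm exists: both sides are mean
    values. *)
Lemma circ_shift0 (F G : C -> C) w c : entire1 F -> entire1 G ->
  I0 (fun t => cre (c * F 0 * conjc (G (cis t * w)))) =
  I0 (fun t => cre (c * F (cis t * w) * conjc (G 0))).
Proof.
move=> eF eG.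
have -> : (fun t => cre (c * F 0 * conjc (G (cis t * w)))) =
          (fun t => cre (conjc (c * F 0) * G (cis t * w))).
  by apply/funext => t; rewrite -[LHS]creJ (conjcM (c * F 0)) conjcK.
rewrite (@circle_mean (fun z => conjc (c * F 0) * G z)); last by apply: entire1M => //; exact: entire1_cst.
rewrite (@circle_mean (fun z => c * F z * conjc (G 0))); last first.
  by apply: entire1M; [apply: entire1M => //|]; exact: entire1_cst.
by congr (_ * _); rewrite -[LHS]creJ (conjcM (conjc _)) conjcK.
Qed.

End Circle.

(** * Rotation averages and cut-off densities in one coordinate *)

Section PlaneCut.
Variable R : realType.
Local Notation C := (complex R).
Local Notation mu := (@lebesgue_measure R).
Local Notation rc x := (Complex (x : R) 0).
Local Notation plane := (@plane R).
Local Notation I0 f := (Rintegral mu `[0, pi *+ 2] f).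

Definition mC (F : C -> R) := forall dd (T : measurableType dd) (Z : T -> C),
  cmeas Z -> measurable_fun setT (fun t => F (Z t)).

(** The plane seen as vectors of dimension 1, so that the Haar argument supplies its rotations. *)
Let Z1 (p : measurableTypeR R * measurableTypeR R) : cvec R 1 := \col__ cpair p.

Let mZ1 : cmeasv Z1.
Proof. by move=> j; rewrite /Z1; under eq_fun do rewrite mxE; exact: cmeas_cpair. Qed.

Let shift1 a : preserves plane Z1 (fun z => z + a).
Proof.
move=> F mF F0; rewrite -[RHS](@plane_shift _ (cim (a 0 0)) (cre (a 0 0)) (fun p => (F (Z1 p))%:E)).
- apply: eq_integral => p _; congr (F _)%:E; apply/matrixP => i j; rewrite !mxE !ord1.
  by apply: cre_cim_inj; rewrite !cE.
- by apply/measurable_EFinP; exact: mF.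
- by move=> p; rewrite lee_fin.
Qed.

Let gauss1' : exists2 g : R, 0 < g & (\int[plane]_t (expR (- cnorm2 (Z1 t)))%:E = g%:E)%E.
Proof.
exists (gauss1 (1 : R) ^+ 2); first by rewrite gauss1_1 sqr_sqrtr ?pi_ge0// pi_gt0.
rewrite -int_gauss_plane//; apply: eq_integral => p _; congr (expR _)%:E.
by rewrite mul1r cnorm2E big_ord1 mxE.
Qed.

Let rot1 u : cabs u = 1 -> preserves plane Z1 (fun z => u *: z).
Proof.
move=> u1; have u0 : u != 0 by apply/eqP => u0; move: u1; rewrite u0 cabs0 => /esym/eqP; rewrite oner_eq0.
apply: (haar_preserves mZ1 shift1 gauss1' (V := fun z => u^-1 *: z)).
- by move=> x y; rewrite scalerDr.
- by move=> x; rewrite scalerA mulfV// scale1r.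
- by move=> x; rewrite cnorm2Z u1 expr1n mul1r.
- exact: mmapZ.
Qed.

Let mC1 (F : C -> R) : mC F -> mvecR (fun z : cvec R 1 => F (z 0 0)).
Proof. by move=> mF dd T Z mZ; apply: mF. Qed.

Lemma plane_shift_Rint (F : C -> R) a : mC F ->
  Rintegral plane setT (fun p => F (a + cpair p)) = Rintegral plane setT (fun p => F (cpair p)).
Proof.
move=> mF; have := preserves_Rint (shift1 (\col__ a)) (mC1 mF).
under eq_Rintegral do rewrite !mxE addrC.
by under [in X in _ = X -> _]eq_Rintegral do rewrite mxE.
Qed.

Lemma plane_shift_integrable (F : C -> R) a : mC F ->
  plane.-integrable setT (EFin \o (fun p => F (cpair p))) ->
  plane.-integrable setT (EFin \o (fun p => F (a + cpair p))).
Proof.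
move=> mF iF; have := @preserves_integrable _ _ _ _ _ _ mZ1 _ _ (shift1 (\col__ a)) _ (mC1 mF).
have -> : EFin \o (fun t => F (Z1 t 0 0)) = EFin \o (fun p => F (cpair p)).
  by apply/funext => p /=; rewrite mxE.
have -> : EFin \o (fun t => F ((Z1 t + \col__ a) 0 0)) = EFin \o (fun p => F (a + cpair p)).
  by apply/funext => p /=; rewrite !mxE addrC.
apply => // dd T Z mZ j; under eq_fun do rewrite !mxE.
by apply: cmeasD => //; exact: cmeas_cst.
Qed.

Lemma plane_opp_Rint (F : C -> R) : mC F ->
  Rintegral plane setT (fun p => F (- cpair p)) = Rintegral plane setT (fun p => F (cpair p)).
Proof.
move=> mF; have u1 : cabs (-1 : C) = 1 by rewrite cabsN cabs1.
have := preserves_Rint (rot1 u1) (mC1 mF).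
under eq_Rintegral do rewrite !mxE mulN1r.
by under [in X in _ = X -> _]eq_Rintegral do rewrite mxE.
Qed.

Lemma plane_opp_integrable (F : C -> R) : mC F ->
  plane.-integrable setT (EFin \o (fun p => F (cpair p))) ->
  plane.-integrable setT (EFin \o (fun p => F (- cpair p))).
Proof.
move=> mF iF; have u1 : cabs (-1 : C) = 1 by rewrite cabsN cabs1.
have := @preserves_integrable _ _ _ _ _ _ mZ1 _ _ (rot1 u1) _ (mC1 mF).
have -> : EFin \o (fun t => F (Z1 t 0 0)) = EFin \o (fun p => F (cpair p)).
  by apply/funext => p /=; rewrite mxE.
have -> : EFin \o (fun t => F ((-1 *: Z1 t) 0 0)) = EFin \o (fun p => F (- cpair p)).
  by apply/funext => p /=; rewrite !mxE mulN1r.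
by apply => //; exact: mmapZ.
Qed.

Lemma plane_avg (F : C -> R) : mC F -> plane.-integrable setT (EFin \o (fun p => F (cpair p))) ->
  Rintegral plane setT (fun p => I0 (fun t => F (cis t * cpair p))) =
  (pi *+ 2) * Rintegral plane setT (fun p => F (cpair p)).
Proof.
move=> mF iF; have := rot_average mZ1 rot1 (mC1 mF).
have -> : EFin \o (fun t => F (Z1 t 0 0)) = EFin \o (fun p => F (cpair p)).
  by apply/funext => p /=; rewrite mxE.
move=> /(_ iF); under eq_Rintegral => p _.
  under eq_Rintegral do rewrite !mxE.
  over.
by under [in X in _ = _ * X -> _]eq_Rintegral do rewrite mxE.
Qed.

Lemma mC_cre (f : C -> C) : (forall dd (T : measurableType dd) (Z : T -> C), cmeas Z -> cmeas (fun t => f (Z t))) ->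
  mC (fun z => cre (f z)).
Proof. by move=> mf dd T Z /mf []. Qed.

(** A radial weight passes through the average over rotations, which reduces the claim to single
    circles; [plane_avg] does the work of polar coordinates. *)
Lemma circ_plane (F G : C -> C) (lam : R) c (rho : C -> R) : entire1 F -> entire1 G -> 0 <= lam ->
  mC rho -> (forall t w, rho (cis t * w) = rho w) ->
  let a w := cre (rc (rho w) * c * F (rc lam * w) * conjc (G w)) in
  let b w := cre (rc (rho w) * c * F w * conjc (G (rc lam * w))) in
  plane.-integrable setT (EFin \o (fun p => a (cpair p))) ->
  plane.-integrable setT (EFin \o (fun p => b (cpair p))) ->
  Rintegral plane setT (fun p => a (cpair p)) = Rintegral plane setT (fun p => b (cpair p)).
Proof.
move=> eF eG l0 mrho rrho a b ia ib.
have mr dd (T : measurableType dd) (Z : T -> C) : cmeas Z -> cmeas (fun t => rc (rho (Z t)) * c).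
  by move=> mZ; apply: cmeasM; [apply: cmeas_real; exact: mrho|exact: cmeas_cst].
have ml dd (T : measurableType dd) (Z : T -> C) : cmeas Z -> cmeas (fun t => rc lam * Z t).
  by move=> mZ; apply: cmeasM => //; exact: cmeas_cst.
have ma : mC a.
  apply: mC_cre => dd T Z mZ; apply: cmeasM; first apply: cmeasM; first exact: mr.
    by apply: cmeas_entire1 => //; exact: ml.
  by apply: cmeasJ; exact: cmeas_entire1.
have mb : mC b.
  apply: mC_cre => dd T Z mZ; apply: cmeasM; first apply: cmeasM; first exact: mr.
    exact: cmeas_entire1.
  by apply: cmeasJ; apply: cmeas_entire1 => //; exact: ml.
have p0 : (pi *+ 2 : R) != 0 by rewrite gt_eqF// pmulrn_lgt0// pi_gt0.
apply: (mulfI p0); rewrite -(plane_avg ma ia) -(plane_avg mb ib).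
apply: eq_Rintegral => p _; rewrite /a /b.
under eq_Rintegral do rewrite rrho.
under [RHS]eq_Rintegral do rewrite rrho.
move: l0; rewrite le_eqVlt => /predU1P[<-|l0].
  have z0 w : rc 0 * w = 0 :> C by rewrite mul0r.
  under eq_Rintegral do rewrite z0.
  under [RHS]eq_Rintegral do rewrite z0.
  exact: circ_shift0.
exact: circ_shift.
Qed.

Definition growth1 (F : C -> C) := entire1 F /\ exists K : R, forall z, cabs (F z) <= K * expR (cabs z ^+ 2 / 2).

(** With Cf(z) = exp(z conj q) f(lam z + q), [sliceL] and [sliceR] are the real parts of the
    densities of <CF, G> and <F, CG>, Gaussian weight included, times a cutoff [W]. *)
Definition sliceL (lam : R) q (F G W : C -> C) z : R :=
  cre (cexp (z * conjc q - z * conjc z) * F (rc lam * z + q) * conjc (G z) * W z).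
Definition sliceR (lam : R) q (F G W : C -> C) z : R :=
  cre (cexp (- (z * conjc z)) * F z * conjc (cexp (z * conjc q) * G (rc lam * z + q)) * W z).

(* Cutoffs [W N -> 1] strong enough to make the truncated densities of
   [<Cf, g>] integrable when [f] and [g] only satisfy the pointwise growth bound
   of Fock functions. *)
Definition cutoff (lam : R) q (W : nat -> C -> C) :=
  [/\ forall N dd (T : measurableType dd) (Z : T -> C), cmeas Z -> cmeas (fun t => W N (Z t)),
   forall N, exists K k : R, 0 < k /\ forall z, cabs (W N z) *
     expR (cre (z * conjc q) + cabs (rc lam * z + q) ^+ 2 / 2 - cabs z ^+ 2 / 2) <= K * expR (- (k * cabs z ^+ 2)),
   exists M : R, forall N z, cabs (W N z) <= M &
   forall z (e : R), 0 < e -> exists N0, forall N, (N0 <= N)%N -> cabs (W N z - 1) <= e].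

(** The two sides may carry different cutoffs, because a contour shift also transforms the cutoff
    factor. *)
Definition coord_cut lam q W W' := [/\ cutoff lam q W, cutoff lam q W' &
  forall N F G, growth1 F -> growth1 G ->
   Rintegral plane setT (fun p => sliceL lam q F G (W N) (cpair p)) =
   Rintegral plane setT (fun p => sliceR lam q F G (W' N) (cpair p))].

Lemma gauss_plane_integrable (K k : R) : 0 < k ->
  plane.-integrable setT (EFin \o (fun p => K * expR (- (k * cabs (cpair p) ^+ 2)))).
Proof.
move=> k0.
suff H : plane.-integrable setT (fun p => (expR (- (k * cabs (cpair p) ^+ 2)))%:E).
  by have := integrableZl measurableT K H.
apply/integrableP; split; first by apply/measurable_EFinP; exact: measurable_gauss_plane.
have -> : (\int[plane]_x `|(expR (- (k * cabs (cpair x) ^+ 2)))%:E| = (gauss1 k ^+ 2)%:E)%E.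
  by rewrite -int_gauss_plane//; apply: eq_integral => p _; rewrite gee0_abs// lee_fin expR_ge0.
exact: ltry.
Qed.

Lemma cexp_negsq z : cabs (cexp (- (z * conjc z))) = expR (- (cabs z ^+ 2)) :> R.
Proof. by rewrite mulcJ cabs_cexp. Qed.

Section slice.
Variables (lam : R) (q : C) (W : nat -> C -> C) (F G : C -> C) (N : nat).
Hypotheses (hW : cutoff lam q W) (gF : growth1 F) (gG : growth1 G).

Lemma mC_sliceL : mC (sliceL lam q F G (W N)).
Proof.
have [mW _ _ _] := hW; have [eF _] := gF; have [eG _] := gG.
apply: mC_cre => dd T Z mZ.
have mc c : cmeas (fun _ : T => c) by exact: cmeas_cst.
apply: cmeasM; last exact: mW.
apply: cmeasM; last by apply: cmeasJ; exact: cmeas_entire1.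
apply: cmeasM.
  apply: cmeas_exp; apply: cmeasD; first exact: cmeasM.
  by apply: cmeasN; apply: cmeasM => //; exact: cmeasJ.
by apply: cmeas_entire1 => //; apply: cmeasD => //; exact: cmeasM.
Qed.

Lemma mC_sliceR : mC (sliceR lam q F G (W N)).
Proof.
have [mW _ _ _] := hW; have [eF _] := gF; have [eG _] := gG.
apply: mC_cre => dd T Z mZ.
have mc c : cmeas (fun _ : T => c) by exact: cmeas_cst.
apply: cmeasM; last exact: mW.
apply: cmeasM.
  apply: cmeasM; last exact: cmeas_entire1.
  by apply: cmeas_exp; apply: cmeasN; apply: cmeasM => //; exact: cmeasJ.
apply: cmeasJ; apply: cmeasM; first by apply: cmeas_exp; exact: cmeasM.
by apply: cmeas_entire1 => //; apply: cmeasD => //; exact: cmeasM.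
Qed.

Lemma growth1_bound : exists K : R, forall z, cabs (F z) <= K * expR (cabs z ^+ 2 / 2) /\ cabs (G z) <= K * expR (cabs z ^+ 2 / 2) /\ 0 <= K.
Proof.
have [_ [K1 H1]] := gF; have [_ [K2 H2]] := gG; exists (`|K1| + `|K2|) => z.
split; last split.
- apply: (le_trans (H1 z)); rewrite ler_wpM2r ?expR_ge0//.
  by rewrite (le_trans (ler_norm _))// lerDl.
- apply: (le_trans (H2 z)); rewrite ler_wpM2r ?expR_ge0//.
  by rewrite (le_trans (ler_norm _))// lerDr.
- by rewrite addr_ge0.
Qed.

(** Moving the map from [F] to [G] merely exchanges the exponents |z|^2 / 2 and |lam z + q|^2 / 2,
    so the one bound built into [cutoff] controls both densities. *)
Lemma slice_bound : exists K k : R, 0 < k /\ forall z,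
  `|sliceL lam q F G (W N) z| <= K * expR (- (k * cabs z ^+ 2)) /\
  `|sliceR lam q F G (W N) z| <= K * expR (- (k * cabs z ^+ 2)).
Proof.
have [K H] := growth1_bound; have [_ hb _ _] := hW; have [K' [k [k0 Hk]]] := hb N.
exists (K ^+ 2 * K'), k; split=> // z; have K0 : 0 <= K by have [_ [_]] := H 0.
have [Fz [Gz _]] := H z; have [Fl [Gl _]] := H (rc lam * z + q).
have e x : 0 <= expR x :> R by exact: expR_ge0.
have E : K * expR (cabs (rc lam * z + q) ^+ 2 / 2) * (K * expR (cabs z ^+ 2 / 2)) *
    (expR (cre (z * conjc q)) * expR (- (cabs z ^+ 2)) * cabs (W N z))
   <= K ^+ 2 * K' * expR (- (k * cabs z ^+ 2)).
  rewrite -[leRHS]mulrA; apply: le_trans (ler_wpM2l (sqr_ge0 K) (Hk z)).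
  rewrite le_eqVlt; apply/orP; left; apply/eqP.
  have -> : cre (z * conjc q) + cabs (rc lam * z + q) ^+ 2 / 2 - cabs z ^+ 2 / 2 =
    cre (z * conjc q) + cabs (rc lam * z + q) ^+ 2 / 2 + cabs z ^+ 2 / 2 + - cabs z ^+ 2 by field.
  rewrite !expRD; ring.
split; apply: (le_trans (ler_cre _)); apply: le_trans E; rewrite !cabsM.
- rewrite cexpD cabsM cexp_negsq cabs_cexp cabsJ.
  have -> : forall a b c d w : R, a * b * c * d * w = c * d * (a * b * w) by move=> *; ring.
  by apply: ler_wpM2r; [rewrite !mulr_ge0 ?cabs_ge0|apply: ler_pM; rewrite ?cabs_ge0].
- rewrite cabsJ cabsM cexp_negsq cabs_cexp.
  have -> : forall a b c d w : R, a * b * (c * d) * w = d * b * (c * a * w) by move=> *; ring.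
  by apply: ler_wpM2r; [rewrite !mulr_ge0 ?cabs_ge0|apply: ler_pM; rewrite ?cabs_ge0].
Qed.

Lemma sliceL_integrable : plane.-integrable setT (EFin \o (fun p => sliceL lam q F G (W N) (cpair p))).
Proof.
have [K [k [k0 H]]] := slice_bound.
apply: (le_integrable _ _ _ (gauss_plane_integrable K k0)) => //.
  by apply/measurable_EFinP; apply: mC_sliceL; exact: cmeas_cpair.
move=> p _ /=; rewrite lee_fin; apply: le_trans (ler_norm _); exact: (H _).1.
Qed.

Lemma sliceR_integrable : plane.-integrable setT (EFin \o (fun p => sliceR lam q F G (W N) (cpair p))).
Proof.
have [K [k [k0 H]]] := slice_bound.
apply: (le_integrable _ _ _ (gauss_plane_integrable K k0)) => //.
  by apply/measurable_EFinP; apply: mC_sliceR; exact: cmeas_cpair.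
move=> p _ /=; rewrite lee_fin; apply: le_trans (ler_norm _); exact: (H _).2.
Qed.

End slice.

End PlaneCut.

(** * The two kinds of cutoff: discs and strips *)

Section Cuts.
Variable R : realType.
Local Notation C := (complex R).
Local Notation rc x := (Complex (x : R) 0).
Local Notation plane := (@plane R).

Lemma cmeas_if dd (T : measurableType dd) (h : T -> R) (M : R) (f : T -> C) :
  measurable_fun setT h -> cmeas f -> cmeas (fun t => if h t < M then f t else 0).
Proof.
move=> mh [f1 f2]; have mb : measurable_fun setT (fun t => h t < M).
  by apply: measurable_fun_ltr => //; exact: measurable_cst.
split.
  by under eq_fun do rewrite fun_if; apply: measurable_fun_ifT => //; exact: measurable_cst.
by under eq_fun do rewrite fun_if; apply: measurable_fun_ifT => //; exact: measurable_cst.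
Qed.

Section CircleCut.
Variables (lam : R) (q p : C).
Hypothesis hq : q = (1 - rc lam) * p.

Let W (N : nat) z : C := if cabs (z - p) < N%:R then 1 else 0.

Let cutoffW : cutoff lam q W.
Proof.
split.
- move=> N dd T Z mZ; apply: cmeas_if; last exact: cmeas_cst.
  by apply: measurable_cabs; apply: cmeasD => //; exact: cmeas_cst.
- move=> N; set r : R := N%:R + cabs p.
  exists (expR (r * cabs q + (`|lam| * r + cabs q) ^+ 2 / 2 + r ^+ 2)), 1; split=> // z.
  rewrite /W; case: ifP => zN; last by rewrite cabs0 mul0r mulr_ge0 ?expR_ge0.
  rewrite cabs1 !mul1r -expRD ler_expR.
  have zr : cabs z <= r.
    have -> : z = (z - p) + p by ring.
    by apply: (le_trans (ler_cabsD _ _)); rewrite lerD2r ltW.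
  have h1 : cre (z * conjc q) <= r * cabs q.
    apply: (le_trans (ler_norm _)); apply: (le_trans (ler_cre _)).
    by rewrite cabsM cabsJ ler_wpM2r ?cabs_ge0.
  have h2 : cabs (rc lam * z + q) ^+ 2 <= (`|lam| * r + cabs q) ^+ 2.
    rewrite lerXn2r ?nnegrE ?cabs_ge0//.
      by rewrite addr_ge0 ?mulr_ge0 ?cabs_ge0// (le_trans _ zr)// cabs_ge0.
    apply: (le_trans (ler_cabsD _ _)); rewrite cabsM cabs_real lerD2r.
    by rewrite ler_wpM2l.
  have h3 : cabs z ^+ 2 <= r ^+ 2.
    by rewrite lerXn2r ?nnegrE ?cabs_ge0// (le_trans _ zr)// cabs_ge0.
  have h4 := sqr_ge0 (cabs z); lra.
- by exists 1 => N z; rewrite /W; case: ifP; rewrite ?cabs1 ?cabs0 ?lexx.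
- move=> z e e0; exists (Num.truncn (cabs (z - p))).+1 => N NN.
  rewrite /W ifT ?subrr ?cabs0 ?ltW//.
  by apply: (lt_le_trans (truncnS_gt _)); rewrite ler_nat.
Qed.

(* The map has the fixed point [p]; after recentring there, discs are invariant
   under rotations and the two sides agree by the circle shift. *)
Lemma fixpoint_cut : exists W W', coord_cut lam q W W'.
Proof.
exists W, W; split => // N F G gF gG.
have [eF _] := gF; have [eG _] := gG.
(* Translation to the fixed point with the Fock-space multiplier exp(- z conj p) turns the affine
   map into z |-> lam z; [c] = exp(- lam |p|^2) is the constant left over. *)
pose F1 z := F (p + z) * cexp (- (z * conjc p)).
pose G1 z := G (p + z) * cexp (- (z * conjc p)).
pose c : C := cexp (- (rc lam * (p * conjc p))).
pose rho (w : C) : R := (if cabs w < N%:R then 1 else 0) * expR (- cabs w ^+ 2).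
have eT (H : C -> C) : entire1 H -> entire1 (fun z => H (p + z) * cexp (- (z * conjc p))).
  move=> eH; apply: entire1M.
    apply: (@entire1_comp _ (fun z => p + z) H) => //.
    by apply: entire1D; [exact: entire1_cst|exact: entire1_id].
  apply: (@entire1_comp _ (fun z => - (z * conjc p)) (@cexp R)); last exact: entire1_cexp.
  have -> : (fun z : C => - (z * conjc p)) = (fun z => z * - conjc p) by apply/funext => z; rewrite mulrN.
  by apply: entire1M; [exact: entire1_id|exact: entire1_cst].
have eF1 := eT F eF; have eG1 := eT G eG.
have rhoE w : cexp (- (w * conjc w)) * W N (p + w) = rc (rho w).
  rewrite mulcJ /W /rho [p + w]addrC addrK.
  have -> : - rc (cabs w ^+ 2) = rc (- cabs w ^+ 2) by apply: cre_cim_inj; rewrite !cE ?oppr0.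
  by rewrite cexp_real; case: ifP => _; apply: cre_cim_inj; rewrite !cE; ring.
have hqJ : conjc q = (1 - rc lam) * conjc p.
  by rewrite hq conjcM; congr (_ * _); apply: cre_cim_inj; rewrite !cE; ring.
have arg w : rc lam * (p + w) + q = p + rc lam * w by rewrite hq; ring.
have lamJ : conjc (rc lam) = rc lam by apply: cre_cim_inj; rewrite !cE ?oppr0.
have aE w : sliceL lam q F G (W N) (p + w) =
    cre (rc (rho w) * c * F1 (rc lam * w) * conjc (G1 w)).
  rewrite /sliceL -rhoE arg; congr cre.
  have -> : cexp ((p + w) * conjc q - (p + w) * conjc (p + w)) =
    c * cexp (- (rc lam * w * conjc p)) * conjc (cexp (- (w * conjc p))) * cexp (- (w * conjc w)).
    rewrite /c -cexpJ -!cexpD; congr cexp.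
    by rewrite hqJ !(conjcN, conjcM, conjcK, conjcD); ring.
  by rewrite /F1 /G1 conjcM; ring.
have bE w : sliceR lam q F G (W N) (p + w) =
    cre (rc (rho w) * c * F1 w * conjc (G1 (rc lam * w))).
  rewrite /sliceR -rhoE arg; congr cre; rewrite conjcM.
  have -> : cexp (- ((p + w) * conjc (p + w))) =
    c * cexp (- (w * conjc p)) * conjc (cexp (- (rc lam * w * conjc p))) * cexp (- (w * conjc w))
     * cexp (- (conjc ((p + w) * conjc q))).
    rewrite /c -cexpJ -!cexpD; congr cexp.
    by rewrite hqJ !(conjcN, conjcM, conjcK, conjcD) lamJ conjc1; ring.
  have E : cexp (- (conjc ((p + w) * conjc q))) * conjc (cexp ((p + w) * conjc q)) = 1.
    by rewrite -cexpJ -cexpD addNr cexp0.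
  rewrite /F1 /G1 [conjc (G _ * _)]conjcM -[RHS]mulr1 -[in RHS]E; ring.
have mA := mC_sliceL N cutoffW gF gG; have mB := mC_sliceR N cutoffW gF gG.
rewrite -(plane_shift_Rint p mA) -(plane_shift_Rint p mB).
have iA := plane_shift_integrable p mA (sliceL_integrable N cutoffW gF gG).
have iB := plane_shift_integrable p mB (sliceR_integrable N cutoffW gF gG).
pose a w := cre (rc (rho w) * c * F1 (rc lam * w) * conjc (G1 w)).
pose b w := cre (rc (rho w) * c * F1 w * conjc (G1 (rc lam * w))).
have aE' : (fun t => sliceL lam q F G (W N) (p + cpair t)) = (fun t => a (cpair t)) by apply/funext => t; rewrite aE.
have bE' : (fun t => sliceR lam q F G (W N) (p + cpair t)) = (fun t => b (cpair t)) by apply/funext => t; rewrite bE.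
rewrite aE' in iA *; rewrite bE' in iB *.
have mrho : mC rho.
  move=> dd T Z mZ; apply: measurable_funM.
    by have [] := cmeas_if N%:R (measurable_cabs mZ) (cmeas_cst _ (1 : C)); under eq_fun do rewrite fun_if.
  by apply: measurableT_comp => //; apply: measurableT_comp => //; apply: measurable_funX; exact: measurable_cabs.
have rrho t w : rho (cis t * w) = rho w by rewrite /rho cabsM cabs_cis mul1r.
have [l0|l0] := leP 0 lam; first exact: (circ_plane eF1 eG1 l0 mrho rrho iA iB).
(* A negative [lam] is reduced to [- lam]: reflect the argument of [F1] and substitute -w in the
   right-hand integral. *)
have rhoN w : rho (- w) = rho w by rewrite /rho cabsN.
pose F2 z := F1 (- z).
have eF2 : entire1 F2.
  apply: (@entire1_comp _ (fun z => - z) F1) => //.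
  have -> : (fun z : C => - z) = (fun z => -1 * z) by apply/funext => z; rewrite mulN1r.
  by apply: entire1M; [exact: entire1_cst|exact: entire1_id].
have nl : 0 <= - lam by rewrite oppr_ge0 ltW.
have rN w : rc (- lam) * w = - (rc lam * w) by apply: cre_cim_inj; rewrite !cE; ring.
have aN : (fun t => a (cpair t)) = (fun t => cre (rc (rho (cpair t)) * c * F2 (rc (- lam) * cpair t) * conjc (G1 (cpair t)))).
  by apply/funext => t; rewrite /a /F2 rN opprK.
have bN : (fun t => b (- cpair t)) = (fun t => cre (rc (rho (cpair t)) * c * F2 (cpair t) * conjc (G1 (rc (- lam) * cpair t)))).
  by apply/funext => t; rewrite /b /F2 rhoN rN mulrN.
have mb : mC b.
  move=> dd T Z mZ; have : cmeas (fun t => Z t - p) by apply: cmeasD => //; exact: cmeas_cst.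
  have : cmeas (fun t => rc (rho (Z t)) * c * F1 (Z t) * conjc (G1 (rc lam * Z t))).
    have mc k : cmeas (fun _ : T => k) by exact: cmeas_cst.
    apply: cmeasM; first apply: cmeasM; first apply: cmeasM => //.
    + by apply: cmeas_real; exact: mrho.
    + exact: cmeas_entire1.
    + by apply: cmeasJ; apply: cmeas_entire1 => //; exact: cmeasM.
  by case.
rewrite -(plane_opp_Rint mb) aN bN; rewrite aN in iA.
apply: (circ_plane eF2 eG1 nl mrho rrho iA).
have := plane_opp_integrable mb iB.
by have -> : EFin \o (fun t => b (- cpair t)) = EFin \o (fun t => cre (rc (rho (cpair t)) * c * F2 (cpair t) * conjc (G1 (rc (- lam) * cpair t)))) by rewrite bN.
Qed.

End CircleCut.

Lemma circle_cut (lam : R) q : lam != 1 -> exists W W', coord_cut lam q W W'.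
Proof.
move=> l1; apply: (@fixpoint_cut lam q (q / rc (1 - lam))).
have -> : 1 - rc lam = rc (1 - lam) by apply: cre_cim_inj; rewrite !cE; ring.
by rewrite mulrC divfK// eq_complex /= eqxx andbT subr_eq0 eq_sym.
Qed.
Section LineCut.
Variable c : R.
Hypothesis c0 : 0 <= c.
Local Notation ii := (Complex (0 : R) 1).

(** Strength of the damping, tending to 0; the successor keeps it positive at N = 0. *)
Let ep (N : nat) : R := (N.+1%:R)^-1.
Let ep0 N : 0 < ep N. Proof. by rewrite invr_gt0. Qed.
(* [Complex s (2 Im z)] is [z - conj z + s]. *)
Let W (s : R) (N : nat) (z : C) : C :=
  if `|cre z| < N%:R then cexp (rc (ep N / 4) * Complex s (2 * cim z) ^+ 2) else 0.

Let cabsW s N z : `|cre z| < N%:R -> cabs (W s N z) = expR (ep N / 4 * (s ^+ 2 - 4 * cim z ^+ 2)).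
Proof.
by move=> h; rewrite /W h cabs_cexp expr2 !cE; congr expR; ring.
Qed.

Let cutoffW s : `|s| = c -> cutoff 1 (rc c) (W s).
Proof.
move=> sc; have s2 : s ^+ 2 = c ^+ 2 by rewrite -sc real_normK// num_real.
split.
- move=> N dd T Z mZ; have [m1 m2] := mZ; apply: cmeas_if.
    exact: measurableT_comp.
  apply: cmeas_exp; apply: cmeasM; first exact: cmeas_cst.
  rewrite /=; have mm : cmeas (fun t => Complex s (2 * cim (Z t))).
    by split; [exact: measurable_cst|exact: measurable_funM].
  by under eq_fun do rewrite expr2; exact: cmeasM.
(* For lam = 1 the quadratic terms cancel and the exponent to beat is 2 c Re z + c^2 / 2. The strip
   bounds Re z by N, and the modulus of the cutoff supplies exp(- [ep N] (Im z)^2). *)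
- move=> N; exists (expR (2 * c * N%:R + c ^+ 2 / 2 + ep N * c ^+ 2 / 4 + ep N * N%:R ^+ 2)), (ep N).
  split=> // z; case: (ltP `|cre z| N%:R) => zN; last first.
    by rewrite /W ltNge zN cabs0 mul0r mulr_ge0 ?expR_ge0.
  rewrite cabsW// s2 -!expRD ler_expR.
  rewrite !sqr_cabs !cE.
  have h1 : cre z * c <= N%:R * c.
    by rewrite ler_wpM2r// ltW// (le_lt_trans (ler_norm _)).
  have h2 : ep N * cre z ^+ 2 <= ep N * N%:R ^+ 2.
    rewrite ler_wpM2l ?(ltW (ep0 N))// -[X in X <= _]real_normK ?num_real//.
    by rewrite lerXn2r ?nnegrE// ltW.
  move: h1 h2; set x := cre z; set y := cim z; set e := ep N; set n : R := N%:R => h1 h2.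
  rewrite -subr_ge0.
  set L := (X in 0 <= X).
  have -> : L = 2 * (n * c - x * c) + (e * n ^+ 2 - e * x ^+ 2) by rewrite /L; field.
  by rewrite addr_ge0 ?mulr_ge0 ?subr_ge0.
- exists (expR (c ^+ 2 / 4)) => N z; case: (ltP `|cre z| N%:R) => zN; last first.
    by rewrite /W ltNge zN cabs0 expR_ge0.
  rewrite cabsW// ler_expR s2.
  have := mulr_ge0 (ltW (ep0 N)) (sqr_ge0 (cim z)).
  have : ep N * c ^+ 2 <= 1 * c ^+ 2 by rewrite ler_wpM2r ?sqr_ge0// invf_le1// ler1n.
  lra.
- move=> z e e0; have [d [d0 H]] := entire1_cont 0 (@entire1_cexp R) e0.
  set w : C := Complex s (2 * cim z) ^+ 2.
  exists (maxn (Num.truncn `|cre z|).+1 (Num.truncn (cabs w / d)).+1) => N.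
  rewrite geq_max => /andP[N1 N2].
  rewrite /W ifT; last by apply: (lt_le_trans (truncnS_gt _)); rewrite ler_nat.
  have := H (rc (ep N / 4) * w); rewrite add0r cexp0; apply.
  rewrite cabsM cabs_real ger0_norm ?divr_ge0 ?(ltW (ep0 N))//.
  have : cabs w / d < N.+1%:R.
    by apply: (lt_le_trans (truncnS_gt _)); rewrite ler_nat; apply: leqW.
  rewrite ltr_pdivrMr// => h.
  have h2 : ep N * cabs w < d by rewrite /ep mulrC ltr_pdivrMr// mulrC.
  have h3 : 0 <= ep N * cabs w by rewrite mulr_ge0 ?cabs_ge0 ?(ltW (ep0 N)).
  have -> : ep N / 4 * cabs w = ep N * cabs w / 4 by ring.
  by lra.
Qed.

(* For each real part, moving the contour in the imaginary variable from [0] to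
   [c] turns one truncated integrand into the other. *)
Lemma line_cut : exists W W', coord_cut 1 (rc c) W W'.
Proof.
(* For tau = y + i c, the factor c + 2 i tau becomes - c + 2 i y: the shift carries the first cutoff
   into the second. *)
exists (W c), (W (- c)); split => //.
- by apply: cutoffW; rewrite ger0_norm.
- by apply: cutoffW; rewrite normrN ger0_norm.
move=> N F G gF gG.
have wA : cutoff 1 (rc c) (W c) by apply: cutoffW; rewrite ger0_norm.
have wB : cutoff 1 (rc c) (W (- c)) by apply: cutoffW; rewrite normrN ger0_norm.
have iA := sliceL_integrable N wA gF gG.
have iB := sliceR_integrable N wB gF gG.
have [eF _] := gF; have [eG _] := gG.
(* This order keeps the real part [x] fixed and leaves the imaginary part as the inner variable. *)
rewrite (Rint_fubini2 iA) (Rint_fubini2 iB).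
apply: eq_Rintegral => x _.
rewrite /cpair /=.
have [xN|xN] := ltP `|x| N%:R; last first.
  apply: eq_Rintegral => y _; rewrite /sliceL /sliceR /W /= ltNge xN /=.
  by rewrite !mulr0.
(* The left integrand at x + i tau, with conj z continued as x - i tau; raising tau by i c turns F(z
   + c) conj(G(z)) into F(z) conj(G(z + c)). *)
pose E tau := cexp (rc c * (rc x + ii * tau)) * F (rc (x + c) + ii * tau) *
  conjc (G (conjc (rc x - ii * tau))) * cexp (- (rc (x ^+ 2) + tau * tau)) *
  cexp (rc (ep N / 4) * (rc c + 2 * ii * tau) ^+ 2).
have elin (k a : C) : entire1 (fun z => k + a * z).
  by apply: entire1D; [exact: entire1_cst|apply: entire1M; [exact: entire1_cst|exact: entire1_id]].
have eE : entire1 E.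
  have ecx f : entire1 f -> entire1 (fun z => cexp (f z)).
    by move=> ef; apply: entire1_comp => //; exact: entire1_cexp.
  have neg f : entire1 f -> entire1 (fun z => - f z).
    move=> ef; have -> : (fun z => - f z) = (fun z => -1 * f z) by apply/funext => z; rewrite mulN1r.
    by apply: entire1M => //; exact: entire1_cst.
  apply: entire1M; first apply: entire1M; first apply: entire1M; first apply: entire1M.
  - by apply: ecx; apply: entire1M; [exact: entire1_cst|exact: elin].
  - by apply: (@entire1_comp _ (fun z => rc (x + c) + ii * z) F).
  - apply: (@entire1_comp _ (fun z => rc x - ii * z) (fun z => conjc (G (conjc z)))).
      by have -> : (fun z => rc x - ii * z) = (fun z => rc x + (- ii) * z) by apply/funext => z; rewrite mulNr.
    exact: entire1_conj.
  - apply: ecx; apply: neg; apply: entire1D; first exact: entire1_cst.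
    by apply: entire1M; exact: entire1_id.
  - apply: ecx; apply: entire1M; first exact: entire1_cst.
    by apply: entire1M; exact: elin.
have EA y : cre (E (rc y)) = sliceL 1 (rc c) F G (W c N) (Complex x y).
  rewrite /sliceL /W /= xN; congr cre.
  rewrite /E.
  have -> : rc (x + c) + ii * rc y = rc 1 * Complex x y + rc c by apply: cre_cim_inj; rewrite !cE; ring.
  have -> : conjc (rc x - ii * rc y) = Complex x y by apply: cre_cim_inj; rewrite !cE; ring.
  have -> : rc c + 2 * ii * rc y = Complex c (2 * y) by apply: cre_cim_inj; rewrite !cE /=; ring.
  have -> : cexp (Complex x y * conjc (rc c) - Complex x y * conjc (Complex x y)) =
    cexp (rc c * (rc x + ii * rc y)) * cexp (- (rc (x ^+ 2) + rc y * rc y)).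
    by rewrite -cexpD; congr cexp; apply: cre_cim_inj; rewrite !cE; ring.
  ring.
have EB y : cre (E (Complex y c)) = sliceR 1 (rc c) F G (W (- c) N) (Complex x y).
  rewrite /sliceR /W /= xN; congr cre.
  rewrite /E.
  have -> : rc (x + c) + ii * Complex y c = Complex x y by apply: cre_cim_inj; rewrite !cE; ring.
  have -> : conjc (rc x - ii * Complex y c) = rc 1 * Complex x y + rc c by apply: cre_cim_inj; rewrite !cE; ring.
  have -> : rc c + 2 * ii * Complex y c = Complex (- c) (2 * y) by apply: cre_cim_inj; rewrite !cE /=; ring.
  rewrite conjcM -cexpJ.
  have X : cexp (- (Complex x y * conjc (Complex x y))) * cexp (conjc (Complex x y * conjc (rc c))) =
    cexp (rc c * (rc x + ii * Complex y c)) * cexp (- (rc (x ^+ 2) + Complex y c * Complex y c)).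
    by rewrite -!cexpD; congr cexp; apply: cre_cim_inj; rewrite !cE; ring.
  transitivity (cexp (rc c * (rc x + ii * Complex y c)) * cexp (- (rc (x ^+ 2) + Complex y c * Complex y c)) *
     F (Complex x y) * conjc (G (rc 1 * Complex x y + rc c)) * cexp (rc (ep N / 4) * Complex (- c) (2 * y) ^+ 2)).
    ring.
  by rewrite -X; ring.
under eq_Rintegral do rewrite -EA.
under [RHS]eq_Rintegral do rewrite -EB.
have [K HK] := growth1_bound gF gG.
have K0 : 0 <= K by have [_ []] := HK 0.
(* At height s the exponent is the one at height 0 minus (2 + [ep N]) s (c - s), so the bound at
   height 0 serves for all 0 <= s <= c. *)
apply: (@line_shift _ E eE c (ep N) (K ^+ 2 * expR (2 * c * x + c ^+ 2 / 2 + ep N * c ^+ 2 / 4))) => //.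
move=> y s /andP[s0 sc].
rewrite /E !cabsM !cabs_cexp cabsJ.
have [Fb _] := HK (rc (x + c) + ii * Complex y s).
have [_ [Gb _]] := HK (conjc (rc x - ii * Complex y s)).
rewrite cabsJ in Gb.
apply: (@le_trans _ _ (expR (cre (rc c * (rc x + ii * Complex y s))) *
  (K * expR (cabs (rc (x + c) + ii * Complex y s) ^+ 2 / 2)) *
  (K * expR (cabs (rc x - ii * Complex y s) ^+ 2 / 2)) *
  expR (cre (- (rc (x ^+ 2) + Complex y s * Complex y s))) *
  expR (cre (rc (ep N / 4) * (rc c + 2 * ii * Complex y s) ^+ 2)))).
  rewrite ler_wpM2r ?expR_ge0// ler_wpM2r ?expR_ge0//.
  apply: ler_pM; rewrite ?mulr_ge0 ?cabs_ge0 ?expR_ge0//.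
    by rewrite ler_wpM2l ?expR_ge0.
have -> : forall a b d e f : R, a * (K * b) * (K * d) * e * f = K ^+ 2 * (a * b * d * e * f).
  by move=> *; ring.
rewrite -[leRHS]mulrA ler_wpM2l ?sqr_ge0// -!expRD ler_expR !sqr_cabs expr2 !cE.
have e0 := ltW (ep0 N).
have h1 : 0 <= s * (c - s) by rewrite mulr_ge0// subr_ge0.
have h2 := mulr_ge0 e0 h1.
rewrite -subr_ge0; set L := (X in 0 <= X).
have -> : L = 2 * (s * (c - s)) + ep N * (s * (c - s)) by rewrite /L /=; field.
by rewrite addr_ge0// mulr_ge0.
Qed.

End LineCut.
End Cuts.

(** * Symmetry for diagonal and Hermitian matrices *)

Section Diagonal.
Variable R : realType.
Local Notation C := (complex R).
Local Notation rc x := (Complex (x : R) 0).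
Local Notation plane := (@plane R).
Local Notation T_ n := (ms_T (cspace R n)).
Local Notation mu_ n := (ms_mu (cspace R n)).

Definition cseqmeas (f : (nat -> C) -> C) := forall dd (T : measurableType dd) (Z : T -> nat -> C),
  (forall k, cmeas (Z^~ k)) -> cmeas (fun t => f (Z t)).

Definition ssq n (z : nat -> C) : R := \sum_(j < n) cabs (z j) ^+ 2.

(** Functions of [n] coordinates live on whole sequences, so that freezing a coordinate with [cset]
    stays within one type. Analyticity is recorded in each coordinate separately, as coordinates are
    treated one at a time. *)
Definition cseq_growth n (f : (nat -> C) -> C) := [/\ cseqmeas f,
  forall j z, entire1 (fun w => f (cset z j w)) &
  exists K : R, forall z, cabs (f z) <= K * expR (ssq n z / 2)].

Lemma ssq_ge0 n z : 0 <= ssq n z.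
Proof. by apply: sumr_ge0 => j _; rewrite sqr_ge0. Qed.

Lemma ssq_ccoord n (t : T_ n) : ssq n (ccoord t) = cnorm2 (cpoint t).
Proof. by rewrite cnorm2E; apply: eq_bigr => j _; rewrite mxE. Qed.

Lemma ssqS n z : ssq n.+1 z = ssq n z + cabs (z n) ^+ 2.
Proof. by rewrite /ssq big_ord_recr. Qed.

Lemma ssq_cset n z w : ssq n (cset z n w) = ssq n z.
Proof. by apply: eq_bigr => j _; rewrite /cset ltn_eqF. Qed.

Lemma cset_same z j w w' : cset (cset z j w) j w' = cset z j w' :> (nat -> C).
Proof. by apply/funext => k; rewrite /cset; case: eqP. Qed.
Lemma cset_swap z i j w w' : i != j -> cset (cset z i w) j w' = cset (cset z j w') i w :> (nat -> C).
Proof.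
move=> ij; apply/funext => k; rewrite /cset; case: (eqVneq k j) => [->|//].
by rewrite eq_sym (negbTE ij).
Qed.

Lemma cseq_growth_scale n f (a : C) : cseq_growth n f -> cseq_growth n (fun z => a * f z).
Proof.
move=> [gf ef [K HK]]; split.
- by move=> dd T Z mZ; apply: cmeasM; [exact: cmeas_cst|exact: gf].
- by move=> j z; apply: entire1M => //; exact: entire1_cst.
- by exists (cabs a * K) => z; rewrite cabsM -mulrA ler_wpM2l ?cabs_ge0.
Qed.

Lemma cseq_growth_cset n f (w : C) : cseq_growth n.+1 f -> cseq_growth n (fun z => f (cset z n w)).
Proof.
move=> [gf ef [K HK]]; split.
- by move=> dd T Z mZ; apply: gf; apply: cmeas_cset => //; exact: cmeas_cst.
- move=> j z; have [->|jn] := eqVneq j n.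
    by under eq_fun do rewrite cset_same; exact: entire1_cst.
  by under eq_fun do rewrite cset_swap//; exact: ef.
- exists (K * expR (cabs w ^+ 2 / 2)) => z; apply: (le_trans (HK _)).
  rewrite ssqS ssq_cset /cset eqxx mulrDl expRD; rewrite le_eqVlt; apply/orP; left; apply/eqP; ring.
Qed.

Section Mask.
Variables (lam : nat -> R) (q : nat -> C) (W W' : nat -> nat -> C -> C).
Hypothesis hcut : forall j, coord_cut (lam j) (q j) (W j) (W' j).
Variable N : nat.

(* A mask [s] records on which side of the sesquilinear form the map acts in
   each coordinate. *)
Definition mask_weight (s : nat -> bool) j w : C :=
  if s j then cexp (w * conjc (q j) - w * conjc w) * W j N w
  else cexp (- (w * conjc w)) * conjc (cexp (w * conjc (q j))) * W' j N w.
Definition mask_argL (s : nat -> bool) j w : C := if s j then rc (lam j) * w + q j else w.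
Definition mask_argR (s : nat -> bool) j w : C := if s j then w else rc (lam j) * w + q j.
Definition mapn n (a : nat -> C -> C) (z : nat -> C) : nat -> C := fun k => if (k < n)%N then a k (z k) else z k.
Definition mask_density n s f g (z : nat -> C) : R :=
  cre ((\prod_(j < n) mask_weight s j (z j)) * f (mapn n (mask_argL s) z) * conjc (g (mapn n (mask_argR s) z))).

Lemma mapnS n a z w : mapn n.+1 a (cset z n w) = cset (mapn n a z) n (a n w).
Proof.
apply/funext => k; rewrite /mapn /cset; have [->|kn] := eqVneq k n; first by rewrite ltnSn.
by rewrite ltnS leq_eqVlt (negbTE kn).
Qed.

Lemma mask_densityS n s f g z w : mask_density n.+1 s f g (cset z n w) =
  mask_density n s (fun z => mask_weight s n w * f (cset z n (mask_argL s n w))) (fun z => g (cset z n (mask_argR s n w))) z.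
Proof.
rewrite /mask_density big_ord_recr /= !mapnS; congr cre.
have -> : cset z n w n = w by rewrite /cset eqxx.
have -> : \prod_(i < n) mask_weight s i (cset z n w i) = \prod_(i < n) mask_weight s i (z i).
  by apply: eq_bigr => j _; rewrite /cset ltn_eqF.
ring.
Qed.

Lemma mask_weight_meas s j dd (T : measurableType dd) (Z : T -> C) : cmeas Z -> cmeas (fun t => mask_weight s j (Z t)).
Proof.
move=> mZ; have [[mW _ _ _] [mW' _ _ _] _] := hcut j; rewrite /mask_weight.
have mc c : cmeas (fun _ : T => c) by exact: cmeas_cst.
case: (s j).
  apply: cmeasM; last exact: mW.
  apply: cmeas_exp; apply: cmeasD; first exact: cmeasM.
  by apply: cmeasN; apply: cmeasM => //; exact: cmeasJ.
apply: cmeasM; last exact: mW'.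
apply: cmeasM; first by apply: cmeas_exp; apply: cmeasN; apply: cmeasM => //; exact: cmeasJ.
by apply: cmeasJ; apply: cmeas_exp; exact: cmeasM.
Qed.

Lemma cmeas_prod n dd (T : measurableType dd) (F : nat -> T -> C) : (forall j, cmeas (F j)) ->
  cmeas (fun t => \prod_(j < n) F j t).
Proof.
move=> mF; elim: n => [|n IH].
  by under eq_fun do rewrite big_ord0; exact: cmeas_cst.
by under eq_fun do rewrite big_ord_recr; exact: cmeasM.
Qed.

Lemma mask_argL_meas s j dd (T : measurableType dd) (Z : T -> C) : cmeas Z ->
  cmeas (fun t => mask_argL s j (Z t)) /\ cmeas (fun t => mask_argR s j (Z t)).
Proof.
move=> mZ; have H : cmeas (fun t => rc (lam j) * Z t + q j).
  by apply: cmeasD; [apply: cmeasM => //|]; exact: cmeas_cst.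
by rewrite /mask_argL /mask_argR; case: (s j).
Qed.

Lemma mapn_meas n a dd (T : measurableType dd) (Z : T -> nat -> C) :
  (forall j, cmeas (fun t => a j (Z t j))) -> (forall k, cmeas (Z^~ k)) ->
  forall k, cmeas (fun t => mapn n a (Z t) k).
Proof. by move=> ma mZ k; rewrite /mapn; case: (k < n)%N. Qed.

Lemma mask_density_meas n s f g : cseqmeas f -> cseqmeas g -> cseqmeasR (mask_density n s f g).
Proof.
move=> gf gg dd T Z mZ.
suff : cmeas (fun t => (\prod_(j < n) mask_weight s j (Z t j)) * f (mapn n (mask_argL s) (Z t)) * conjc (g (mapn n (mask_argR s) (Z t)))) by case.
apply: cmeasM; last first.
  by apply: cmeasJ; apply: gg; apply: (@mapn_meas n (mask_argR s) _ _ Z _ mZ) => j; have [] := mask_argL_meas s j (mZ j).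
apply: cmeasM; first by apply: (@cmeas_prod n _ _ (fun j t => mask_weight s j (Z t j))) => j; exact: mask_weight_meas.
by apply: gf; apply: (@mapn_meas n (mask_argL s) _ _ Z _ mZ) => j; have [] := mask_argL_meas s j (mZ j).
Qed.

Lemma mask_weight_bound s j : exists K k : R, 0 < k /\ forall w,
  cabs (mask_weight s j w) * expR (cabs (mask_argL s j w) ^+ 2 / 2 + cabs (mask_argR s j w) ^+ 2 / 2) <= K * expR (- (k * cabs w ^+ 2)).
Proof.
have [[_ hW _ _] [_ hW' _ _] _] := hcut j.
have [K1 [k1 [k10 H1]]] := hW N; have [K2 [k2 [k20 H2]]] := hW' N.
rewrite /mask_weight /mask_argL /mask_argR; case: (s j).
  exists K1, k1; split=> // w; apply: le_trans (H1 w).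
  rewrite cabsM cexpD cabsM cexp_negsq cabs_cexp -mulrA mulrCA.
  rewrite le_eqVlt; apply/orP; left; apply/eqP.
  have -> : cre (w * conjc (q j)) + cabs (rc (lam j) * w + q j) ^+ 2 / 2 - cabs w ^+ 2 / 2 =
    cre (w * conjc (q j)) + - cabs w ^+ 2 + (cabs (rc (lam j) * w + q j) ^+ 2 / 2 + cabs w ^+ 2 / 2) by field.
  rewrite (expRD (cre _ + _)) (expRD (cre _)); ring.
exists K2, k2; split=> // w; apply: le_trans (H2 w).
rewrite !cabsM cexp_negsq cabsJ cabs_cexp.
rewrite le_eqVlt; apply/orP; left; apply/eqP.
have -> : cre (w * conjc (q j)) + cabs (rc (lam j) * w + q j) ^+ 2 / 2 - cabs w ^+ 2 / 2 =
  cre (w * conjc (q j)) + - cabs w ^+ 2 + (cabs w ^+ 2 / 2 + cabs (rc (lam j) * w + q j) ^+ 2 / 2) by field.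
rewrite (expRD (cre _ + _)) (expRD (cre _)); ring.
Qed.

(** The coordinate bounds multiply, and the smallest of the Gaussian rates survives. *)
Lemma prod_mask_weight_bound n s : exists K k : R, 0 < k /\ forall z : nat -> C,
  cabs (\prod_(j < n) mask_weight s j (z j)) * expR (ssq n (mapn n (mask_argL s) z) / 2 + ssq n (mapn n (mask_argR s) z) / 2)
   <= K * expR (- (k * ssq n z)).
Proof.
elim: n => [|n [K [k [k0 IH]]]].
  by exists 1, 1; split => // z; rewrite /ssq !big_ord0 cabs1 !mul0r mulr0 addr0 oppr0.
have [K' [k' [k'0 H]]] := mask_weight_bound s n.
exists (K * K'), (Num.min k k'); split; first by rewrite lt_min k0.
move=> z; rewrite big_ord_recr /= !ssqS cabsM.
have E a : ssq n (mapn n.+1 a z) = ssq n (mapn n a z).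
  by apply: eq_bigr => j _; rewrite /mapn ltnS (ltnW (ltn_ord j)) ltn_ord.
rewrite !E.
have -> : mapn n.+1 (mask_argL s) z n = mask_argL s n (z n) by rewrite /mapn ltnSn.
have -> : mapn n.+1 (mask_argR s) z n = mask_argR s n (z n) by rewrite /mapn ltnSn.
set P := cabs (\prod_(j < n) _); set Q := cabs (mask_weight s n (z n)).
have -> : forall a b c d : R, (a + b) / 2 + (c + d) / 2 = (a / 2 + c / 2) + (b / 2 + d / 2) by move=> *; field.
rewrite expRD mulrACA.
apply: le_trans (ler_pM _ _ (IH z) (H (z n))) _; rewrite ?mulr_ge0 ?cabs_ge0 ?expR_ge0//.
have KK : 0 <= K * K'.
  apply: mulr_ge0.
    have : 0 <= K * expR (- (k * ssq n z)).
      by apply: le_trans (IH z); rewrite mulr_ge0 ?cabs_ge0 ?expR_ge0.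
    by rewrite pmulr_lge0 ?expR_gt0.
  have : 0 <= K' * expR (- (k' * cabs (z n) ^+ 2)).
    by apply: le_trans (H (z n)); rewrite mulr_ge0 ?cabs_ge0 ?expR_ge0.
  by rewrite pmulr_lge0 ?expR_gt0.
rewrite mulrACA ler_wpM2l// -expRD ler_expR -opprD lerN2 mulrDr lerD//.
  by rewrite ler_wpM2r ?ssq_ge0// ge_min lexx.
by rewrite ler_wpM2r ?sqr_ge0// ge_min lexx orbT.
Qed.

Lemma gauss_cspace_integrable n (K k : R) : 0 < k ->
  (mu_ n).-integrable setT (EFin \o (fun t => K * expR (- (k * ssq n (ccoord t))))).
Proof.
move=> k0.
suff H : (mu_ n).-integrable setT (fun t : T_ n => (expR (- (k * ssq n (ccoord t))))%:E).
  by have := integrableZl measurableT K H.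
apply/integrableP; split.
  apply/measurable_EFinP; under eq_fun do rewrite ssq_ccoord.
  by apply: (@mvecR_gauss R n k); exact: cmeasv_cpoint.
have -> : (\int[mu_ n]_t `|(expR (- (k * ssq n (ccoord t))))%:E| = (gauss1 k ^+ 2 ^+ n)%:E)%E.
  rewrite -int_gauss_cspace//; apply: eq_integral => t _.
  by rewrite ssq_ccoord gee0_abs// lee_fin expR_ge0.
exact: ltry.
Qed.

(** For every mask, mixed ones included, the cutoffs outweigh the growth of [f] and [g]; this
    licenses Fubini while the mask is being changed. *)
Lemma mask_density_integrable n s f g : cseq_growth n f -> cseq_growth n g ->
  (mu_ n).-integrable setT (EFin \o (fun t => mask_density n s f g (ccoord t))).
Proof.
move=> [gf ef [K1 H1]] [gg eg [K2 H2]]; have [K [k [k0 H]]] := prod_mask_weight_bound n s.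
apply: (le_integrable _ _ _ (gauss_cspace_integrable n (`|K1| * `|K2| * K) k0)) => //.
  by apply/measurable_EFinP; apply: mask_density_meas => // j; exact: cmeas_ccoord.
move=> t _ /=; rewrite lee_fin; apply: le_trans (ler_norm _).
apply: (le_trans (ler_cre _)); rewrite !cabsM cabsJ.
rewrite -[leRHS]mulrA; apply: le_trans (ler_wpM2l _ (H (ccoord t))); last by rewrite mulr_ge0.
rewrite expRD.
set P := cabs (\prod_(j < n) _).
set a := expR _; set b := expR _.
have -> : `|K1| * `|K2| * (P * (a * b)) = P * (`|K1| * a) * (`|K2| * b) by ring.
have Ha : cabs (f (mapn n (mask_argL s) (ccoord t))) <= `|K1| * a.
  by apply: (le_trans (H1 _)); rewrite ler_wpM2r ?expR_ge0// ler_norm.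
have Hb : cabs (g (mapn n (mask_argR s) (ccoord t))) <= `|K2| * b.
  by apply: (le_trans (H2 _)); rewrite ler_wpM2r ?expR_ge0// ler_norm.
by apply: ler_pM => //; [rewrite mulr_ge0 ?cabs_ge0|exact: cabs_ge0|exact: (ler_wpM2l (cabs_ge0 _) Ha)].
Qed.

Lemma cseq_growth_growth1 n f z (a : C) : cseq_growth n.+1 f -> growth1 (fun w => a * f (cset z n w)).
Proof.
move=> [gf ef [K HK]]; split; first by apply: entire1M; [exact: entire1_cst|exact: ef].
exists (cabs a * (K * expR (ssq n z / 2))) => w; rewrite cabsM -mulrA ler_wpM2l ?cabs_ge0//.
apply: (le_trans (HK _)); rewrite ssqS ssq_cset /cset eqxx mulrDl expRD; rewrite le_eqVlt.
by apply/orP; left; apply/eqP; ring.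
Qed.

(** With the other coordinates frozen, the density is a one-variable slice whose [F] absorbs the
    weights of the first [n] coordinates, and the cut of coordinate [n] applies. *)
Lemma mask_density_coord n s f g z : cseq_growth n.+1 f -> cseq_growth n.+1 g ->
  Rintegral plane setT (fun p => mask_density n.+1 s f g (cset z n (cpair p))) =
  Rintegral plane setT (fun p => mask_density n.+1 (fun j => if j == n then true else s j) f g (cset z n (cpair p))).
Proof.
move=> cf cg; case sn : (s n).
  have -> // : (fun j => if j == n then true else s j) = s.
  by apply/funext => j; case: eqP => // ->.
pose s' j := if j == n then true else s j.
have [_ _ H] := hcut n.
pose F w := (\prod_(j < n) mask_weight s j (z j)) * f (cset (mapn n (mask_argL s) z) n w).
pose G w := 1 * g (cset (mapn n (mask_argR s) z) n w).
have := H N F G (cseq_growth_growth1 _ _ cf) (cseq_growth_growth1 _ _ cg).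
have -> : (fun p => mask_density n.+1 s f g (cset z n (cpair p))) = (fun p => sliceR (lam n) (q n) F G (W' n N) (cpair p)).
  apply/funext => p; rewrite mask_densityS /mask_density /sliceR /F /G; congr cre.
  have -> w : mask_weight s n w = cexp (- (w * conjc w)) * conjc (cexp (w * conjc (q n))) * W' n N w.
    by rewrite /mask_weight sn.
  have -> w : mask_argL s n w = w by rewrite /mask_argL sn.
  have -> w : mask_argR s n w = rc (lam n) * w + q n by rewrite /mask_argR sn.
  rewrite mul1r conjcM; ring.
have Es j : (j < n)%N -> s' j = s j by move=> jn; rewrite /s' ltn_eqF.
have -> : (fun p => mask_density n.+1 s' f g (cset z n (cpair p))) = (fun p => sliceL (lam n) (q n) F G (W n N) (cpair p)).
  apply/funext => p; rewrite mask_densityS /mask_density /sliceL /F /G; congr cre.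
  have -> : \prod_(j < n) mask_weight s' j (z j) = \prod_(j < n) mask_weight s j (z j).
    by apply: eq_bigr => j _; rewrite /mask_weight Es.
  have -> : mapn n (mask_argL s') z = mapn n (mask_argL s) z.
    by apply/funext => k; rewrite /mapn /mask_argL; case: ifP => // kn; rewrite Es.
  have -> : mapn n (mask_argR s') z = mapn n (mask_argR s) z.
    by apply/funext => k; rewrite /mapn /mask_argR; case: ifP => // kn; rewrite Es.
  have -> w : mask_weight s' n w = cexp (w * conjc (q n) - w * conjc w) * W n N w.
    by rewrite /mask_weight /s' eqxx.
  have -> w : mask_argL s' n w = rc (lam n) * w + q n by rewrite /mask_argL /s' eqxx.
  have -> w : mask_argR s' n w = w by rewrite /mask_argR /s' eqxx.
  rewrite mul1r; ring.
by move=> ->.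
Qed.

(* Flip the mask one coordinate at a time, by Fubini. *)
Lemma mask_density_mask n s f g : cseq_growth n f -> cseq_growth n g ->
  Rintegral (mu_ n) setT (fun t => mask_density n s f g (ccoord t)) =
  Rintegral (mu_ n) setT (fun t => mask_density n xpredT f g (ccoord t)).
Proof.
elim: n s f g => [|n IH] s f g cf cg.
  by apply: eq_Rintegral => t _; rewrite /mask_density !big_ord0.
(* [s1] only switches coordinate [n] on; the remaining ones are left to the induction hypothesis. *)
pose s1 j := if j == n then true else s j.
transitivity (Rintegral (mu_ n.+1) setT (fun t => mask_density n.+1 s1 f g (ccoord t))).
  rewrite (Rint_fubini2 (mask_density_integrable s cf cg)) (Rint_fubini2 (mask_density_integrable s1 cf cg)).
  by apply: eq_Rintegral => t _; exact: (@mask_density_coord n s f g (ccoord t) cf cg).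
rewrite (Rint_fubini (mask_density_integrable s1 cf cg)) (Rint_fubini (mask_density_integrable xpredT cf cg)).
apply: eq_Rintegral => p _ /=.
under eq_Rintegral do rewrite mask_densityS.
under [RHS]eq_Rintegral do rewrite mask_densityS.
have sn : s1 n = true by rewrite /s1 eqxx.
have -> : mask_weight s1 n (cpair p) = mask_weight xpredT n (cpair p) by rewrite /mask_weight sn.
have -> : mask_argL s1 n (cpair p) = mask_argL xpredT n (cpair p) by rewrite /mask_argL sn.
have -> : mask_argR s1 n (cpair p) = mask_argR xpredT n (cpair p) by rewrite /mask_argR sn.
exact: (IH s1 _ _ (cseq_growth_scale (mask_weight xpredT n (cpair p)) (cseq_growth_cset _ cf)) (cseq_growth_cset _ cg)).
Qed.

End Mask.
End Diagonal.

(** * Removal of the cutoffs *)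

Section DiagonalLimit.
Variable R : realType.
Local Notation C := (complex R).
Local Notation rc x := (Complex (x : R) 0).
Local Notation T_ n := (ms_T (cspace R n)).
Local Notation mu_ n := (ms_mu (cspace R n)).
Local Notation cvec := (cvec R).

Lemma cutoff_prod_bound n (V : nat -> nat -> C -> C) :
  (forall j, exists M : R, forall N z, cabs (V j N z) <= M) ->
  exists M : R, forall N (z : nat -> C), cabs (\prod_(j < n) V j N (z j)) <= M.
Proof.
move=> H; elim: n => [|n [M IH]]; first by exists 1 => N z; rewrite big_ord0 cabs1.
have [M' H'] := H n; exists (M * M') => N z; rewrite big_ord_recr /= cabsM.
by apply: ler_pM; rewrite ?cabs_ge0.
Qed.

Lemma cutoff_prod_lim n (V : nat -> nat -> C -> C) (z : nat -> C) :
  (forall j, exists M : R, forall N z, cabs (V j N z) <= M) ->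
  (forall j z (e : R), 0 < e -> exists N0, forall N, (N0 <= N)%N -> cabs (V j N z - 1) <= e) ->
  forall e : R, 0 < e -> exists N0, forall N, (N0 <= N)%N -> cabs (\prod_(j < n) V j N (z j) - 1) <= e.
Proof.
move=> HM HL; elim: n => [|n IH] e e0.
  by exists 0%N => N _; rewrite big_ord0 subrr cabs0 ltW.
have [M HM'] := cutoff_prod_bound n HM.
have M0 : 0 <= M by apply: le_trans (HM' 0%N (fun=> 0)); exact: cabs_ge0.
have e2 : 0 < e / 2 by rewrite divr_gt0.
have M1 : 0 < M + 1 by rewrite ltr_wpDl.
have [N1 H1] := IH _ e2; have [N2 H2] := HL n (z n) (e / 2 / (M + 1)) (divr_gt0 e2 M1).
exists (maxn N1 N2) => N; rewrite geq_max => /andP[/H1 h1 /H2 h2].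
rewrite big_ord_recr /=; set P := \prod_(j < n) _ in h1 *; set v := V n N (z n) in h2 *.
have -> : P * v - 1 = P * (v - 1) + (P - 1) by ring.
apply: (le_trans (ler_cabsD _ _)); rewrite cabsM.
have : cabs P * cabs (v - 1) <= (M + 1) * (e / 2 / (M + 1)).
  apply: ler_pM; rewrite ?cabs_ge0//; apply: (le_trans (HM' N z)); by rewrite lerDl.
rewrite [X in _ <= X -> _]mulrC divfK ?gt_eqF// => h; lra.
Qed.

Section Limit.
Variables (n : nat) (lam : nat -> R) (q : nat -> C) (W W' : nat -> nat -> C -> C).
Hypothesis hcut : forall j, coord_cut (lam j) (q j) (W j) (W' j).
Variables (f g : (nat -> C) -> C).
Hypotheses (cf : cseq_growth n f) (cg : cseq_growth n g).

Let one : nat -> nat -> C -> C := fun _ _ _ => 1.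

(** The mask density, before taking real parts, with all cutoffs replaced by 1: the mask [xpredT]
    gives the density of <Cf, g>, and [xpred0] that of <f, Cg>. *)
Definition uncut_density (s : nat -> bool) (z : nat -> C) : C :=
  (\prod_(j < n) mask_weight q one one 0 s j (z j)) * f (mapn n (mask_argL lam q s) z) *
  conjc (g (mapn n (mask_argR lam q s) z)).

Let V (s : nat -> bool) j N z := if s j then W j N z else W' j N z.

Let mask_densityE N s z : mask_density lam q W W' N n s f g z = cre ((\prod_(j < n) V s j N (z j)) * uncut_density s z).
Proof.
rewrite /mask_density /uncut_density; congr cre.
have -> : \prod_(j < n) mask_weight q W W' N s j (z j) =
   (\prod_(j < n) V s j N (z j)) * \prod_(j < n) mask_weight q one one 0 s j (z j).
  rewrite -big_split /=; apply: eq_bigr => j _; rewrite /mask_weight /V /one.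
  by case: (s j); ring.
ring.
Qed.

(** Products of cutoffs are bounded uniformly in [N] and tend to 1 pointwise, so a multiple of the
    modulus of [uncut_density] dominates. *)
Lemma mask_density_limit s : (mu_ n).-integrable setT (fun t => (cabs (uncut_density s (ccoord t)))%:E) ->
  Rintegral (mu_ n) setT (fun t => mask_density lam q W W' N n s f g (ccoord t)) @[N --> \oo] -->
  Rintegral (mu_ n) setT (fun t => cre (uncut_density s (ccoord t))).
Proof.
move=> iY; have [gf _ _] := cf; have [gg _ _] := cg.
have mD N : measurable_fun setT (fun t : T_ n => mask_density lam q W W' N n s f g (ccoord t)).
  by apply: (mask_density_meas hcut N n s gf gg) => k; exact: cmeas_ccoord.
have VM j : exists M : R, forall N z, cabs (V s j N z) <= M.
  by have [[_ _ ? _] [_ _ ? _] _] := hcut j; rewrite /V; case: (s j).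
have VL j z (e : R) : 0 < e -> exists N0, forall N, (N0 <= N)%N -> cabs (V s j N z - 1) <= e.
  by have [[_ _ _ H] [_ _ _ H'] _] := hcut j; rewrite /V; case: (s j); [exact: H|exact: H'].
have [M HM] := cutoff_prod_bound n VM.
have lim t : mask_density lam q W W' N n s f g (ccoord t) @[N --> \oo] --> cre (uncut_density s (ccoord t)).
  apply/cvgrPdist_le => e e0; set Y := uncut_density s (ccoord t).
  have Y1 : 0 < cabs Y + 1 by rewrite ltr_pwDr ?cabs_ge0.
  have [N0 H0] := cutoff_prod_lim n (ccoord t) VM VL (divr_gt0 e0 Y1).
  exists N0 => // N /= NN; rewrite mask_densityE -/Y distrC -creB.
  apply: (le_trans (ler_cre _)).
  have -> : forall P : C, P * Y - Y = (P - 1) * Y by move=> P; ring.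
  rewrite cabsM; apply: (@le_trans _ _ (e / (cabs Y + 1) * (cabs Y + 1))).
    by apply: ler_pM; rewrite ?cabs_ge0 ?H0// lerDl.
  by rewrite divfK// gt_eqF.
have mY : measurable_fun setT (fun t : T_ n => cre (uncut_density s (ccoord t))).
  by apply: (measurable_fun_cvg mD) => t _; exact: lim.
have [] := @dominated_convergence _ _ _ (mu_ n) setT measurableT
  (fun N t => (mask_density lam q W W' N n s f g (ccoord t))%:E) (fun t => (cre (uncut_density s (ccoord t)))%:E)
  (fun t => (M%:E * (cabs (uncut_density s (ccoord t)))%:E)%E).
- by move=> N; exact/measurable_EFinP.
- exact/measurable_EFinP.
- by apply: aeW => t _; apply/cvg_EFin; [exact: nearW|exact: lim].
- exact: integrableZl.
- apply: aeW => t N _; rewrite abse_EFin -EFinM lee_fin mask_densityE.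
  apply: (le_trans (ler_cre _)); rewrite cabsM ler_wpM2r ?cabs_ge0//.
move=> iL _ H; apply: fine_cvg; rewrite fineK; last exact: integrable_fin_num.
exact: H.
Qed.

End Limit.

(** Integrability is asked of the two pure densities alone; mixed masks occur only under cutoffs, at
    fixed [N], where flipping the mask makes the two sequences equal. *)
Lemma diag_sym n (lam : nat -> R) (q : nat -> C) (f g : (nat -> C) -> C) :
  (forall j, lam j = 1 -> exists2 c, 0 <= c & q j = rc c) -> cseq_growth n f -> cseq_growth n g ->
  (mu_ n).-integrable setT (fun t => (cabs (uncut_density n lam q f g xpredT (ccoord t)))%:E) ->
  (mu_ n).-integrable setT (fun t => (cabs (uncut_density n lam q f g xpred0 (ccoord t)))%:E) ->
  Rintegral (mu_ n) setT (fun t => cre (uncut_density n lam q f g xpredT (ccoord t))) =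
  Rintegral (mu_ n) setT (fun t => cre (uncut_density n lam q f g xpred0 (ccoord t))).
Proof.
move=> hq cf cg iA iB.
have /choice[WW HWW] : forall j, exists WW : (nat -> C -> C) * (nat -> C -> C), coord_cut (lam j) (q j) WW.1 WW.2.
  move=> j; have [l1|l1] := eqVneq (lam j) 1.
    have [c c0 ->] := hq j l1; have [W [W' H]] := line_cut c0; rewrite l1; by exists (W, W').
  by have [W [W' H]] := circle_cut (q j) l1; exists (W, W').
have LA := mask_density_limit HWW cf cg iA; have LB := mask_density_limit HWW cf cg iB.
apply: (@cvg_unique _ (@Rhausdorff R) _ _ _ _ LA).
suff <- : (fun N => Rintegral (mu_ n) setT (fun t => mask_density lam q (fun x => (WW x).1) (fun x => (WW x).2) N n xpred0 f g (ccoord t))) =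
   (fun N => Rintegral (mu_ n) setT (fun t => mask_density lam q (fun x => (WW x).1) (fun x => (WW x).2) N n xpredT f g (ccoord t))) by exact: LB.
by apply/funext => N; exact: (mask_density_mask HWW).
Qed.

End DiagonalLimit.

(** * Unitary diagonalisation of a Hermitian matrix *)

Section LinAlg.
Variable R : realType.
Local Notation C := (complex R).
Local Notation rc x := (Complex (x : R) 0).
Local Notation cvec := (cvec R).

Lemma adjmxM d (A B : 'M[C]_d) : adjmx (A *m B) = adjmx B *m adjmx A.
Proof. by rewrite /adjmx map_mxM trmx_mul. Qed.

Lemma adjmxK d (A : 'M[C]_d) : adjmx (adjmx A) = A.
Proof. by apply/matrixP => i j; rewrite !mxE conjcK. Qed.

Lemma adjmxE d (A : 'M[C]_d) : adjmx A = (A ^t Num.conj)%sesqui.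
Proof. by apply/matrixP => i j; rewrite !mxE. Qed.

Lemma cdotMl d (A : 'M[C]_d) (x y : cvec d) : cdot (A *m x) y = cdot x (adjmx A *m y).
Proof.
rewrite /cdot; under eq_bigr do rewrite mxE mulr_suml.
rewrite exchange_big /=; apply: eq_bigr => j _.
rewrite !mxE (rmorph_sum (@conjc R)) mulr_sumr; apply: eq_bigr => i _.
by rewrite /= conjcM !mxE conjcK mulrCA !mulrA.
Qed.

Lemma cdotzz d (z : cvec d) : cdot z z = rc (cnorm2 z).
Proof.
rewrite /cdot cnorm2E; under eq_bigr do rewrite mulcJ.
by apply: cre_cim_inj; rewrite ?cre_sum ?cim_sum //= big1.
Qed.

Lemma cnorm2_unitary d (U : 'M[C]_d) (z : cvec d) : adjmx U *m U = 1%:M -> cnorm2 (U *m z) = cnorm2 z.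
Proof.
move=> UU; have : cdot (U *m z) (U *m z) = cdot z z by rewrite cdotMl mulmxA UU mul1mx.
by rewrite !cdotzz => -[].
Qed.

(** The spectral theorem leaves a diagonal unitary factor free, since it commutes with the diagonal
    matrix; it is spent on rotating each coordinate of [P *m v] onto the nonnegative half-line, the
    form of translation that the strip argument accepts. *)
Lemma hermitian_diag d (Q : 'M[C]_d) (v : cvec d) : Q = adjmx Q ->
  exists (P : 'M[C]_d) (lam : 'I_d -> R), [/\ P *m adjmx P = 1%:M, adjmx P *m P = 1%:M,
    Q = adjmx P *m diag_mx (\row_j rc (lam j)) *m P &
    forall j, exists2 c : R, 0 <= c & (P *m v) j 0 = rc c].
Proof.
move=> hQ; have Qh : Q \is hermsymmx.
  by apply/is_hermitianmxP; rewrite expr0 scale1r {1}hQ adjmxE.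
pose P0 : 'M[C]_d := spectralmx Q.
have P0u : P0 *m adjmx P0 = 1%:M.
  by rewrite adjmxE; apply/unitarymxP; exact: spectral_unitarymx.
have P0u' : adjmx P0 *m P0 = 1%:M by exact: mulmx1C.
have Q0 : Q = adjmx P0 *m diag_mx (spectral_diag Q) *m P0.
  have := orthomx_spectralP (hermitian_normalmx Qh).
  by rewrite (invmx_unitary (spectral_unitarymx Q)) -adjmxE.
have sr : spectral_diag Q = \row_j rc (cre (spectral_diag Q 0 j)).
  apply/rowP => j; rewrite !mxE; have /mxOverP/(_ 0 j) := hermitian_spectral_diag_real Qh.
  by case: (spectral_diag Q 0 j) => a b; rewrite complex_real => /eqP ->.
pose w := P0 *m v.
(* The phase that sends w_j to |w_j|, and 1 when w_j = 0. *)
pose u j : C := if w j 0 == 0 then 1 else conjc (w j 0) / rc (cabs (w j 0)).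
have rc0 (x : R) : x != 0 -> rc x != 0 by move=> x0; rewrite eq_complex /= (negbTE x0).
have cab0 (z : C) : z != 0 -> cabs z != 0.
  by apply: contra_neq => /cabs_eq0.
have uu j : u j * conjc (u j) = 1.
  rewrite /u; case: eqVneq => [_|w0]; first by rewrite conjc1 mulr1.
  rewrite conjcM conjcK conjc_inv.
  have -> : conjc (rc (cabs (w j 0))) = rc (cabs (w j 0)) by apply: cre_cim_inj; rewrite !cE ?oppr0.
  rewrite mulrACA -invfM [conjc _ * _]mulrC mulcJ.
  have -> : rc (cabs (w j 0)) * rc (cabs (w j 0)) = rc (cabs (w j 0) ^+ 2).
    by apply: cre_cim_inj; rewrite !cE; ring.
  by rewrite divff// rc0// expf_neq0// cab0.
pose Dg := diag_mx (\row_j u j).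
have aD : adjmx Dg = diag_mx (\row_j conjc (u j)).
  by apply/matrixP => i j; rewrite !mxE [j == i]eq_sym; case: eqVneq => [->|_]; rewrite ?mulr1n// !mulr0n conjc0.
have DD : Dg *m adjmx Dg = 1%:M.
  rewrite aD mulmx_diag; apply/matrixP => i j; rewrite !mxE uu.
  by [].
exists (Dg *m P0), (fun j => cre (spectral_diag Q 0 j)); split.
- by rewrite adjmxM mulmxA -(mulmxA Dg) P0u mulmx1.
- by rewrite adjmxM mulmxA -(mulmxA _ _ Dg) (mulmx1C DD) mulmx1.
- rewrite -sr adjmxM -!mulmxA (mulmxA (diag_mx _) Dg) [diag_mx _ *m Dg]diag_mxC.
  rewrite !mulmxA -(mulmxA _ _ Dg) (mulmx1C DD) mulmx1; exact: Q0.
move=> j; exists (cabs (w j 0)); first exact: cabs_ge0.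
have E (x : cvec d) : (Dg *m x) j 0 = u j * x j 0 by rewrite mul_diag_mx !mxE.
rewrite -mulmxA -/w E /u.
case: eqVneq => [->|w0]; first by rewrite cabs0 mulr0.
rewrite mulrAC [conjc _ * _]mulrC mulcJ.
have -> : rc (cabs (w j 0) ^+ 2) = rc (cabs (w j 0)) * rc (cabs (w j 0)).
  by apply: cre_cim_inj; rewrite !cE; ring.
by rewrite mulfK// rc0// cab0.
Qed.

End LinAlg.

(** * From diagonal to Hermitian matrices *)

Section Hermitian.
Variable R : realType.
Local Notation C := (complex R).
Local Notation rc x := (Complex (x : R) 0).
Local Notation T_ n := (ms_T (cspace R n)).
Local Notation mu_ n := (ms_mu (cspace R n)).
Local Notation cvec := (cvec R).

(** Holomorphy along complex lines is stable under linear substitutions and yields analyticity in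
    each coordinate. *)
Definition line_entire d (f : cvec d -> C) := mvec f /\ forall a b, entire1 (fun w => f (a + w *: b)).
Definition vgrowth d (f : cvec d -> C) := line_entire f /\ exists K : R, forall z, cabs (f z) <= K * expR (cnorm2 z / 2).

(* The densities of <Cf, g> and <f, Cg> for Cf(z) = exp(<z,q>) f(Qz + q). *)
Definition pairL d (Q : 'M[C]_d) q (f g : cvec d -> C) z : C :=
  cexp (cdot z q) * f (Q *m z + q) * conjc (g z) * rc (expR (- cnorm2 z)).
Definition pairR d (Q : 'M[C]_d) q (f g : cvec d -> C) z : C :=
  f z * conjc (cexp (cdot z q) * g (Q *m z + q)) * rc (expR (- cnorm2 z)).

Lemma cexp_sum n (F : nat -> C) : \prod_(j < n) cexp (F j) = cexp (\sum_(j < n) F j).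
Proof.
by elim: n => [|n IH]; rewrite ?big_ord0 ?cexp0// !big_ord_recr /= IH cexpD.
Qed.

Lemma vgrowth_cseq_growth d (f : cvec d -> C) : vgrowth f -> cseq_growth d (fun z => f (\col_j z j)).
Proof.
move=> [[mf ef] [K HK]]; split.
- by move=> dd T Z mZ; apply: mf => j; under eq_fun do rewrite mxE.
- move=> j z.
  have -> : (fun w => f (\col_i cset z j w i)) =
     (fun w => f (\col_i cset z j 0 i + w *: \col_i cset (fun=> 0) j 1 i)).
    apply/funext => w; congr f; apply/matrixP => i k; rewrite !mxE /cset.
    by case: eqP => _; rewrite ?add0r ?mulr1 ?mulr0 ?addr0.
  exact: ef.
- exists K => z; apply: (le_trans (HK _)); rewrite cnorm2E.
  by under eq_bigr do rewrite mxE.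
Qed.

Lemma diag_symv d (lam : 'I_d -> R) (q : cvec d) (f g : cvec d -> C) :
  (forall j, exists2 c, 0 <= c & q j 0 = rc c) -> vgrowth f -> vgrowth g ->
  let L := diag_mx (\row_j rc (lam j)) in
  (mu_ d).-integrable setT (fun t => (cabs (pairL L q f g (cpoint t)))%:E) ->
  (mu_ d).-integrable setT (fun t => (cabs (pairR L q f g (cpoint t)))%:E) ->
  Rintegral (mu_ d) setT (fun t => cre (pairL L q f g (cpoint t))) =
  Rintegral (mu_ d) setT (fun t => cre (pairR L q f g (cpoint t))).
Proof.
move=> hq vf vg L iA iB.
(* Extension by 0 beyond [d]: the eigenvalue there is not 1, so the condition on [q'] is vacuous. *)
pose lam' k := if insub k is Some j then lam (j : 'I_d) else 0.
pose q' k : C := if insub k is Some j then q (j : 'I_d) 0 else 0.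
have lamE (j : 'I_d) : lam' j = lam j by rewrite /lam' valK.
have qE (j : 'I_d) : q' j = q j 0 by rewrite /q' valK.
pose f' (z : nat -> C) := f (\col_j z j); pose g' (z : nat -> C) := g (\col_j z j).
have evE (t : T_ d) : (\col_j ccoord t j) = cpoint t by [].
have mE (t : T_ d) (a : nat -> C -> C) : (forall w (j : 'I_d), a j w = rc (lam j) * w + q j 0) ->
    \col_j mapn d a (ccoord t) j = L *m cpoint t + q.
  move=> Ha; apply/matrixP => i k; rewrite mul_diag_mx !mxE /mapn ltn_ord Ha.
  by rewrite ord1.
have mI (t : T_ d) (a : nat -> C -> C) : (forall w (j : 'I_d), a j w = w) -> \col_j mapn d a (ccoord t) j = cpoint t.
  by move=> Ha; apply/matrixP => i k; rewrite !mxE /mapn ltn_ord Ha.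
have e1 (t : T_ d) : \sum_(j < d) (ccoord t j * conjc (ccoord t j)) = rc (cnorm2 (cpoint t)).
  by rewrite -cdotzz; apply: eq_bigr => j _; rewrite !mxE.
have e2 (t : T_ d) : \sum_(j < d) (ccoord t j * conjc (q' j)) = cdot (cpoint t) q.
  by apply: eq_bigr => j _; rewrite !mxE qE.
have e3 (t : T_ d) : rc (expR (- cnorm2 (cpoint t))) = cexp (- rc (cnorm2 (cpoint t))).
  by rewrite -cexp_real; congr cexp; apply: cre_cim_inj; rewrite !cE ?oppr0.
have EA t : uncut_density d lam' q' f' g' xpredT (ccoord t) = pairL L q f g (cpoint t).
  rewrite /uncut_density /pairL /f' /g' mE ?mI//; last by move=> w j; rewrite /mask_argL lamE qE.
  have -> : \prod_(j < d) mask_weight q' (fun _ _ _ => 1) (fun _ _ _ => 1) 0 xpredT j (ccoord t j) =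
     cexp (cdot (cpoint t) q) * rc (expR (- cnorm2 (cpoint t))).
    rewrite e3 -cexpD -e1 -e2 -sumrB -(cexp_sum d (fun j => ccoord t j * conjc (q' j) - ccoord t j * conjc (ccoord t j))).
    by apply: eq_bigr => j _; rewrite /mask_weight mulr1.
  ring.
have EB t : uncut_density d lam' q' f' g' xpred0 (ccoord t) = pairR L q f g (cpoint t).
  rewrite /uncut_density /pairR /f' /g' (mI t (mask_argL _ _ _))// mE; last by move=> w j; rewrite /mask_argR lamE qE.
  have -> : \prod_(j < d) mask_weight q' (fun _ _ _ => 1) (fun _ _ _ => 1) 0 xpred0 j (ccoord t j) =
     conjc (cexp (cdot (cpoint t) q)) * rc (expR (- cnorm2 (cpoint t))).
    rewrite e3 -cexpJ -cexpD -e1 -e2 (rmorph_sum (@conjc R)) -sumrB.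
    rewrite -(cexp_sum d (fun j => conjc (ccoord t j * conjc (q' j)) - ccoord t j * conjc (ccoord t j))).
    by apply: eq_bigr => j _; rewrite /mask_weight mulr1 cexpD cexpJ mulrC.
  rewrite conjcM; ring.
transitivity (Rintegral (mu_ d) setT (fun t => cre (uncut_density d lam' q' f' g' xpredT (ccoord t)))).
  by apply: eq_Rintegral => t _; rewrite EA.
transitivity (Rintegral (mu_ d) setT (fun t => cre (uncut_density d lam' q' f' g' xpred0 (ccoord t)))); last first.
  by apply: eq_Rintegral => t _; rewrite EB.
apply: diag_sym; [|exact: vgrowth_cseq_growth|exact: vgrowth_cseq_growth|..].
- move=> j; rewrite /lam' /q'; case: insubP => [i _ _ _|_ /eqP]; first exact: hq.
  by rewrite eq_sym oner_eq0.
- by move: iA; congr (integrable _ _ _); apply/funext => t; rewrite EA.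
- by move: iB; congr (integrable _ _ _); apply/funext => t; rewrite EB.
Qed.

Lemma preserves_shift_cspace d (a : cvec d) : preserves (mu_ d) (@cpoint R d) (fun z => z + a).
Proof. by move=> F mF F0; exact: shift_cspace. Qed.

Lemma mmapM d (A : 'M[C]_d) : mmap (fun z : cvec d => A *m z).
Proof.
move=> dd T Z mZ j; under eq_fun do rewrite mxE.
by apply: cmeas_sum => i; apply: cmeasM; [exact: cmeas_cst|].
Qed.

Lemma mmapD d (W : cvec d -> cvec d) a : mmap W -> mmap (fun z : cvec d => W z + a).
Proof.
move=> mW dd T Z mZ j; under eq_fun do rewrite mxE.
by apply: cmeasD; [exact: mW|exact: cmeas_cst].
Qed.

Lemma preserves_unitary d (U : 'M[C]_d) : U *m adjmx U = 1%:M ->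
  preserves (mu_ d) (@cpoint R d) (fun z => U *m z).
Proof.
move=> UU.
have gs : exists2 g : R, 0 < g & (\int[mu_ d]_t (expR (- cnorm2 (cpoint t)))%:E = g%:E)%E.
  by exists (pi ^+ d); rewrite ?exprn_gt0 ?pi_gt0// int_gauss_pi.
apply: (haar_preserves (@cmeasv_cpoint R d) (@preserves_shift_cspace d) gs (V := fun z => adjmx U *m z)).
- by move=> x y; rewrite mulmxDr.
- by move=> x; rewrite mulmxA UU mul1mx.
- by move=> x; apply: cnorm2_unitary; exact: mulmx1C.
- exact: mmapM.
Qed.

Lemma mvec_cdot d (q : cvec d) : mvec (fun z => cdot z q).
Proof.
move=> dd T Z mZ; apply: (@cmeas_sum R _ T d (fun j t => Z t j 0 * conjc (q j 0))) => j.
by apply: cmeasM => //; exact: cmeas_cst.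
Qed.

Lemma mvec_weight d : mvec (fun z : cvec d => rc (expR (- cnorm2 z))).
Proof.
move=> dd T Z mZ; apply: cmeas_real; apply: measurableT_comp => //.
by apply: measurableT_comp => //; exact: mvecR_cnorm2.
Qed.

Lemma mvec_pairL d (Q : 'M[C]_d) q f g : mvec f -> mvec g -> mvec (pairL Q q f g).
Proof.
move=> mf mg dd T Z mZ; rewrite /pairL; apply: cmeasM; last exact: mvec_weight.
apply: cmeasM; last by apply: cmeasJ; exact: mg.
apply: cmeasM; first by apply: cmeas_exp; exact: mvec_cdot.
by apply: mf; apply: mmapD => //; exact: mmapM.
Qed.

Lemma mvec_pairR d (Q : 'M[C]_d) q f g : mvec f -> mvec g -> mvec (pairR Q q f g).
Proof.
move=> mf mg dd T Z mZ; rewrite /pairR; apply: cmeasM; last exact: mvec_weight.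
apply: cmeasM; first exact: mf.
apply: cmeasJ; apply: cmeasM; first by apply: cmeas_exp; exact: mvec_cdot.
by apply: mg; apply: mmapD => //; exact: mmapM.
Qed.

Lemma mvecR_cabs d (f : cvec d -> C) : mvec f -> mvecR (fun z => cabs (f z)).
Proof. by move=> mf dd T Z mZ; apply: measurable_cabs; exact: mf. Qed.
Lemma mvecR_cre d (f : cvec d -> C) : mvec f -> mvecR (fun z => cre (f z)).
Proof. by move=> mf dd T Z /mf []. Qed.

Lemma vgrowth_unitary d (U : 'M[C]_d) f : adjmx U *m U = 1%:M -> vgrowth f -> vgrowth (fun z : cvec d => f (U *m z)).
Proof.
move=> UU [[mf ef] [K HK]]; split; first split.
- by move=> dd T Z mZ; apply: mf; exact: mmapM.
- by move=> a b; under eq_fun do rewrite mulmxDr -scalemxAr; exact: ef.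
- by exists K => z; rewrite -(cnorm2_unitary z UU).
Qed.

Lemma herm_sym d (Q : 'M[C]_d) (q : cvec d) (f g : cvec d -> C) :
  Q = adjmx Q -> vgrowth f -> vgrowth g ->
  (mu_ d).-integrable setT (fun t => (cabs (pairL Q q f g (cpoint t)))%:E) ->
  (mu_ d).-integrable setT (fun t => (cabs (pairR Q q f g (cpoint t)))%:E) ->
  Rintegral (mu_ d) setT (fun t => cre (pairL Q q f g (cpoint t))) =
  Rintegral (mu_ d) setT (fun t => cre (pairR Q q f g (cpoint t))).
Proof.
move=> hQ vf vg iA iB.
have [P [lam [PP PP' QE hq]]] := hermitian_diag q hQ.
have mf : mvec f by have [[]] := vf.
have mg : mvec g by have [[]] := vg.
have AP : adjmx P *m adjmx (adjmx P) = 1%:M by rewrite adjmxK.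
have pres := preserves_unitary AP.
pose f' z := f (adjmx P *m z); pose g' z := g (adjmx P *m z).
set L := diag_mx (\row_j rc (lam j)) in QE *.
have cE1 z : cdot (adjmx P *m z) q = cdot z (P *m q) by rewrite cdotMl adjmxK.
have aE z : Q *m (adjmx P *m z) + q = adjmx P *m (L *m z + P *m q).
  rewrite mulmxDr {1}QE !mulmxA PP' mul1mx -[_ *m P *m adjmx P]mulmxA PP mulmx1.
  by [].
have nE z : cnorm2 (adjmx P *m z) = cnorm2 z by apply: cnorm2_unitary; rewrite adjmxK.
have EA z : pairL Q q f g (adjmx P *m z) = pairL L (P *m q) f' g' z.
  by rewrite /pairL cE1 aE nE.
have EB z : pairR Q q f g (adjmx P *m z) = pairR L (P *m q) f' g' z.
  by rewrite /pairR cE1 aE nE.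
have mA := mvec_pairL Q q mf mg; have mB := mvec_pairR Q q mf mg.
rewrite -(preserves_Rint pres (mvecR_cre mA)) -(preserves_Rint pres (mvecR_cre mB)).
have iA' := preserves_integrable (@cmeasv_cpoint R d) pres (@mmapM d _) (mvecR_cabs mA) iA.
have iB' := preserves_integrable (@cmeasv_cpoint R d) pres (@mmapM d _) (mvecR_cabs mB) iB.
under eq_Rintegral do rewrite EA.
under [RHS]eq_Rintegral do rewrite EB.
have AP' : adjmx (adjmx P) *m adjmx P = 1%:M by rewrite adjmxK.
apply: diag_symv => //.
- exact: vgrowth_unitary.
- exact: vgrowth_unitary.
- by move: iA'; congr (integrable _ _ _); apply/funext => t /=; rewrite EA.
- by move: iB'; congr (integrable _ _ _); apply/funext => t /=; rewrite EB.
Qed.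

End Hermitian.

(** * The Fock space *)

Section WeightedSquares.
Variable R : realType.
Local Notation C := (complex R).
Local Notation rc x := (Complex (x : R) 0).
Local Notation mu_ n := (ms_mu (cspace R n)).
Local Notation cvec := (cvec R).

Lemma cnorm_ge0 d (z : cvec d) : 0 <= cnorm z. Proof. exact: sqrtr_ge0. Qed.

Lemma cabs_le_cnorm d (z : cvec d) j : cabs (z j 0) <= cnorm z.
Proof.
rewrite /cabs /cnorm ler_sqrt ?cnorm2_ge0// /cnorm2 (bigD1 j)//= lerDl.
by apply: sumr_ge0 => i _; rewrite addr_ge0 ?sqr_ge0.
Qed.

Lemma cabs_sum d (F : 'I_d -> C) : cabs (\sum_j F j) <= \sum_j cabs (F j).
Proof.
elim/big_ind2: _ => // [|x1 x2 y1 y2 h1 h2]; first by rewrite cabs0.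
by apply: (le_trans (ler_cabsD _ _)); exact: lerD.
Qed.

Lemma cabs_lin_le d (a h : cvec d) : cabs (\sum_(j < d) a j 0 * h j 0) <= (\sum_j cabs (a j 0)) * cnorm h.
Proof.
apply: (le_trans (cabs_sum _)); rewrite mulr_suml; apply: ler_sum => j _.
by rewrite cabsM ler_wpM2l ?cabs_ge0// cabs_le_cnorm.
Qed.

Lemma cnormZ d (w : C) (z : cvec d) : cnorm (w *: z) = cabs w * cnorm z.
Proof. by rewrite /cnorm cnorm2Z sqrtrM ?sqr_ge0// sqrtr_sqr ger0_norm ?cabs_ge0. Qed.

Lemma cnorm_le_sum d (z : cvec d) : cnorm z <= \sum_j cabs (z j 0).
Proof.
rewrite -(@ler_pXn2r _ 2) ?nnegrE ?cnorm_ge0 ?sumr_ge0// => [|j _]; last exact: cabs_ge0.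
rewrite sqr_sqrtr ?cnorm2_ge0// cnorm2E expr2 mulr_suml; apply: ler_sum => j _.
rewrite expr2 ler_wpM2l ?cabs_ge0// (bigD1 j)//= lerDl.
by apply: sumr_ge0 => i _; exact: cabs_ge0.
Qed.

Lemma entire_cont d (f : cfun R d) z : entire f -> forall e : R, 0 < e ->
  exists dl : R, 0 < dl /\ forall h, cnorm h < dl -> cabs (f (z + h) - f z) <= e.
Proof.
move=> /(_ z) [a Ha] e e0; have [d1 [d10 H]] := Ha _ ltr01.
set S := 1 + \sum_j cabs (a j 0).
have S0 : 0 < S by rewrite ltr_pwDl// sumr_ge0// => j _; exact: cabs_ge0.
exists (Num.min d1 (e / S)); split; first by rewrite lt_min d10 divr_gt0.
move=> h; rewrite lt_min => /andP[/H h1 h2].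
have -> : f (z + h) - f z = (f (z + h) - f z - \sum_(j < d) a j 0 * h j 0) + \sum_(j < d) a j 0 * h j 0 by ring.
apply: (le_trans (ler_cabsD _ _)); apply: (le_trans (lerD h1 (cabs_lin_le a h))).
by rewrite -mulrDl mulrC -ler_pdivlMr// ltW.
Qed.

Lemma entire_mvec d (f : cfun R d) : entire f -> mvec f.
Proof.
move=> ef dd T Z mZ.
have H (G : C -> R) : (forall z w, `|G z - G w| <= cabs (z - w)) ->
    measurable_fun setT (fun t => G (f (Z t))).
  move=> GL.
  pose c (i : 'I_d * bool) t : R := if i.2 then cre (Z t i.1 0) else cim (Z t i.1 0).
  pose vv (v : 'I_d * bool -> R) : cvec d := \col_j Complex (v (j, true)) (v (j, false)).
  have -> : (fun t => G (f (Z t))) = (fun t => G (f (vv (c^~ t)))).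
    apply/funext => t; congr (G (f _)); apply/matrixP => i k.
    by rewrite ord1 mxE /c /= cK.
  apply: (@measurable_fun_continuous_coords R _ _ T c (fun v => G (f (vv v)))).
    by move=> [j []]; rewrite /c /=; have [] := mZ j.
  move=> v e e0; have [dl [dl0 Hd]] := entire_cont (vv v) ef e0.
  (* The norm is at most the sum of the moduli of 2 d real coordinates; the 1 makes the estimate
     strict and the radius positive for d = 0. *)
  exists (dl / (2 * d%:R + 1)).
  have d1 : (0 : R) < 2 * d%:R + 1 by rewrite ltr_wpDl// mulr_ge0.
  split; first by rewrite divr_gt0.
  move=> w wv; apply: (le_trans (GL _ _)).
  have := Hd (vv w - vv v); rewrite addrCA subrr addr0; apply.
  apply: (le_lt_trans (cnorm_le_sum _)).
  apply: (@le_lt_trans _ _ (\sum_(j < d) (2 * (dl / (2 * d%:R + 1))))).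
    apply: ler_sum => j _; apply: (le_trans (cabs_ler _)); rewrite !mxE !cE.
    by have := wv (j, true); have := wv (j, false); lra.
  have -> : \sum_(j < d) (2 * (dl / (2 * d%:R + 1))) = dl * (2 * d%:R / (2 * d%:R + 1)).
    by rewrite sumr_const card_ord -[LHS]mulr_natr; field; rewrite gt_eqF.
  by rewrite gtr_pMr// ltr_pdivrMr// mul1r ltrDl.
split; apply: H => z w; first by rewrite -creB ler_cre.
by rewrite -cimB ler_cim.
Qed.

Lemma entire_line d (f : cfun R d) a b : entire f -> entire1 (fun w => f (a + w *: b)).
Proof.
move=> ef w; have [al Hal] := ef (a + w *: b).
exists (\sum_(j < d) al j 0 * b j 0) => e e0.
have b1 : 0 < cnorm b + 1 by rewrite ltr_wpDl// cnorm_ge0.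
have [dl [dl0 H]] := Hal _ (divr_gt0 e0 b1).
exists (dl / (cnorm b + 1)); split; first by rewrite divr_gt0.
move=> h hd; have := H (h *: b).
have hb : cnorm (h *: b) <= cabs h * (cnorm b + 1).
  by rewrite cnormZ ler_wpM2l ?cabs_ge0// lerDl.
move: hd; rewrite ltr_pdivlMr// => hd /(_ (le_lt_trans hb hd)).
have -> : a + w *: b + h *: b = a + (w + h) *: b by rewrite scalerDl addrA.
have -> : \sum_(j < d) al j 0 * (h *: b) j 0 = (\sum_(j < d) al j 0 * b j 0) * h.
  by rewrite mulr_suml; apply: eq_bigr => j _; rewrite mxE; ring.
move=> H2; apply: (le_trans H2).
apply: (@le_trans _ _ (e / (cnorm b + 1) * (cabs h * (cnorm b + 1)))).
  by rewrite ler_wpM2l// divr_ge0// ltW.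
by rewrite [cabs h * _]mulrC mulrA divfK// gt_eqF.
Qed.

Lemma entire_line_entire d (f : cfun R d) : entire f -> line_entire f.
Proof. by move=> ef; split; [exact: entire_mvec|move=> a b; exact: entire_line]. Qed.

Lemma entire_scale d (f : cfun R d) c : entire f -> entire (fun z => c * f z).
Proof.
move=> ef z; have [a Ha] := ef z; exists (c *: a) => e e0.
have c1 : 0 < cabs c + 1 by rewrite ltr_wpDl// cabs_ge0.
have [dl [dl0 H]] := Ha _ (divr_gt0 e0 c1); exists dl; split=> // h /H {}H.
have -> : \sum_(j < d) (c *: a) j 0 * h j 0 = c * \sum_(j < d) a j 0 * h j 0.
  by rewrite mulr_sumr; apply: eq_bigr => j _; rewrite mxE mulrA.
rewrite -!mulrBr cabsM.
apply: (@le_trans _ _ ((cabs c + 1) * (e / (cabs c + 1) * cnorm h))).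
  by apply: ler_pM; rewrite ?cabs_ge0// lerDl.
by rewrite mulrA [(cabs c + 1) * _]mulrC divfK// gt_eqF.
Qed.

Definition weighted_sq d (f : cvec d -> C) (z : cvec d) : R := cabs (f z) ^+ 2 * expR (- cnorm2 z).

Lemma mvecR_weighted_sq d (f : cvec d -> C) : mvec f -> mvecR (weighted_sq f).
Proof.
move=> mf dd T Z mZ; apply: measurable_funM.
  by apply: measurable_funX; apply: measurable_cabs; exact: mf.
by apply: measurableT_comp => //; apply: measurableT_comp => //; exact: mvecR_cnorm2.
Qed.

Lemma weighted_sq_ge0 d (f : cvec d -> C) z : 0 <= weighted_sq f z.
Proof. by rewrite mulr_ge0 ?sqr_ge0 ?expR_ge0. Qed.

(** Replaces the iterated integrals in the definition of [fock] by integrability on [cspace], where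
    Fubini and dominated convergence are available. *)
Lemma fockP d (f : cfun R d) : fock f <-> entire f /\
  (mu_ d).-integrable setT (EFin \o (fun t => weighted_sq f (cpoint t))).
Proof.
have E : entire f -> intCd_nneg (fock_weight f) = (\int[mu_ d]_t `|(weighted_sq f (cpoint t))%:E|)%E.
  move=> ef; rewrite intCd_nnegE.
  - by apply: eq_integral => t _; rewrite gee0_abs// lee_fin weighted_sq_ge0.
  - by apply: mvecR_weighted_sq; exact: entire_mvec.
  - by move=> z; exact: weighted_sq_ge0.
split => [[ef fi]|[ef /integrableP[_ fi]]]; split => //.
  apply/integrableP; split; last by rewrite -E.
  by apply/measurable_EFinP; apply: mvecR_weighted_sq; [exact: entire_mvec|exact: cmeasv_cpoint].
by rewrite E.
Qed.

Lemma fock_scale d (f : cfun R d) c : fock f -> fock (fun z => c * f z).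
Proof.
move=> /fockP[ef fi]; apply/fockP; split; first exact: entire_scale.
have := integrableZl measurableT (cabs c ^+ 2) fi.
congr (integrable _ _ _); apply/funext => t /=.
by rewrite -EFinM /weighted_sq cabsM exprMn mulrA.
Qed.

Definition ip_density d (f g : cvec d -> C) z : C := f z * conjc (g z) * rc (expR (- cnorm2 z)).

Lemma mvec_ip_density d (f g : cvec d -> C) : mvec f -> mvec g -> mvec (ip_density f g).
Proof.
move=> mf mg dd T Z mZ; apply: cmeasM; last exact: mvec_weight.
by apply: cmeasM; [exact: mf|apply: cmeasJ; exact: mg].
Qed.

Lemma cabs_ip_density d (f g : cvec d -> C) z :
  cabs (ip_density f g z) = cabs (f z) * cabs (g z) * expR (- cnorm2 z).
Proof. by rewrite /ip_density !cabsM cabsJ cabs_real ger0_norm ?expR_ge0. Qed.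

(** Pointwise, |f g| <= |f|^2 + |g|^2. *)
Lemma ip_density_integrable d (f g : cfun R d) : fock f -> fock g ->
  (mu_ d).-integrable setT (fun t => (cabs (ip_density f g (cpoint t)))%:E).
Proof.
move=> /fockP[ef fi] /fockP[eg gi].
apply: (le_integrable _ _ _ (integrableD measurableT fi gi)) => //.
  apply/measurable_EFinP; apply: (mvecR_cabs (mvec_ip_density (entire_mvec ef) (entire_mvec eg))).
  exact: cmeasv_cpoint.
move=> t _ /=; rewrite lee_fin !ger0_norm ?addr_ge0 ?weighted_sq_ge0 ?cabs_ge0//.
rewrite cabs_ip_density /weighted_sq -mulrDl ler_wpM2r ?expR_ge0//.
have := sqr_ge0 (cabs (f (cpoint t)) - cabs (g (cpoint t))); rewrite sqrrB.
have := sqr_ge0 (cabs (f (cpoint t)) + cabs (g (cpoint t))); rewrite sqrrD.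
lra.
Qed.

Lemma ip_density_cre_integrable d (f g : cfun R d) : fock f -> fock g ->
  (mu_ d).-integrable setT (EFin \o (fun t => cre (ip_density f g (cpoint t)))).
Proof.
move=> ff fg; have [ef _] := ff; have [eg _] := fg.
apply: (le_integrable _ _ _ (ip_density_integrable ff fg)) => //.
  by apply/measurable_EFinP; have [] := mvec_ip_density (entire_mvec ef) (entire_mvec eg) (@cmeasv_cpoint R d).
by move=> t _ /=; rewrite lee_fin [leRHS]ger0_norm ?cabs_ge0// ler_cre.
Qed.

Lemma ip_density_cim d (f g : cvec d -> C) z : cim (ip_density f g z) = cre (ip_density (fun z => Complex 0 (-1) * f z) g z).
Proof. by rewrite /ip_density !cE; ring. Qed.

Definition re_ip d (f g : cvec d -> C) : R := Rintegral (mu_ d) setT (fun t => cre (ip_density f g (cpoint t))).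

(** The imaginary part is the real part for - i f, so statements about [re_ip] suffice. *)
Lemma fock_ipE d (f g : cfun R d) : fock f -> fock g ->
  fock_ip f g = Complex ((pi ^+ d)^-1 * re_ip f g)
    ((pi ^+ d)^-1 * re_ip (fun z => Complex 0 (-1) * f z) g).
Proof.
move=> ff fg; have [ef _] := ff; have [eg _] := fg.
have mi := mvec_ip_density (entire_mvec ef) (entire_mvec eg).
have fi := fock_scale (Complex 0 (-1)) ff; have [ei _] := fi.
have mi' := mvec_ip_density (entire_mvec ei) (entire_mvec eg).
rewrite /fock_ip /intCd.
have -> : iter_Rint d.*2 (fun v => cre (f (vec_of_coords d v) * conjc (g (vec_of_coords d v)) *
   rc (expR (- cnorm2 (vec_of_coords d v))))) = re_ip f g.
  by apply: (@iter_Rint_cpoint R d (fun z => cre (ip_density f g z)) (mvecR_cre mi)); exact: ip_density_cre_integrable.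
have -> : iter_Rint d.*2 (fun v => cim (f (vec_of_coords d v) * conjc (g (vec_of_coords d v)) *
   rc (expR (- cnorm2 (vec_of_coords d v))))) = re_ip (fun z => Complex 0 (-1) * f z) g.
  rewrite /re_ip -(@iter_Rint_cpoint R d (fun z => cre (ip_density (fun z => Complex 0 (-1) * f z) g z)) (mvecR_cre mi')).
    by congr (iter_Rint _ _); apply/funext => v; rewrite -ip_density_cim.
  exact: ip_density_cre_integrable.
by apply: cre_cim_inj; rewrite !cE; ring.
Qed.

Definition repker d (a : cvec d) : cvec d -> C := fun u => cexp (cdot u a).

Lemma cdotDl d (x y a : cvec d) : cdot (x + y) a = cdot x a + cdot y a.
Proof. by rewrite /cdot -big_split; apply: eq_bigr => j _; rewrite mxE mulrDl. Qed.
Lemma cdotJ d (x y : cvec d) : conjc (cdot x y) = cdot y x.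
Proof.
rewrite /cdot (rmorph_sum (@conjc R)); apply: eq_bigr => j _.
by rewrite /= conjcM conjcK mulrC.
Qed.
Lemma cdotDr d (x y a : cvec d) : cdot a (x + y) = cdot a x + cdot a y.
Proof. by rewrite -cdotJ cdotDl conjcD !cdotJ. Qed.
Lemma cdotZl d w (x a : cvec d) : cdot (w *: x) a = w * cdot x a.
Proof. by rewrite /cdot mulr_sumr; apply: eq_bigr => j _; rewrite mxE mulrA. Qed.
Lemma cdot0l d (a : cvec d) : cdot 0 a = 0.
Proof. by rewrite -(scale0r a) cdotZl mul0r. Qed.

Lemma entire_repker d (a : cvec d) : entire (repker a).
Proof.
move=> z; exists (\col_j (cexp (cdot z a) * conjc (a j 0))) => e e0.
set S := 1 + \sum_j cabs (a j 0).
have S0 : 0 < S by rewrite ltr_pwDl// sumr_ge0// => j _; exact: cabs_ge0.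
have cd h : cabs (cdot h a) <= S * cnorm h.
  have -> : cdot h a = \sum_(j < d) (\col_j conjc (a j 0)) j 0 * h j 0.
    by apply: eq_bigr => j _; rewrite mxE mulrC.
  apply: (le_trans (cabs_lin_le _ _)); rewrite ler_wpM2r ?cnorm_ge0// /S.
  by under eq_bigr do rewrite mxE cabsJ; rewrite lerDr.
have hder : cderiv (@cexp R) (cdot z a) (cexp (cdot z a)).
  move=> e' e'0; have k0 : 0 < cabs (cexp (cdot z a)) by rewrite cabs_cexp expR_gt0.
  have [d1 [d10 H]] := cderiv_cexp0 (divr_gt0 e'0 k0).
  exists d1; split=> // h /H; rewrite add0r cexp0 mul1r => {}H.
  have -> : cexp (cdot z a + h) - cexp (cdot z a) - cexp (cdot z a) * h = cexp (cdot z a) * (cexp h - 1 - h).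
    by rewrite cexpD; ring.
  by rewrite cabsM mulrC -ler_pdivlMr// mulrAC.
have [dl [dl0 H]] := hder _ (divr_gt0 e0 S0).
exists (dl / S); split; first by rewrite divr_gt0.
move=> h; rewrite ltr_pdivlMr// => hd.
have := H (cdot h a); rewrite mulrC in hd => /(_ (le_lt_trans (cd h) hd)).
rewrite -cdotDl -/(repker a (z + h)) -/(repker a z).
have -> : \sum_(j < d) (\col_j (cexp (cdot z a) * conjc (a j 0))) j 0 * h j 0 = repker a z * cdot h a.
  by rewrite /cdot mulr_sumr; apply: eq_bigr => j _; rewrite mxE /repker; ring.
move=> h1; apply: (le_trans h1); apply: (@le_trans _ _ (e / S * (S * cnorm h))).
  by rewrite ler_wpM2l// divr_ge0// ltW.
by rewrite mulrA divfK// gt_eqF.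
Qed.

Lemma cnorm2D d (x y : cvec d) : cnorm2 (x + y) = cnorm2 x + cnorm2 y + 2 * cre (cdot x y).
Proof.
have : cdot (x + y) (x + y) = cdot x x + cdot y y + (cdot x y + conjc (cdot x y)).
  by rewrite cdotDl !cdotDr cdotJ; ring.
by rewrite !cdotzz => /(congr1 (@cre R)); rewrite !cE => ->; ring.
Qed.

(** Completing the square: translation by [a] centres the Gaussian, which gives the norm of the
    kernel and its membership in the Fock space. *)
Lemma weighted_sq_repker_shift d (a z : cvec d) : weighted_sq (repker a) (z + a) = expR (cnorm2 a) * expR (- cnorm2 z).
Proof.
rewrite /weighted_sq /repker cabs_cexp cdotDl cdotzz !cE cnorm2D -expRM_natl -!expRD; congr expR.
ring.
Qed.

Lemma int_weighted_sq_repker d (a : cvec d) :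
  (\int[mu_ d]_t (weighted_sq (repker a) (cpoint t))%:E = (expR (cnorm2 a) * pi ^+ d)%:E)%E.
Proof.
rewrite -(shift_cspace a (mvecR_weighted_sq (entire_mvec (@entire_repker d a))) (fun z => weighted_sq_ge0 _ z)).
under eq_integral do rewrite weighted_sq_repker_shift EFinM.
rewrite ge0_integralZl//; last first.
- apply/measurable_EFinP; have := @mvecR_gauss R d 1 _ _ _ (@cmeasv_cpoint R d).
  by under eq_fun do rewrite mul1r.
by rewrite int_gauss_pi.
Qed.

Lemma fock_repker d (a : cvec d) : fock (repker a).
Proof.
apply/fockP; split; first exact: entire_repker.
apply/integrableP; split.
  by apply/measurable_EFinP; apply: mvecR_weighted_sq; [exact: entire_mvec (entire_repker a)|exact: cmeasv_cpoint].
under eq_integral do rewrite /= ger0_norm ?weighted_sq_ge0//.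
by rewrite int_weighted_sq_repker ltry.
Qed.

End WeightedSquares.

(** * Reproducing property, growth, and symmetry of the operator *)

Section ReproducingKernels.
Variable R : realType.
Local Notation C := (complex R).
Local Notation rc x := (Complex (x : R) 0).
Local Notation mu_ n := (ms_mu (cspace R n)).
Local Notation cvec := (cvec R).
Local Notation mi := (Complex (0 : R) (-1)).

Lemma preserves_unimodular d (u : C) : cabs u = 1 ->
  preserves (mu_ d) (@cpoint R d) (fun z : cvec d => u *: z).
Proof.
move=> u1; have := @preserves_unitary R d u%:M.
have -> : (fun z : cvec d => u%:M *m z) = (fun z => u *: z).
  by apply/funext => z; rewrite mul_scalar_mx.
apply; apply/matrixP => i j; rewrite mul_scalar_mx !mxE eq_sym.
case: eqP => _; rewrite ?mulr1n ?mulr0n; last by apply: cre_cim_inj; rewrite !cE; ring.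
by rewrite mulcJ u1 expr1n.
Qed.

Lemma integrable_weight d : (mu_ d).-integrable setT (EFin \o (fun t => expR (- cnorm2 (@cpoint R d t)))).
Proof.
apply/integrableP; split.
  apply/measurable_EFinP; have := @mvecR_gauss R d 1 _ _ _ (@cmeasv_cpoint R d).
  by under eq_fun do rewrite mul1r.
under eq_integral do rewrite /= ger0_norm ?expR_ge0//.
by rewrite int_gauss_pi ltry.
Qed.

(* Translate by [a], average over rotations, and apply the mean value property. *)
Lemma re_ip_repker d (f : cfun R d) a : fock f -> re_ip f (repker a) = pi ^+ d * cre (f a).
Proof.
move=> ff; have [ef _] := ff; have [ek _] := fock_repker a.
pose F z : R := cre (ip_density f (repker a) z).
(* After translation, the conjugated kernel and the weight combine to exp(- <z, a>) exp(- |z|^2): a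
   holomorphic factor, kept in [h], and a radial one. *)
pose h z : C := f (z + a) * cexp (- cdot z a).
pose G z : R := cre (h z * rc (expR (- cnorm2 z))).
have FG z : F (z + a) = G z.
  rewrite /F /G /ip_density /h /repker -!mulrA; congr (cre (_ * _)).
  rewrite -!cexp_real -cexpJ -!cexpD; congr cexp.
  rewrite cdotDl cdotzz cnorm2D; apply: cre_cim_inj; rewrite !cE; ring.
have mF : mvecR F by apply: mvecR_cre; apply: mvec_ip_density; apply: entire_mvec.
have mid : mmap (fun z : cvec d => z) by move=> dd T Z.
have mG : mvecR G.
  move=> dd T Z mZ; under eq_fun do rewrite -FG; apply: (mF _ _ (fun t => Z t + a)).
  exact: (mmapD a mid).
have iF : (mu_ d).-integrable setT (EFin \o (fun t => F (cpoint t))) by exact: (ip_density_cre_integrable ff (fock_repker a)).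
have iG : (mu_ d).-integrable setT (EFin \o (fun t => G (cpoint t))).
  have := preserves_integrable (@cmeasv_cpoint R d) (@preserves_shift_cspace R d a) (mmapD a mid) mF iF.
  by congr (integrable _ _ _); apply/funext => t /=; rewrite FG.
have -> : re_ip f (repker a) = Rintegral (mu_ d) setT (fun t => G (cpoint t)).
  rewrite /re_ip -(preserves_Rint (@preserves_shift_cspace R d a) mF).
  by apply: eq_Rintegral => t _; rewrite FG.
have p2 : pi *+ 2 != 0 :> R by rewrite mulrn_eq0 /= gt_eqF// pi_gt0.
apply: (mulfI p2); rewrite -(rot_average (@cmeasv_cpoint R d) (@preserves_unimodular d) mG iG).
have inner w : Rintegral (@lebesgue_measure R) `[0, pi *+ 2] (fun t => G (cis t *: cpoint w)) =
    (pi *+ 2 * cre (f a)) * expR (- cnorm2 (@cpoint R d w)).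
  pose g zt : C := h (zt *: cpoint w) * rc (expR (- cnorm2 (@cpoint R d w))).
  have eg : entire1 g.
    apply: entire1M; last exact: entire1_cst.
    apply: entire1M.
      by under eq_fun do rewrite addrC; exact: entire_line.
    apply: (@entire1_comp R (fun zt => - cdot (zt *: cpoint w) a) (@cexp R)); last exact: entire1_cexp.
    have -> : (fun zt => - cdot (zt *: cpoint w) a) = (fun zt => (- cdot (cpoint w) a) * zt + 0).
      by apply/funext => zt; rewrite cdotZl; ring.
    exact: entire1_affine.
  have := circle_mean 1 eg; rewrite /g /h scale0r add0r cdot0l oppr0 cexp0 mulr1 => E.
  transitivity (pi *+ 2 * cre (f a * rc (expR (- cnorm2 (@cpoint R d w))))); last by rewrite !cE; ring.
  rewrite -E; apply: eq_Rintegral => t _.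
  by rewrite /G /h mulr1 cnorm2Z cabs_cis expr1n mul1r.
under eq_Rintegral do rewrite inner.
rewrite RintegralZl//; last exact: integrable_weight.
by rewrite /Rintegral int_gauss_pi /=; ring.
Qed.

Lemma re_ip_scale d (f g : cfun R d) (c : C) : fock f -> fock g ->
  re_ip (fun z => c * f z) g = cre c * re_ip f g - cim c * re_ip (fun z => mi * f z) g.
Proof.
move=> ff fg; have fi := fock_scale mi ff.
rewrite -mulNr /re_ip.
rewrite -(RintegralZl (cre c) measurableT (ip_density_cre_integrable ff fg)).
rewrite -(RintegralZl (- cim c) measurableT (ip_density_cre_integrable fi fg)).
rewrite -RintegralD//.
- by apply: eq_Rintegral => t _; rewrite /ip_density !cE; ring.
- by have := integrableZl measurableT (cre c) (ip_density_cre_integrable ff fg).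
- by have := integrableZl measurableT (- cim c) (ip_density_cre_integrable fi fg).
Qed.

Lemma fock_ipZl d (f g : cfun R d) (c : C) : fock f -> fock g ->
  fock_ip (fun z => c * f z) g = c * fock_ip f g.
Proof.
move=> ff fg; rewrite !fock_ipE//; last exact: fock_scale.
have -> : (fun z => mi * (c * f z)) = (fun z => (mi * c) * f z) by apply/funext => z; rewrite mulrA.
rewrite (re_ip_scale c ff fg) (re_ip_scale (mi * c) ff fg); apply: cre_cim_inj; rewrite !cE; ring.
Qed.

Lemma fock_ipJ d (f g : cfun R d) : fock f -> fock g -> fock_ip g f = conjc (fock_ip f g).
Proof.
move=> ff fg; rewrite !fock_ipE//.
have E1 : re_ip g f = re_ip f g.
  by apply: eq_Rintegral => t _; rewrite /ip_density !cE; ring.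
have E2 : re_ip (fun z => mi * g z) f = - re_ip (fun z => mi * f z) g.
  have := re_ip_scale (-1) (fock_scale mi ff) fg; rewrite !cE oppr0 mul0r subr0 mulN1r => <-.
  by apply: eq_Rintegral => t _; rewrite /ip_density !cE; ring.
by rewrite E1 E2 mulrN.
Qed.

Lemma fock_ipZr d (f g : cfun R d) (c : C) : fock f -> fock g ->
  fock_ip f (fun z => c * g z) = conjc c * fock_ip f g.
Proof.
move=> ff fg; rewrite fock_ipJ//; last exact: fock_scale.
by rewrite fock_ipZl// conjcM -fock_ipJ.
Qed.

Lemma fock_ip_repker d (f : cfun R d) a : fock f -> fock_ip f (repker a) = f a.
Proof.
move=> ff; have fk := fock_repker a; have fi := fock_scale mi ff.
have p0 : pi ^+ d != 0 :> R by rewrite expf_neq0// gt_eqF// pi_gt0.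
by rewrite fock_ipE// !re_ip_repker// !mulKf//; apply: cre_cim_inj; rewrite !cE; ring.
Qed.

(* Reproducing property and AM-GM with the weight [exp(|a|^2 / 2)]. *)
Lemma fock_growth d (f : cfun R d) : fock f ->
  exists K : R, forall z, cabs (f z) <= K * expR (cnorm2 z / 2).
Proof.
move=> ff; have [ef fi] := (fockP f).1 ff.
pose N := Rintegral (mu_ d) setT (fun t => weighted_sq f (cpoint t)).
have p0 : 0 < pi ^+ d :> R by rewrite exprn_gt0// pi_gt0.
have N0 : 0 <= N by rewrite /N Rintegral_ge0// => t _; exact: weighted_sq_ge0.
exists ((N + pi ^+ d) / (2 * pi ^+ d)) => a.
set s := expR (cnorm2 a / 2); have s0 : 0 < s by exact: expR_gt0.
have [->|fa0] := eqVneq (f a) 0.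
  by rewrite cabs0 mulr_ge0 ?divr_ge0 ?addr_ge0 ?mulr_ge0 ?(ltW p0) ?(ltW s0).
have A0 : 0 < cabs (f a).
  by rewrite lt_neqAle cabs_ge0 andbT eq_sym; apply: contra_neq fa0 => /cabs_eq0.
(* Makes c f(a) = |f(a)|^2 real, so that the real part of the pairing loses nothing. *)
pose c := conjc (f a).
have fc := fock_scale c ff; have fk := fock_repker a.
have [ek ki] := (fockP _).1 fk.
have Nk : Rintegral (mu_ d) setT (fun t => weighted_sq (repker a) (cpoint t)) = s ^+ 2 * pi ^+ d.
  by rewrite /Rintegral int_weighted_sq_repker /= /s -expRM_natl; congr (expR _ * _); field.
have is1 : (mu_ d).-integrable setT (EFin \o (fun t => (cabs (f a) * s / 2) * weighted_sq f (cpoint t))).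
  by have := integrableZl measurableT (cabs (f a) * s / 2) fi.
have is2 : (mu_ d).-integrable setT (EFin \o (fun t => (cabs (f a) / s / 2) * weighted_sq (repker a) (cpoint t))).
  by have := integrableZl measurableT (cabs (f a) / s / 2) ki.
have : re_ip (fun z => c * f z) (repker a) <= Rintegral (mu_ d) setT
    (fun t => (cabs (f a) * s / 2) * weighted_sq f (cpoint t) + (cabs (f a) / s / 2) * weighted_sq (repker a) (cpoint t)).
  apply: le_Rintegral => //.
  - exact: (ip_density_cre_integrable fc fk).
  - by have := integrableD measurableT is1 is2.
  move=> t _; apply: (le_trans (ler_norm _)); apply: (le_trans (ler_cre _)).
  rewrite cabs_ip_density cabsM cabsJ /weighted_sq.
  set x := cabs (f (cpoint t)); set y := cabs (repker a (cpoint t)).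
  have -> : cabs (f a) * s / 2 * (x ^+ 2 * expR (- cnorm2 (cpoint t))) + cabs (f a) / s / 2 * (y ^+ 2 * expR (- cnorm2 (cpoint t)))
     = cabs (f a) * x * y * expR (- cnorm2 (cpoint t)) + cabs (f a) * expR (- cnorm2 (cpoint t)) / (2 * s) * (s * x - y) ^+ 2.
    by field; rewrite gt_eqF.
  by rewrite lerDl mulr_ge0 ?sqr_ge0// divr_ge0 ?mulr_ge0 ?expR_ge0 ?ltW// mulr_gt0.
rewrite re_ip_repker// RintegralD// !RintegralZl// Nk -/N.
have -> : cre (c * f a) = cabs (f a) * cabs (f a) by rewrite mulrC mulcJ expr2.
have -> : cabs (f a) * s / 2 * N + cabs (f a) / s / 2 * (s ^+ 2 * pi ^+ d) =
  cabs (f a) * (pi ^+ d * ((N + pi ^+ d) / (2 * pi ^+ d) * s)).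
  by field; rewrite !gt_eqF// pi_gt0.
by rewrite mulrCA ler_pM2l// ler_pM2l.
Qed.

Lemma fock_vgrowth d (f : cfun R d) : fock f -> vgrowth f.
Proof. by move=> ff; split; [apply: entire_line_entire; have [] := ff|exact: fock_growth]. Qed.

Definition wexp d (Q : 'M[C]_d) (q : cvec d) : cfun R d -> cfun R d :=
  wcomp (fun z => cexp (cdot z q)) (fun z => Q *m z + q).

(** Membership of the images of [f] and [g] in the Fock space supplies the integrability of the two
    densities. Multiplication by -i commutes with the operator, so the imaginary part reduces to the
    real one. *)
Lemma wexp_sym d (Q : 'M[C]_d) (q : cvec d) (f g : cfun R d) : Q = adjmx Q ->
  fock f -> fock g -> fock (wexp Q q f) -> fock (wexp Q q g) ->
  fock_ip (wexp Q q f) g = fock_ip f (wexp Q q g).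
Proof.
move=> hQ ff fg fEf fEg; rewrite !fock_ipE//.
have H (f' : cfun R d) : fock f' -> fock (wexp Q q f') -> re_ip (wexp Q q f') g = re_ip f' (wexp Q q g).
  move=> f1 f2; apply: (herm_sym hQ (fock_vgrowth f1) (fock_vgrowth fg)).
    exact: (ip_density_integrable f2 fg).
  exact: (ip_density_integrable f1 fEg).
have Ei : (fun z => mi * wexp Q q f z) = wexp Q q (fun z => mi * f z).
  by apply/funext => z; rewrite /wexp /wcomp mulrCA.
rewrite H// Ei H//; first exact: fock_scale.
by rewrite -Ei; exact: fock_scale.
Qed.

End ReproducingKernels.

(** * Real and skew-real symmetry *)

Section Symmetry.
Variable R : realType.
Local Notation C := (complex R).
Local Notation cvec := (cvec R).

(** Both symmetries in one: [s = 1] makes the operator its own adjoint, [s = -1] the negative of its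
    adjoint. *)
Definition op_eq_sgn d (s : C) (D : set (cfun R d)) (A : cfun R d -> cfun R d) : Prop :=
  forall g h : cfun R d, (D g /\ h = A g) <-> adjoint_graph D A g (fun z => s * h z).

Lemma op_eq_adjE d (D : set (cfun R d)) A : op_eq_adj D A <-> op_eq_sgn 1 D A.
Proof.
have E (h : cfun R d) : (fun z => 1 * h z) = h by apply/funext => z; rewrite mul1r.
by split=> H g h; rewrite H E.
Qed.

Lemma op_eq_neg_adjE d (D : set (cfun R d)) A : op_eq_neg_adj D A <-> op_eq_sgn (-1) D A.
Proof.
have E (h : cfun R d) : (fun z => -1 * h z) = (fun z => - h z) by apply/funext => z; rewrite mulN1r.
by split=> H g h; rewrite H E.
Qed.

Lemma entire1_sum n (F : 'I_n -> C -> C) : (forall j, entire1 (F j)) ->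
  entire1 (fun w => \sum_(j < n) F j w).
Proof.
elim: n F => [|n IH] F eF.
  by under eq_fun do rewrite big_ord0; exact: entire1_cst.
under eq_fun do rewrite big_ord_recl.
by apply: entire1D => //; exact: (IH (fun j => F (lift ord0 j))).
Qed.

Lemma cdotNl d (x y : cvec d) : cdot (- x) y = - cdot x y.
Proof. by rewrite -scaleN1r cdotZl mulN1r. Qed.
Lemma cdotNr d (x y : cvec d) : cdot x (- y) = - cdot x y.
Proof. by rewrite -cdotJ cdotNl conjcN cdotJ. Qed.

Lemma cdot_ei d (x : cvec d) i : cdot x (\col_j (j == i)%:R) = x i 0.
Proof.
rewrite /cdot (bigD1 i)//= mxE eqxx conjc1 mulr1 big1 ?addr0// => j ji.
by rewrite mxE (negbTE ji) conjc0 mulr0.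
Qed.

(** Symmetry forces linearity: the i-th coordinate of chi z is <chi z, e_i> = <z, chi e_i>. *)
Lemma cdot_symmetric_mx d (chi : cvec d -> cvec d) :
  (forall u z, cdot (chi u) z = cdot u (chi z)) ->
  exists2 Q : 'M[C]_d, Q = adjmx Q & forall z, chi z = Q *m z.
Proof.
move=> H; pose e i : cvec d := \col_j (j == i)%:R.
exists (\matrix_(i, j) conjc (chi (e i) j 0)).
  apply/matrixP => i j; rewrite !mxE conjcK.
  by rewrite -(cdot_ei (chi (e j)) i) H -cdotJ cdot_ei.
move=> z; apply/matrixP => i k; rewrite ord1 mxE -(cdot_ei (chi z) i) H.
by apply: eq_bigr => j _; rewrite mxE mulrC.
Qed.

(** Otherwise, up to sign, [h] takes by the intermediate value theorem a value in ]0, 1], where the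
    cosine is below 1 because 1 < pi. *)
Lemma cos_eq1_const (h : R -> R) : continuous h -> h 0 = 0 ->
  (forall t, cos (h t) = 1) -> h 1 = 0.
Proof.
move=> hc h0 hcos; apply/eqP/negPn/negP => h10.
wlog hp : h hc h0 hcos h10 / 0 < h 1.
  move=> W; case: (ltgtP (h 1) 0) h10 => // h1 _; last by apply: (W h) => //; rewrite gt_eqF.
  apply: (W (fun t => - h t)); rewrite ?h0 ?oppr0 ?oppr_eq0 ?oppr_gt0 ?lt_eqF//.
    by move=> t; apply: continuousN; exact: hc.
  by move=> t; rewrite cosN.
pose v := Num.min (h 1) 1.
have v0 : 0 < v by rewrite lt_min hp ltr01.
have [||t _ htv] := @IVT R h 0 1 v ler01.
- by apply: continuous_subspaceT.
- have vh : v <= h 1 by rewrite ge_min lexx.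
  by rewrite h0 ge_min le_max vh (ltW v0) orbT.
have := hcos t; rewrite htv.
have v1 : v <= 1 by rewrite ge_min lexx orbT.
have p2 : (2 : R) <= pi by exact: pi_ge2.
have : cos v < cos 0 by rewrite ltr_cos ?in_itv//=; apply/andP; split; lra.
by rewrite cos0 => /lt_eqF /eqP.
Qed.

Section Forward.
Variables (d : nat) (psi : cfun R d) (phi : cvec d -> cvec d) (s : C) (D : set (cfun R d)).
Hypotheses (s2 : s * s = 1) (hphi : holo_map phi).
Hypothesis psi0 : psi <> (fun _ => 0).
Hypothesis DA : D `<=` cmax_dom psi phi.
Hypothesis opD : op_eq_sgn s D (wcomp psi phi).

(** For f in the domain, <Cf, K_z> = psi(z) f(phi z) is the pairing of f with conj(psi z) times the
    kernel at phi z. Hence K_z lies in the domain of the adjoint, thus in [D], and C K_z is s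
    conj(psi z) times the kernel at phi z. *)
Lemma kernel_identity u z :
  psi u * cexp (cdot (phi u) z) = s * (conjc (psi z) * cexp (cdot u (phi z))).
Proof.
pose h : cfun R d := fun u => s * (conjc (psi z) * repker (phi z) u).
have E : (fun u => s * h u) = (fun u => conjc (psi z) * repker (phi z) u).
  by apply/funext => v; rewrite /h mulrA s2 mul1r.
have : adjoint_graph D (wcomp psi phi) (repker z) (fun u => s * h u).
  rewrite E; split; first exact: fock_repker.
  split; first by apply: fock_scale; exact: fock_repker.
  move=> f /DA[ff fAf]; rewrite fock_ip_repker// fock_ipZr//; last exact: fock_repker.
  by rewrite fock_ip_repker// conjcK.
by move=> /opD[_ /(congr1 (fun F : cfun R d => F u))]; rewrite /h /wcomp => <-.
Qed.

Lemma psi0_sgn : psi 0 = s * conjc (psi 0).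
Proof.
have := kernel_identity 0 0; rewrite cdot0l -(cdotJ 0) cdot0l conjc0 cexp0.
by rewrite !mulr1.
Qed.

Lemma psi_exp u : psi u = psi 0 * cexp (cdot u (phi 0)).
Proof.
have := kernel_identity u 0.
by rewrite -(cdotJ 0) cdot0l conjc0 cexp0 mulr1 mulrA -psi0_sgn.
Qed.

Lemma psi0_neq0 : psi 0 != 0.
Proof.
apply/eqP => p0; apply: psi0.
by apply/funext => z; rewrite psi_exp p0 mul0r.
Qed.

Let chi z := phi z - phi 0.

Lemma cexp_chi u z : cexp (cdot (chi u) z - cdot u (chi z)) = 1.
Proof.
have := kernel_identity u z; rewrite (psi_exp u) (psi_exp z) conjcM.
rewrite [RHS](_ : _ = psi 0 * (conjc (cexp (cdot z (phi 0))) * cexp (cdot u (phi z)))); last first.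
  by rewrite {2}psi0_sgn !mulrA.
rewrite -mulrA => /(mulfI psi0_neq0); rewrite -cexpJ cdotJ -!cexpD => E.
apply: (mulIf (cexp_neq0 (cdot (phi 0) z + cdot u (phi z)))).
rewrite mul1r -cexpD -E; congr cexp; rewrite /chi cdotDl cdotDr cdotNl cdotNr.
ring.
Qed.

Lemma chi_sym u z : cdot (chi u) z = cdot u (chi z).
Proof.
pose B v := cdot (chi v) z - cdot v (chi z).
(* The modulus of exp(B v) = 1 fixes the real part; the imaginary part is known only modulo 2 pi,
   hence the passage to a line. *)
have reB v : cre (B v) = 0.
  have := cexp_chi v z => /(congr1 (@cabs R)); rewrite cabs_cexp cabs1 => /(congr1 (@ln R)).
  by rewrite expRK ln1.
pose g w := B (w *: u).
have eg : entire1 g.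
  have -> : g = (fun w => \sum_(j < d) (phi (0 + w *: u) j 0 - phi 0 j 0) * conjc (z j 0)
                  + (- cdot u (chi z) * w + 0)).
    apply/funext => w; rewrite /g /B cdotZl addr0 add0r; congr (_ + _); last by ring.
    by apply: eq_bigr => j _; rewrite /chi !mxE.
  apply: entire1D; last exact: entire1_affine.
  apply: (@entire1_sum d (fun j w => (phi (0 + w *: u) j 0 - phi 0 j 0) * conjc (z j 0))) => j.
  apply: entire1M; last exact: entire1_cst.
  apply: (@entire1D R (fun w => phi (0 + w *: u) j 0)); last exact: entire1_cst.
  by have := entire_line 0 u (hphi j).
have imB : cim (g 1) = 0.
  apply: (@cos_eq1_const (fun t => cim (g (Complex t 0)))).
  - by apply: (entire1_continuous_im eg) => x h; exact: line_lip_re.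
  - rewrite (_ : Complex 0 0 = 0)// /g /B !scale0r cdot0l /chi subrr cdot0l subrr.
    by [].
  move=> t; have := cexp_chi (Complex t 0 *: u) z => /(congr1 (@cre R)).
  by rewrite -/(B _) /cexp /= reB expR0 mul1r.
by apply/eqP; rewrite -subr_eq0; apply/eqP; apply: cre_cim_inj; [exact: reB|by move: imB; rewrite /g scale1r].
Qed.

Lemma affine_of_sgn : exists (Q : 'M[C]_d) (q : cvec d),
  affine_form psi phi (psi 0) Q q.
Proof.
have [Q hQ EQ] := cdot_symmetric_mx chi_sym.
exists Q, (phi 0); split=> //; split=> z; first exact: psi_exp.
by rewrite -EQ subrK.
Qed.

End Forward.

Section Backward.
Variables (d : nat) (psi : cfun R d) (phi : cvec d -> cvec d) (s th : C).
Variables (Q : 'M[C]_d) (q : cvec d).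
Hypotheses (s2 : s * s = 1) (th_s : th = s * conjc th) (th0 : th != 0).
Hypothesis aff : affine_form psi phi th Q q.

Lemma wcomp_wexp f : wcomp psi phi f = (fun z => th * wexp Q q f z).
Proof.
have [_ [psiE phiE]] := aff.
by apply/funext => z; rewrite /wexp /wcomp psiE phiE mulrA.
Qed.

Lemma fock_wexp f : fock (wcomp psi phi f) -> fock (wexp Q q f).
Proof.
move=> /(fock_scale th^-1); congr (fock _); apply/funext => z.
by rewrite wcomp_wexp mulKf.
Qed.

(** As [Q] is Hermitian, <u, q> + <Q u + q, z> = <q, z> + <u, Q z + q>: kernels go to multiples of
    kernels, hence lie in the maximal domain. *)
Lemma wcomp_repker z : wcomp psi phi (repker z) = (fun u => (th * cexp (cdot q z)) * repker (phi z) u).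
Proof.
have [hQ [_ phiE]] := aff.
apply/funext => u; rewrite wcomp_wexp /wexp /wcomp /repker -mulrA -!cexpD phiE.
rewrite cdotDl cdotMl -hQ cdotDr; congr (_ * cexp _); ring.
Qed.

Lemma cmax_op_eq_sgn : op_eq_sgn s (cmax_dom psi phi) (wcomp psi phi).
Proof.
have [hQ [psiE phiE]] := aff => g h; split=> [[[fg fAg] ->]|[fg [fh H]]].
  split=> //; split=> [|f [ff fAf]]; first exact: fock_scale.
  have fEf := fock_wexp fAf; have fEg := fock_wexp fAg.
  rewrite fock_ipZr// !wcomp_wexp fock_ipZl// fock_ipZr// mulrA; congr (_ * _); last exact: wexp_sym.
  (* Conjugating [th] costs exactly the sign [s]. *)
  rewrite -conjcM.
  have -> : s * th = conjc th by rewrite {1}th_s mulrA s2 mul1r.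
  by rewrite conjcK.
have fh' : fock h.
  by have := fock_scale s fh; congr (fock _); apply/funext => z; rewrite mulrA s2 mul1r.
have hE : h = wcomp psi phi g.
  apply/funext => z; have fk := fock_repker z; have fkp := fock_repker (phi z).
  have ck : cmax_dom psi phi (repker z).
    by split=> //; rewrite wcomp_repker; exact: fock_scale.
  have := H _ ck; rewrite wcomp_repker fock_ipZl//.
  rewrite [fock_ip (repker (phi z)) g]fock_ipJ// fock_ip_repker// [RHS]fock_ipJ// fock_ip_repker// => E.
  have := congr1 (@conjc R) E; rewrite !conjcM !conjcK -cexpJ cdotJ => {}E.
  apply: (mulfI (_ : s != 0)).
    by apply/eqP => s0; move: s2; rewrite s0 mul0r => /eqP; rewrite eq_sym oner_eq0.
  by rewrite -E /wcomp psiE {2}th_s !mulrA s2 mul1r.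
by split=> //; split=> //; rewrite -hE.
Qed.

(** Shrinking the domain enlarges the adjoint. The maximal operator, up to sign its own adjoint, is
    therefore contained in the adjoint of the restriction, which is the restriction up to the same
    sign. *)
Lemma op_eq_sgn_cmax (D : set (cfun R d)) : D `<=` cmax_dom psi phi ->
  op_eq_sgn s D (wcomp psi phi) -> D = cmax_dom psi phi.
Proof.
move=> DA opD; apply/seteqP; split=> // g Ag.
have [fg [fh H]] := (cmax_op_eq_sgn g _).1 (conj Ag erefl).
by have [] := (opD g _).2 (conj fg (conj fh (fun f Df => H f (DA f Df)))).
Qed.

End Backward.

(** [i] parametrises the solutions of w = s conj(w), real numbers for [s = 1] and imaginary ones for
    [s = -1]; the kernel identity at the origin imposes this equation on psi(0). *)
Lemma op_eq_sgn_iff d (psi : cfun R d) (phi : cvec d -> cvec d) (s : C) (i : R -> C) :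
  s * s = 1 -> (forall w, w = s * conjc w <-> exists t, w = i t) ->
  psi <> (fun _ => 0) -> holo_map phi ->
  forall D : set (cfun R d), D `<=` cmax_dom psi phi ->
  op_eq_sgn s D (wcomp psi phi) <-> D = cmax_dom psi phi /\
    exists (Q : 'M[C]_d) (q : cvec d) (t : R), affine_form psi phi (i t) Q q.
Proof.
move=> s2 iP psi0 hphi D DA; split=> [opD|[-> [Q [q [t aff]]]]].
  have [Q [q aff]] := affine_of_sgn s2 hphi psi0 DA opD.
  have ths := psi0_sgn s2 DA opD.
  split; first exact: (op_eq_sgn_cmax s2 ths (psi0_neq0 s2 psi0 DA opD) aff).
  by have [t Et] := (iP _).1 ths; exists Q, q, t; rewrite -Et.
have ths : i t = s * conjc (i t) by apply/iP; exists t.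
apply: (cmax_op_eq_sgn s2 ths _ aff); apply/eqP => it0; apply: psi0.
by apply/funext => z; have [_ [-> _]] := aff; rewrite it0 mul0r.
Qed.

Lemma eq_conjc_real (w : C) : w = 1 * conjc w <-> exists t, w = Complex t 0.
Proof.
split=> [/(congr1 (@cim R))|[t ->]]; last by apply: cre_cim_inj; rewrite !cE; ring.
by rewrite !cE => H; exists (cre w); apply: cre_cim_inj; rewrite !cE//; lra.
Qed.

Lemma eq_conjc_imaginary (w : C) : w = -1 * conjc w <-> exists t, w = Complex 0 t.
Proof.
split=> [/(congr1 (@cre R))|[t ->]]; last by apply: cre_cim_inj; rewrite !cE; ring.
by rewrite !cE => H; exists (cim w); apply: cre_cim_inj; rewrite !cE//; lra.
Qed.

End Symmetry.

Theorem theorem1p1 (R : realType) (d : nat) (hd : (0 < d)%N)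
  (psi : cfun R d) (phi : cvec R d -> cvec R d)
  (hpsi : entire psi) (hpsi0 : psi <> (fun _ => 0)) (hphi : holo_map phi) :
  (* (a) *)
  ((op_eq_adj (cmax_dom psi phi) (wcomp psi phi) <->
      exists (Q : 'M[complex R]_d) (q : cvec R d) (t : R),
        affine_form psi phi (Complex t 0) Q q) /\
   (op_eq_neg_adj (cmax_dom psi phi) (wcomp psi phi) <->
      exists (Q : 'M[complex R]_d) (q : cvec R d) (t : R),
        affine_form psi phi (Complex 0 t) Q q)) /\
  (* (b) *)
  (forall D : set (cfun R d), is_subspace D -> D `<=` cmax_dom psi phi ->
    (op_eq_adj D (wcomp psi phi) <->
      D = cmax_dom psi phi /\
      exists (Q : 'M[complex R]_d) (q : cvec R d) (t : R),
        affine_form psi phi (Complex t 0) Q q) /\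
    (op_eq_neg_adj D (wcomp psi phi) <->
      D = cmax_dom psi phi /\
      exists (Q : 'M[complex R]_d) (q : cvec R d) (t : R),
        affine_form psi phi (Complex 0 t) Q q)).
Proof.
have H1 := op_eq_sgn_iff (mul1r 1) (@eq_conjc_real R) hpsi0 hphi.
have sN1 : -1 * -1 = 1 :> complex R by rewrite mulrNN mulr1.
have H2 := op_eq_sgn_iff sN1 (@eq_conjc_imaginary R) hpsi0 hphi.
split; last first.
  move=> D _ DA; split; first exact: (iff_trans (op_eq_adjE _ _) (H1 D DA)).
  exact: (iff_trans (op_eq_neg_adjE _ _) (H2 D DA)).
split.
  (* The maximal domain is itself an admissible [D], for which the condition on [D] holds
     trivially. *)
  apply: (iff_trans (op_eq_adjE _ _)); apply: (iff_trans (H1 _ (fun f => id))).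
  by split=> [[]|].
apply: (iff_trans (op_eq_neg_adjE _ _)); apply: (iff_trans (H2 _ (fun f => id))).
by split=> [[]|].
Qed.
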